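(* Let $f\in\mathbb{R}[x,y,z]$ and let $A,B,C\subset\mathbb{R}$ be finite sets of size $n$. Either $$|f(A\times B\times C)|=\Omega(n^{3/2}),$$ with the constant of proportionality depending only on the degree of $f$, or $f$ has one of the forms $$f=g(h(x)+k(y)+l(z))\quad\text{or}\quad f=g(h(x)\cdot k(y)\cdot l(z)),$$ for some univariate polynomials $g,h,k,l\in\mathbb{R}[t]$.
   Context: $f(A\times B\times C)=\{f(a,b,c)\mid a\in A,\ b\in B,\ c\in C\}$. The notation $\Omega(n^{3/2})$ means at least $c\,n^{3/2}$ for a constant $c>0$, here depending only on $\deg f$ (and not on $n,A,B,C$). *)

(* Defs.v *)
From HB Require Import structures.
From mathcomp Require Import all_boot all_order all_algebra.
From mathcomp Require Import finmap mpoly.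
From mathcomp Require Import reals.
(* Not imported: the notations of analysis clash with those of mpoly. *)
From mathcomp Require exp.

Set Implicit Arguments.
Unset Strict Implicit.
Unset Printing Implicit Defensive.

Import Order.TTheory GRing.Theory Num.Theory.

Local Open Scope ring_scope.

(* [msize f] is one more than the total degree of f when f != 0, and 0 when
   f = 0; the zero polynomial thus gets degree 0. *)
Definition total_degree (R : nzRingType) (f : {mpoly R[3]}) : nat :=
  (msize f).-1.

Definition eval3 (R : comNzRingType) (f : {mpoly R[3]}) (a b c : R) : R :=
  f.@[tnth [tuple a; b; c]].

Definition image3 (R : realType) (f : {mpoly R[3]}) (A B C : {fset R}) :
    {fset R} :=
  [fset eval3 f p.1.1 p.1.2 p.2 | p in ((A `*` B) `*` C)%fset]%fset.

Definition Xvar (R : nzRingType) : {mpoly R[3]} := 'X_(inord 0).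
Definition Yvar (R : nzRingType) : {mpoly R[3]} := 'X_(inord 1).
Definition Zvar (R : nzRingType) : {mpoly R[3]} := 'X_(inord 2).

Definition compose (R : comNzRingType) (g : {poly R}) (u : {mpoly R[3]}) :
    {mpoly R[3]} :=
  horner_alg u g.

Definition additive_form (R : comNzRingType) (f : {mpoly R[3]}) : Prop :=
  exists g h k l : {poly R},
    f = compose g
          (compose h (Xvar R) + compose k (Yvar R) + compose l (Zvar R)).

Definition multiplicative_form (R : comNzRingType) (f : {mpoly R[3]}) : Prop :=
  exists g h k l : {poly R},
    f = compose g
          (compose h (Xvar R) * compose k (Yvar R) * compose l (Zvar R)).

(* Main.v *)
(** Let D be the image. Cut A, B, C, listed increasingly, into blocks of about
    sqrt n consecutive elements. A polynomial of bounded degree has boundedly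
    many interior local extrema up to perturbation, so the pairs (open box of a
    grid of blocks, value v in D taken in that box) number O(sqrt n |D| + n).

    If two slices f(., ., z), f(., ., z') have a nonzero Jacobian, then, by a
    Bezout bound for nonsingular common zeros, few triples (x, y, z) of one box
    and one value v share the polynomial f(x, y, .), while distinct polynomials
    f(x, y, .) agree in at most deg f points. Cauchy-Schwarz against the count of
    boxes gives |D| >= c n^(3/2).

    If f depends on x, y only, Cauchy-Schwarz produces many quadruples with
    f(x, y) = f(x', y'), x, x' in one block and y, y' in one block. These are
    incidences between the points (x, x') and the curves f(., y) = f(., y'),
    which are bounded by a Szemeredi-Trotter argument, unless
    f_xy / (f_x f_y) is algebraically dependent on f.

    In the remaining cases the ratios of the partial derivatives split into
    univariate factors, so that f and its coefficients solve
    a1(x) b2(y) f_x = a2(x) b1(y) f_y. The polynomial solutions of this equation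
    are the g(h(x) + k(y)), or the g(h(x) k(y)), for fixed h, k: compare leading
    coefficients and subtract powers of a minimal solution. Treating the third
    variable in the same way yields the two exceptional forms. *)

Require Import Defs.
From HB Require Import structures.
From mathcomp Require Import all_boot all_order all_algebra.
From mathcomp Require Import finmap mpoly.
From mathcomp Require Import reals.
From mathcomp Require exp.
From mathcomp Require Import boolp polyXY polyrcf zify ring lra.
From mathcomp Require all_classical all_analysis.

Set Implicit Arguments.
Unset Strict Implicit.
Unset Printing Implicit Defensive.

Import Order.TTheory GRing.Theory Num.Theory.

Local Open Scope ring_scope.

(** * Bivariate polynomials and elimination *)

(** The exponent comes from the block length s = sqrt n. Quadruples confined to blocks are
    incidences between about s^3 points and s^3 curves, hence O(s^4) in number, and Cauchy-Schwarz
    for the s^4 pairs (x, y) reads s^8 <= O(s |D| + s^2) O(s^4). Without blocks the same count would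
    only give n^(4/3). Two obstacles shape the rest. The constants may depend on the degree alone,
    so common zeros and fibres are bounded by counting dimensions ([elimination]), uniformly in f;
    degenerate fibres are avoided by passing to a small generic value, and exceptional coordinates
    are roots of a polynomial of bounded degree, deleted beforehand. Secondly, the curves f(., y) =
    f(., y') may coincide or share components, so two curves need not have few common points. The
    bound is therefore asked only for transversal pairs of points on a curve: few curves pass
    through such a pair, while f_xy / (f_x f_y) controls the nontransversal pairs. The cells of the
    incidence argument come from ranks of monotone arcs on vertical lines, which needs no topology
    of the plane. *)

Lemma card_set_sum (T : finType) (P : pred T) : #|[set t | P t]| = (\sum_t (P t : nat))%N.
Proof. by rewrite -sum1_card big_mkcond; apply: eq_bigr => t _; rewrite inE; case: (P t). Qed.

Lemma card_setX_sum (T U : finType) (P : T -> U -> bool) :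
  #|[set t : T * U | P t.1 t.2]| = (\sum_t #|[set u | P t u]|)%N.
Proof.
by rewrite card_set_sum -(pair_bigA _ (fun t u => P t u : nat)) /=; apply: eq_bigr => t _; rewrite card_set_sum.
Qed.

(* In [g.[x, y]] the first argument is substituted for the outer variable ['X] of [{poly {poly R}}]
   and the second one for the inner variable ['Y]. *)
Definition bideg_le (R : nzRingType) (d : nat) (g : {poly {poly R}}) : bool :=
  (size g <= d.+1)%N && (sizeY g <= d.+1)%N.

Section BidegComRing.
Variable R : comNzRingType.
Implicit Types g h : {poly {poly R}}.

Lemma bideg_le_swap d g : bideg_le d (swapXY g) = bideg_le d g.
Proof. by rewrite /bideg_le !sizeYE swapXYK andbC. Qed.

Lemma bideg_leW d e g : (d <= e)%N -> bideg_le d g -> bideg_le e g.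
Proof.
by move=> de /andP[g1 g2]; apply/andP; split; [apply: leq_trans g1 _|apply: leq_trans g2 _].
Qed.

Lemma bideg_leD d g h : bideg_le d g -> bideg_le d h -> bideg_le d (g + h).
Proof.
have A (u v : {poly {poly R}}) : (size u <= d.+1)%N -> (size v <= d.+1)%N ->
    (size (u + v)%R <= d.+1)%N.
  by move=> u1 v1; apply: leq_trans (size_polyD _ _) _; rewrite geq_max u1.
case/andP=> g1 g2 /andP[h1 h2]; apply/andP; split; first exact: A.
by move: g2 h2; rewrite !sizeYE rmorphD; exact: A.
Qed.

Lemma bideg_leN d g : bideg_le d (- g) = bideg_le d g.
Proof. by rewrite /bideg_le !sizeYE rmorphN !size_polyN. Qed.

Lemma bideg_leB d g h : bideg_le d g -> bideg_le d h -> bideg_le d (g - h).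
Proof. by move=> ? ?; apply: bideg_leD; rewrite ?bideg_leN. Qed.

Lemma bideg_leM d e g h : bideg_le d g -> bideg_le e h -> bideg_le (d + e) (g * h).
Proof.
have A (u v : {poly {poly R}}) : (size u <= d.+1)%N -> (size v <= e.+1)%N ->
    (size (u * v)%R <= (d + e).+1)%N.
  by move=> u1 v1; apply: leq_trans (size_polyMleq _ _) _; lia.
case/andP=> g1 g2 /andP[h1 h2]; apply/andP; split; first exact: A.
by move: g2 h2; rewrite !sizeYE rmorphM; exact: A.
Qed.

Lemma bideg_leCC d c : bideg_le d (c%:P%:P : {poly {poly R}}).
Proof.
rewrite /bideg_le sizeYE swapXY_polyC map_polyC.
by rewrite (leq_trans (size_polyC_leq1 _)).
Qed.

Lemma bideg_le0 d : bideg_le d (0 : {poly {poly R}}).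
Proof. by have := bideg_leCC d 0; rewrite !polyC0. Qed.

Lemma bideg_leX d k g : bideg_le d g -> bideg_le (d * k) (g ^+ k).
Proof.
move=> gd; elim: k => [|k IH]; first by rewrite expr0 muln0 -!polyC1 bideg_leCC.
by rewrite exprS mulnS; apply: bideg_leM.
Qed.

Lemma bideg_le_sum d (I : Type) (r : seq I) (P : pred I) (F : I -> {poly {poly R}}) :
  (forall i, P i -> bideg_le d (F i)) -> bideg_le d (\sum_(i <- r | P i) F i).
Proof.
by move=> H; elim/big_rec: _ => [|i g Pi gd]; rewrite ?bideg_le0 ?bideg_leD ?H.
Qed.

Lemma bideg_le_X d : bideg_le d.+1 ('X : {poly {poly R}}).
Proof. by rewrite /bideg_le sizeYE swapXY_X size_polyX (leq_trans (size_polyC_leq1 _)). Qed.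

Lemma bideg_le_Y d : bideg_le d.+1 ('Y : {poly {poly R}}).
Proof. by rewrite -bideg_le_swap swapXY_Y bideg_le_X. Qed.

Definition dX g := g^`().
Definition dY g : {poly {poly R}} := map_poly (@deriv R) g.

Lemma coef_dY g i : (dY g)`_i = (g`_i)^`().
Proof. by rewrite /dY coef_map_id0 ?deriv0. Qed.

Lemma dY_swap g : dY (swapXY g) = swapXY (dX g).
Proof.
by apply/polyP=> i; apply/polyP=> j; rewrite coef_dY coef_deriv !coef_swapXY /dX coef_deriv coefMn.
Qed.

Lemma dX_swap g : dX (swapXY g) = swapXY (dY g).
Proof. by rewrite -{2}[g]swapXYK dY_swap swapXYK. Qed.

Lemma size_deriv_leq (S : nzRingType) (p : {poly S}) : (size p^`() <= size p)%N.
Proof. by rewrite (leq_trans (size_poly _ _)) ?leq_pred. Qed.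

Lemma bideg_le_dX d g : bideg_le d g -> bideg_le d (dX g).
Proof.
case/andP=> g1 g2; apply/andP; split; first exact: leq_trans (size_deriv_leq _) _.
apply/bigmax_leqP => i _; rewrite /dX coef_deriv.
by apply: leq_trans (leq_trans (max_size_coefXY g i.+1) g2); rewrite -scaler_nat size_scale_leq.
Qed.

Lemma bideg_le_dY d g : bideg_le d g -> bideg_le d (dY g).
Proof. by rewrite -bideg_le_swap => /bideg_le_dX; rewrite dX_swap bideg_le_swap. Qed.

Lemma dYD g h : dY (g + h) = dY g + dY h.
Proof. by apply/polyP=> i; rewrite coefD !coef_dY coefD derivD. Qed.
Lemma dYB g h : dY (g - h) = dY g - dY h.
Proof. by apply/polyP=> i; rewrite coefB !coef_dY coefB derivB. Qed.
Lemma dXD g h : dX (g + h) = dX g + dX h. Proof. exact: derivD. Qed.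
Lemma dXB g h : dX (g - h) = dX g - dX h. Proof. exact: derivB. Qed.
Lemma dXM g h : dX (g * h) = dX g * h + g * dX h. Proof. exact: derivM. Qed.
Lemma dYM g h : dY (g * h) = dY g * h + g * dY h.
Proof.
rewrite -[g]swapXYK -[h]swapXYK -rmorphM !dY_swap dXM rmorphD !rmorphM /=.
by rewrite !swapXYK.
Qed.
Lemma dXC p : dX p%:P = 0. Proof. exact: derivC. Qed.
Lemma dYC p : dY p%:P = (p^`())%:P. Proof. by apply/polyP=> i; rewrite coef_dY !coefC; case: eqP; rewrite ?deriv0. Qed.
Lemma dXY_comm g : dX (dY g) = dY (dX g).
Proof.
by apply/polyP=> i; rewrite coef_dY !coef_deriv coef_dY derivMn.
Qed.

(** Restriction of [g] to the parametrised curve [(u, v)]. Being a ring morphism, it carries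
    polynomial relations to the curve, where [deriv_comp2] is the chain rule. *)
Definition comp2 (u v : {poly R}) (g : {poly {poly R}}) : {poly R} :=
  (map_poly (comp_poly v) g).[u].

Lemma comp2_is_zmod_morphism u v : zmod_morphism (comp2 u v).
Proof. by move=> g h; rewrite /comp2 rmorphB hornerD hornerN. Qed.
Lemma comp2_is_monoid_morphism u v : monoid_morphism (comp2 u v).
Proof.
by split=> [|g h]; rewrite /comp2 ?rmorph1 ?hornerC // rmorphM hornerM.
Qed.
HB.instance Definition _ u v :=
  GRing.isZmodMorphism.Build {poly {poly R}} {poly R} (comp2 u v) (comp2_is_zmod_morphism u v).
HB.instance Definition _ u v :=
  GRing.isMonoidMorphism.Build {poly {poly R}} {poly R} (comp2 u v) (comp2_is_monoid_morphism u v).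

Lemma comp2C u v p : comp2 u v p%:P = p \Po v.
Proof. by rewrite /comp2 map_polyC hornerC. Qed.
Lemma comp2X u v : comp2 u v 'X = u.
Proof. by rewrite /comp2 map_polyX hornerX. Qed.

Lemma horner_comp2 u v g s : (comp2 u v g).[s] = g.[u.[s], v.[s]].
Proof.
elim/poly_ind: g => [|g p IH]; first by rewrite rmorph0 !horner0.
by rewrite rmorphD rmorphM /= comp2X comp2C !hornerE IH horner_comp.
Qed.

Lemma deriv_comp2 u v g :
  (comp2 u v g)^`() = comp2 u v (dX g) * u^`() + comp2 u v (dY g) * v^`().
Proof.
elim/poly_ind: g => [|g p IH].
  by rewrite /dX /dY map_poly0 deriv0 !rmorph0 deriv0 !mul0r addr0.
rewrite dXD dYD dXM dYM dXC dYC addr0.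
rewrite /dX derivX (_ : dY 'X = 0); last first.
  by apply/polyP=> i; rewrite coef_dY coefX; case: (i == 1)%N; rewrite ?derivC ?deriv0 ?coef0.
rewrite !rmorphD !rmorphM /= rmorph1 rmorph0 comp2X !comp2C derivD derivM IH deriv_comp.
rewrite -/(dX _).
ring.
Qed.

End BidegComRing.

Section Domain.
Variable R : numDomainType.

Lemma infinite_root0 (p : {poly R}) (s : seq R) :
  uniq s -> all (root p) s -> (size p <= size s)%N -> p = 0.
Proof.
move=> us rs ps; apply: contraTeq ps => p0; rewrite -ltnNge.
exact: max_poly_roots.
Qed.

Lemma poly_fun0 (p : {poly R}) : (forall x, p.[x] = 0) -> p = 0.
Proof.
move=> p0; apply: (@infinite_root0 p [seq i%:R | i <- iota 0 (size p)]).
- by rewrite map_inj_uniq ?iota_uniq //; apply: (mulrIn (oner_neq0 R)).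
- by apply/allP=> x _; rewrite /root p0.
- by rewrite size_map size_iota.
Qed.

Lemma poly_fun_eq (p q : {poly R}) : (forall x, p.[x] = q.[x]) -> p = q.
Proof. by move=> pq; apply/subr0_eq/poly_fun0 => x; rewrite hornerD hornerN pq subrr. Qed.

Lemma poly2_fun0 (g : {poly {poly R}}) : (forall x y, g.[x, y] = 0) -> g = 0.
Proof.
move=> g0; rewrite -[g]swapXYK; apply/eqP; rewrite swapXY_eq0; apply/eqP.
apply/polyP=> i; rewrite coef0; apply: poly_fun0 => x.
have gx0 : g.[x%:P] = 0 by apply: poly_fun0 => y; apply: g0.
by have := congr1 (fun p : {poly R} => p`_i) gx0; rewrite horner_polyC coef_map coef0.
Qed.

Lemma poly2_fun_eq (g h : {poly {poly R}}) : (forall x y, g.[x, y] = h.[x, y]) -> g = h.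
Proof. by move=> pq; apply/subr0_eq/poly2_fun0 => x y; rewrite !hornerE pq subrr. Qed.

Lemma nonroot (p : {poly R}) : p != 0 -> exists x, p.[x] != 0.
Proof.
move=> p0; pose s := [seq i%:R : R | i <- iota 0 (size p)].
have us : uniq s by rewrite map_inj_uniq ?iota_uniq //; apply: (mulrIn (oner_neq0 R)).
have : ~~ all (root p) s.
  by apply/negP=> rs; move/eqP: p0; apply; apply: infinite_root0 us rs _; rewrite size_map size_iota.
by rewrite -has_predC => /hasP[x _ xr]; exists x.
Qed.

Lemma nonroot2 (g : {poly {poly R}}) : g != 0 -> exists x y, g.[x, y] != 0.
Proof.
rewrite -swapXY_eq0 -lead_coef_eq0 => /nonroot[x gx].
have : g.[x%:P] != 0.
  by apply/eqP=> /(congr1 (fun p : {poly R} => p`_(size (swapXY g)).-1)); rewrite coef0 horner_polyC coef_map; apply/eqP.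
by move=> /nonroot[y]; exists x, y.
Qed.

Lemma char0_mulrn (L : {poly R}) k : L *+ k.+1 = 0 -> L = 0.
Proof.
move/polyP=> H; apply/polyP=> i; move: (H i); rewrite coefMn coef0 => /eqP.
by rewrite mulrn_eq0 => /orP[//|/eqP].
Qed.

Lemma deriv_eq0 (p : {poly R}) : p^`() = 0 -> p = (p`_0)%:P.
Proof.
move=> p0; apply/polyP=> -[|i]; rewrite coefC //=.
have /eqP := congr1 (fun q : {poly R} => q`_i) p0.
by rewrite coef_deriv coef0 mulrn_eq0 /= => /eqP.
Qed.
End Domain.

(** Dimension count: the coefficient tables, flattened to rows of length [B * B], are more numerous
    than their length, so their matrix has a nonzero left kernel. *)
Lemma lin_dep2 (F : fieldType) (T : finType) (B : nat) (P : T -> {poly {poly F}}) :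
  (B * B < #|T|)%N -> (forall t, (size (P t) <= B)%N /\ (sizeY (P t) <= B)%N) ->
  exists c : T -> F, (exists t, c t != 0) /\ \sum_t (c t)%:P%:P * P t = 0.
Proof.
move=> BT PB.
pose M : 'M[F]_(#|T|, B * B) :=
  \matrix_(i, j) (P (enum_val i))`_(j %/ B)`_(j %% B).
have : kermx M != 0.
  rewrite -mxrank_eq0 mxrank_ker -lt0n subn_gt0.
  exact: leq_ltn_trans (rank_leq_col _) BT.
case/rowV0Pn=> v /sub_kermxP vM v0.
exists (fun t => v 0 (enum_rank t)); split.
  have /rV0Pn[i vi] := v0.
  by exists (enum_val i); rewrite enum_valK.
apply/polyP=> a; apply/polyP=> b; rewrite !coef0 coef_sum coef_sum.
have [aB|Ba] := ltnP a B; last first.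
  apply: big1 => t _; rewrite coefCM coefCM [(P t)`_a]nth_default ?coef0 ?mulr0 //.
  exact: leq_trans (PB t).1 Ba.
have [bB|Bb] := ltnP b B; last first.
  apply: big1 => t _; rewrite coefCM coefCM [(P t)`_a`_b]nth_default ?mulr0 //.
  exact: leq_trans (leq_trans (max_size_coefXY _ _) (PB t).2) Bb.
have jB : (a * B + b < B * B)%N by nia.
have := congr1 (fun w : 'rV_(B * B) => w 0 (Ordinal jB)) vM.
rewrite !mxE => sum0; rewrite -[RHS]sum0 (reindex (@enum_val T T)) /=; last first.
  by apply: onW_bij; apply: enum_val_bij.
apply: eq_bigr => t _; rewrite !mxE enum_valK coefCM coefCM /=.
by rewrite divnMDl ?divn_small ?addn0 ?modnMDl ?modn_small //; lia.
Qed.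

(* The constant [N] works because [N ^ 3] monomials land in a space of dimension [((3 d + 1) N) ^ 2]. *)
Lemma elimination (F : fieldType) (d : nat) : exists2 N : nat, (0 < N)%N &
  forall z G n m : {poly {poly F}},
    bideg_le d z -> bideg_le d G -> bideg_le d n -> bideg_le d m ->
  exists q : nat -> nat -> nat -> F,
    (exists i j k, [&& (i < N)%N, (j < N)%N, (k < N)%N & q i j k != 0]) /\
    \sum_(i < N) \sum_(j < N) \sum_(k < N)
      (q i j k)%:P%:P * (z ^+ i * G ^+ j * (n ^+ k * m ^+ (N.-1 - k))) = 0.
Proof.
pose N := ((3 * d + 1) * (3 * d + 1)).+1; exists N => // z G n m zd Gd nd md.
pose T := ('I_N * 'I_N * 'I_N)%type.
(* Homogeneous in [(n, m)], so that up to a factor the relation sees only the quotient [n / m]; this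
   later serves to eliminate f_xy / (f_x f_y). *)
pose P (t : T) := z ^+ t.1.1 * G ^+ t.1.2 * (n ^+ t.2 * m ^+ (N.-1 - t.2)).
have [||c [[t ct] csum]] := @lin_dep2 F T ((3 * d + 1) * N) P.
- rewrite !card_prod !card_ord.
  by rewrite mulnACA -[X in (_ < X)%N]mulnA ltn_mul2r ltnSn andbT muln_gt0.
- move=> t.
  have : bideg_le (3 * d * N) (P t).
    have A k (g : {poly {poly F}}) : (k <= N)%N -> bideg_le d g -> bideg_le (d * N) (g ^+ k).
      by move=> kN gd; apply: (@bideg_leW _ (d * k)); rewrite ?leq_mul ?bideg_leX.
    have B : bideg_le (d * N.-1) (n ^+ t.2 * m ^+ (N.-1 - t.2)).
      have -> : (d * N.-1 = d * t.2 + d * (N.-1 - t.2))%N.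
        by rewrite -mulnDr subnKC // -ltnS.
      by apply: bideg_leM; apply: bideg_leX.
    rewrite (_ : 3 * d * N = d * N + d * N + d * N)%N; last by lia.
    apply: bideg_leM; last by apply: bideg_leW B; rewrite leq_mul ?leq_pred.
    by apply: bideg_leM; apply: A => //; apply: ltnW.
  case/andP=> H1 H2; split.
    by apply: leq_trans H1 _; rewrite mulnDl mul1n; lia.
  by apply: leq_trans H2 _; rewrite mulnDl mul1n; lia.
pose f (i j k : nat) := c (inord i, inord j, inord k).
exists f; split.
  exists t.1.1, t.1.2, t.2; rewrite !ltn_ord /= /f !inord_val.
  by case: t ct => [[]].
rewrite -[RHS]csum pair_bigA /= [LHS]pair_bigA /=.
by apply: eq_bigr => -[[i j] k] _ /=; rewrite /f /P /= !inord_val.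
Qed.

(** * Common zeros and fibres, with bounds uniform in the polynomials *)

Definition jac (R : comNzRingType) (g h : {poly {poly R}}) : {poly {poly R}} :=
  dX g * dY h - dY g * dX h.

Section Elim.
Variable R : numFieldType.
Implicit Types g h G n z : {poly {poly R}}.

Lemma horner_map_comp (p : {poly R}) z x y :
  ((map_poly polyC p) \Po z).[x, y] = p.[z.[x, y]].
Proof.
elim/poly_ind: p => [|p c IH]; first by rewrite rmorph0 comp_poly0 !horner0.
by rewrite rmorphD rmorphM /= map_polyX map_polyC /= comp_polyD comp_polyM comp_polyX comp_polyC !hornerE IH.
Qed.

(** The case [m = 1] of [elimination], regrouped: the algebraic dependence of three polynomials in
    two variables is read as a relation between [G] and [n] with coefficients that are polynomials
    in [z]. *)
Lemma elimination2 (d : nat) : exists2 N : nat, (0 < N)%N &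
  forall z G n, bideg_le d z -> bideg_le d G -> bideg_le d n ->
  exists r : nat -> nat -> {poly R},
    [/\ forall j k, (size (r j k) <= N)%N,
        exists j k, [&& (j < N)%N, (k < N)%N & r j k != 0] &
        \sum_(j < N) \sum_(k < N)
          (map_poly polyC (r j k) \Po z) * (G ^+ j * n ^+ k) = 0].
Proof.
have [N N0 H] := @elimination R d; exists N => // z G n zd Gd nd.
have d1 : bideg_le d (1 : {poly {poly R}}) by rewrite -!polyC1 bideg_leCC.
have [q [[i [j [k /and4P[iN jN kN qn]]]] qs]] := H z G n 1 zd Gd nd d1.
exists (fun j k => \poly_(i < N) q i j k); split.
- by move=> j' k'; apply: size_poly.
- exists j, k; rewrite jN kN; apply/eqP=> /(congr1 (fun p : {poly R} => p`_i)).
  by rewrite coef_poly iN coef0; apply/eqP.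
rewrite -[RHS]qs [RHS]exchange_big /=; apply: eq_bigr => b _.
rewrite [RHS]exchange_big; apply: eq_bigr => c _ /=.
have -> : (map_poly polyC (\poly_(i < N) q i b c) : {poly {poly R}}) = \sum_(i < N) (q i b c)%:P%:P * 'X^i.
  rewrite poly_def rmorph_sum; apply: eq_bigr => i' _ /=.
  by rewrite -mul_polyC rmorphM /= map_polyC map_polyXn.
rewrite rmorph_sum /= mulr_suml; apply: eq_bigr => i' _ /=.
by rewrite comp_polyM comp_polyC rmorphXn /= comp_polyX expr1n mulr1 !mulrA.
Qed.

Lemma size_sum_scale (N : nat) (I : finType) (c : I -> R) (p : I -> {poly R}) :
  (forall i, (size (p i) <= N)%N) -> (size (\sum_i c i *: p i)%R <= N)%N.
Proof.
move=> pN; apply: (big_ind (fun q : {poly R} => (size q <= N)%N)).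
- by rewrite size_poly0.
- by move=> u v uN vN; apply: leq_trans (size_polyD _ _) _; rewrite geq_max uN.
- by move=> i _; apply: leq_trans (size_scale_leq _ _) (pN i).
Qed.

(** First order Taylor expansion along the line of direction [(al, be)] through the zero. *)
Lemma zero_on_line (al be x y : R) G : G.[x, y] = 0 ->
  exists2 c : {poly R}, comp2 (x%:P + al *: 'X) (y%:P + be *: 'X) G = c * 'X &
    c.[0] = al * (dX G).[x, y] + be * (dY G).[x, y].
Proof.
move=> G0; set u := _ + _; set v := _ + _.
have u0 : u.[0] = x by rewrite !hornerE.
have v0 : v.[0] = y by rewrite !hornerE.
have : root (comp2 u v G) 0 by rewrite /root horner_comp2 u0 v0 G0.
case/factor_theorem=> c; rewrite subr0 => Gc; exists c => //.
have := congr1 (fun p : {poly R} => p^`().[0]) Gc.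
rewrite /= deriv_comp2 derivM derivX !(hornerD, hornerM) hornerX hornerC.
rewrite !horner_comp2 u0 v0 mulr0 add0r mulr1 => <-.
by rewrite /u /v !derivD !derivC !derivZ derivX !add0r !hornerZ hornerC !mulr1 [al * _]mulrC [be * _]mulrC.
Qed.

(* Restrict the eliminating relation to lines through the zero and compare terms of lowest order:
   there the two polynomials are independent linear forms, so each lowest coefficient vanishes. *)
Lemma nonsingular_zeros1 (d : nat) : exists2 N : nat, (0 < N)%N &
  forall z G1 G2, bideg_le d z -> bideg_le d G1 -> bideg_le d G2 ->
  exists p : {poly R}, [/\ p != 0, (size p <= N)%N &
    forall x y, G1.[x, y] = 0 -> G2.[x, y] = 0 -> (jac G1 G2).[x, y] != 0 ->
      root p z.[x, y]].
Proof.
have [N N0 H] := elimination2 d; exists N => // z G1 G2 zd G1d G2d.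
have [r [rN [j [k /and3P[jN kN rjk]]] rs]] := H z G1 G2 zd G1d G2d.
(* [e] will be the lowest total degree in [(G1, G2)] that occurs with a nonzero coefficient. *)
pose P e := [exists t : 'I_N * 'I_N, (t.1 + t.2 == e)%N && (r t.1 t.2 != 0)].
have exP : exists e, P e.
  by exists (j + k)%N; apply/existsP; exists (Ordinal jN, Ordinal kN); rewrite /= eqxx.
case: (ex_minnP exP) => e /existsP[[j0 k0] /= /andP[/eqP ejk r0]] emin.
have rlow (a b : 'I_N) : (a + b < e)%N -> r a b = 0.
  move=> abe; apply/eqP; apply: contraTT abe => rab; rewrite -leqNgt; apply: emin.
  by apply/existsP; exists (a, b); rewrite /= eqxx.
exists (r j0 k0); split=> // x y G1z G2z Jn.
set z0 := z.[x, y].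
have key tau : \sum_(a < N) \sum_(b < N) (if (a + b == e)%N then (r a b).[z0] * tau ^+ b else 0) = 0.
  set J := (jac G1 G2).[x, y] in Jn.
  (* Cramer's rule: in the direction [(al, be)] the derivatives of [G1] and [G2] are 1 and [tau]. *)
  pose al := ((dY G2).[x, y] - tau * (dY G1).[x, y]) / J.
  pose be := (tau * (dX G1).[x, y] - (dX G2).[x, y]) / J.
  pose u := x%:P + al *: 'X : {poly R}; pose v := y%:P + be *: 'X : {poly R}.
  have u0 : u.[0] = x by rewrite /u !hornerE.
  have v0 : v.[0] = y by rewrite /v !hornerE.
  have [c1 Gc1 c10] := zero_on_line al be G1z; have [c2 Gc2 c20] := zero_on_line al be G2z.
  have c1E : c1.[0] = 1.
    rewrite c10 /al /be; have : J != 0 by []; rewrite /J /jac !hornerE => J0.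
    by field.
  have c2E : c2.[0] = tau.
    rewrite c20 /al /be; have : J != 0 by []; rewrite /J /jac !hornerE => J0.
    by field.
  pose S : {poly R} := \sum_(a < N) \sum_(b < N)
     (if (e <= a + b)%N then comp2 u v (map_poly polyC (r a b) \Po z) * (c1 ^+ a * c2 ^+ b) * 'X^(a + b - e)
      else 0).
  have S0 : S * 'X^e = 0.
    have := congr1 (comp2 u v) rs; rewrite rmorph0 => rs0; rewrite -[RHS]rs0.
    rewrite rmorph_sum /S mulr_suml; apply: eq_bigr => a _.
    rewrite rmorph_sum mulr_suml; apply: eq_bigr => b _ /=.
    case: leqP => [eab|abe]; last by rewrite rlow // map_poly0 comp_poly0 !mul0r rmorph0.
    rewrite !rmorphM !rmorphXn /= Gc1 Gc2 !exprMn -!mulrA; congr (_ * _).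
    rewrite -exprD subnK // exprD; ring.
  have {}S0 : S = 0.
    by move/eqP: S0; rewrite mulf_eq0 expf_eq0 polyX_eq0 andbF orbF => /eqP.
  have := congr1 (fun p : {poly R} => p.[0]) S0; rewrite horner0 => rs0; rewrite -[RHS]rs0.
  rewrite /S horner_sum; apply: eq_bigr => a _; rewrite horner_sum; apply: eq_bigr => b _.
  case: (ltngtP e (a + b)%N) => eab.
  - by rewrite hornerM hornerXn expr0n subn_eq0 leqNgt eab mulr0.
  - by rewrite horner0.
  - rewrite !hornerM !horner_exp c1E c2E horner_comp2 u0 v0 horner_map_comp eab subnn expr0.
    by rewrite expr1n mul1r mulr1.
(* As [tau] is free, all coefficients in [tau] vanish; that of [tau ^+ k0] is [r j0 k0] at [z0]. *)
have /poly_fun0 : forall tau, (\sum_(a < N) \sum_(b < N) (if (a + b == e)%N then (r a b).[z0] else 0) *: 'X^b).[tau] = 0.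
  move=> tau; rewrite -[RHS](key tau) horner_sum; apply: eq_bigr => a _.
  rewrite horner_sum; apply: eq_bigr => b _; rewrite hornerZ hornerXn.
  by case: ifP => // _; rewrite mul0r.
move/(congr1 (fun p : {poly R} => p`_k0)); rewrite coef0 coef_sum (bigD1 j0) //=.
rewrite [X in _ + X]big1 ?addr0; last first.
  move=> a aj; rewrite coef_sum big1 // => b _; rewrite coefZ coefXn.
  case: (k0 =P b :> nat) => [kb|_]; last by rewrite mulr0.
  case: eqP => abe; last by rewrite mul0r.
  by move/eqP: aj; case; apply/val_inj => /=; lia.
rewrite coef_sum (bigD1 k0) //= coefZ coefXn eqxx mulr1 ejk eqxx big1 ?addr0.
  by move=> r00; rewrite /root r00.
move=> b bk; rewrite coefZ coefXn; case: (k0 =P b :> nat) => [kb|_]; last by rewrite mulr0.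
by move/eqP: bk; case; apply/val_inj.
Qed.

(** The previous bound for [z = 'X] and for [z = 'Y]; the degree is raised to [d.+1] to make room
    for the two variables. *)
Lemma nonsingular_zeros (d : nat) : exists2 N : nat, (0 < N)%N &
  forall G1 G2, bideg_le d G1 -> bideg_le d G2 ->
  exists p1 p2 : {poly R}, [/\ p1 != 0, p2 != 0, (size p1 <= N)%N, (size p2 <= N)%N &
    forall x y, G1.[x, y] = 0 -> G2.[x, y] = 0 -> (jac G1 G2).[x, y] != 0 ->
      root p1 x /\ root p2 y].
Proof.
have [N N0 H] := nonsingular_zeros1 d.+1; exists N => // G1 G2 G1d G2d.
have [||p1 [p10 p1N p1r]] := H 'X G1 G2 (bideg_le_X _ d); try exact: bideg_leW (leqnSn _) _.
have [||p2 [p20 p2N p2r]] := H 'Y G1 G2 (bideg_le_Y _ d); try exact: bideg_leW (leqnSn _) _.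
exists p1, p2; split=> // x y G1z G2z J0.
by have := p1r x y G1z G2z J0; have := p2r x y G1z G2z J0; rewrite !hornerE.
Qed.

(** Substituting [e1], [e2] for [G1], [G2] in their dependence with [z] leaves a univariate equation
    for [z]. Its coefficient at the degree of some nonzero [r j k] is [w] at [(e1, e2)], so the
    equation is nontrivial where [w] does not vanish. *)
Lemma generic_fibre1 (d : nat) : exists2 N : nat, (0 < N)%N &
  forall z G1 G2, bideg_le d z -> bideg_le d G1 -> bideg_le d G2 ->
  exists2 w : {poly {poly R}}, w != 0 &
  forall e1 e2, w.[e1, e2] != 0 -> exists p : {poly R},
    [/\ p != 0, (size p <= N)%N &
    forall x y, G1.[x, y] = e1 -> G2.[x, y] = e2 -> root p z.[x, y]].
Proof.
have [N N0 H] := elimination2 d; exists N => // z G1 G2 zd G1d G2d.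
have [r [rN [j [k /and3P[jN kN rjk]]] rs]] := H z G1 G2 zd G1d G2d.
pose i := (size (r j k)).-1.
pose w : {poly {poly R}} := \sum_(a < N) \sum_(b < N) ((r a b)`_i)%:P%:P * ('X^a * 'Y ^+ b).
have wE e1 e2 : w.[e1, e2] = \sum_(a < N) \sum_(b < N) (r a b)`_i * (e1 ^+ a * e2 ^+ b).
  rewrite /w !horner_sum; apply: eq_bigr => a _; rewrite !horner_sum; apply: eq_bigr => b _.
  by rewrite !(hornerM, horner_exp, hornerX, hornerC).
exists w.
  apply/eqP=> w0; move/eqP: rjk; apply.
  apply/eqP; rewrite -lead_coef_eq0 lead_coefE -/i; apply/eqP.
  have := congr1 (fun p : {poly {poly R}} => p`_j`_k) w0; rewrite !coef0 => rs0; rewrite -[RHS]rs0.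
  rewrite /w !coef_sum (bigD1 (Ordinal jN)) //= [X in _ + X]big1 ?addr0; last first.
    move=> a aj; rewrite !coef_sum big1 // => b _.
    rewrite coefCM coefCM -polyC_exp coefMC coefXn; case: eqP => [ja|_]; last by rewrite mul0r coef0 mulr0.
    by move/eqP: aj; case; apply/val_inj.
  rewrite !coef_sum (bigD1 (Ordinal kN)) //= [X in _ + X]big1 ?addr0; last first.
    move=> b bk; rewrite coefCM coefCM -polyC_exp coefMC coefXn eqxx mul1r coefXn.
    case: eqP => [kb|_]; last by rewrite mulr0.
    by move/eqP: bk; case; apply/val_inj.
  by rewrite coefCM coefCM -polyC_exp coefMC coefXn eqxx mul1r coefXn eqxx mulr1.
move=> e1 e2 we; exists (\sum_(t : 'I_N * 'I_N) (e1 ^+ t.1 * e2 ^+ t.2) *: r t.1 t.2); split.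
- apply/eqP=> /(congr1 (fun p : {poly R} => p`_i)); rewrite coef0 coef_sum => H0.
  move/eqP: we; apply; rewrite wE -[RHS]H0 pair_bigA; apply: eq_bigr => t _.
  by rewrite coefZ mulrC.
- by apply: size_sum_scale => t; apply: rN.
move=> x y G1e G2e; have := congr1 (fun p : {poly {poly R}} => p.[x, y]) rs.
rewrite /root !horner0 => {}rs; apply/eqP; rewrite -[RHS]rs pair_bigA !horner_sum /=.
apply: eq_bigr => t _; rewrite !hornerM !horner_exp horner_map_comp G1e G2e hornerZ.
by rewrite mulrC.
Qed.

Lemma generic_fibre (d : nat) : exists2 N : nat, (0 < N)%N &
  forall G1 G2, bideg_le d G1 -> bideg_le d G2 ->
  exists2 w : {poly {poly R}}, w != 0 &
  forall e1 e2, w.[e1, e2] != 0 -> exists p1 p2 : {poly R},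
    [/\ p1 != 0, p2 != 0, (size p1 <= N)%N, (size p2 <= N)%N &
    forall x y, G1.[x, y] = e1 -> G2.[x, y] = e2 -> root p1 x /\ root p2 y].
Proof.
have [N N0 H] := generic_fibre1 d.+1; exists N => // G1 G2 G1d G2d.
have [||w1 w10 p1P] := H 'X G1 G2 (bideg_le_X _ d); try exact: bideg_leW (leqnSn _) _.
have [||w2 w20 p2P] := H 'Y G1 G2 (bideg_le_Y _ d); try exact: bideg_leW (leqnSn _) _.
exists (w1 * w2) => [|e1 e2]; first by rewrite mulf_neq0.
rewrite !hornerM mulf_eq0 negb_or => /andP[/p1P[p1 [? ? p1r]] /p2P[p2 [? ? p2r]]].
exists p1, p2; split=> // x y Ge1 Ge2.
by have := p1r x y Ge1 Ge2; have := p2r x y Ge1 Ge2; rewrite !hornerE.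
Qed.

(** The relation between the first variable, [F] and [G] is divided by the highest possible power of
    [F], so that it survives the substitution [F = 0]. A value that [G] takes on the curve at
    infinitely many first coordinates is then necessarily a root of [w]. *)
Lemma fibre_on_curve (d : nat) : exists2 N : nat, (0 < N)%N &
  forall F G, bideg_le d F -> bideg_le d G -> F != 0 ->
  exists2 w : {poly R}, w != 0 &
  forall e, w.[e] != 0 -> exists p : {poly R},
    [/\ p != 0, (size p <= N)%N &
    forall x y, F.[x, y] = 0 -> G.[x, y] = e -> root p x].
Proof.
have [N N0 H] := elimination2 d.+1; exists N => // F G Fd Gd F0.
have [||r [rN [j [k /and3P[jN kN rjk]]] rs]] := H 'X F G (bideg_le_X _ d).
- exact: bideg_leW (leqnSn _) Fd.
- exact: bideg_leW (leqnSn _) Gd.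
pose P j := [exists t : 'I_N * 'I_N, (t.1 == j :> nat)%N && (r t.1 t.2 != 0)].
have exP : exists j, P j.
  by exists j; apply/existsP; exists (Ordinal jN, Ordinal kN); rewrite /= eqxx.
case: (ex_minnP exP) => j0 /existsP[[j1 k0] /= /andP[/eqP ej r0]] jmin.
subst j0.
have rlow (a b : 'I_N) : (a < j1)%N -> r a b = 0.
  move=> abe; apply/eqP; apply: contraTT abe => rab; rewrite -leqNgt; apply: jmin.
  by apply/existsP; exists (a, b); rewrite /= eqxx.
have {rs} : \sum_(a < N) \sum_(b < N) (if (j1 <= a)%N then
   map_poly polyC (r a b) * (F ^+ (a - j1) * G ^+ b) else 0) = 0.
  apply/eqP; have : F ^+ j1 != 0 by rewrite expf_neq0.
  move/mulfI/inj_eq <-; rewrite mulr0 -[X in _ == X]rs mulr_sumr; apply/eqP.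
  apply: eq_bigr => a _; rewrite mulr_sumr; apply: eq_bigr => b _; rewrite comp_polyXr.
  case: leqP => aj; last by rewrite rlow // map_poly0 mul0r mulr0.
  by rewrite mulrCA [F ^+ j1 * _]mulrA -exprD subnKC.
move=> rs; pose i := (size (r j1 k0)).-1.
exists (\poly_(b < N) (r j1 b)`_i).
  apply/eqP=> /(congr1 (fun p : {poly R} => p`_k0)); rewrite coef_poly ltn_ord coef0.
  by move=> H0; move/eqP: r0; apply; apply/eqP; rewrite -lead_coef_eq0 lead_coefE H0.
move=> e we; exists (\sum_(b < N) e ^+ b *: r j1 b); split.
- apply/eqP=> /(congr1 (fun p : {poly R} => p`_i)); rewrite coef0 coef_sum => H0.
  move/eqP: we; apply; rewrite horner_poly -[RHS]H0; apply: eq_bigr => b _.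
  by rewrite coefZ mulrC.
- by apply: size_sum_scale => t; apply: rN.
move=> x y Fe Ge; have := congr1 (fun p : {poly {poly R}} => p.[x, y]) rs.
rewrite /root !horner0 => {}rs; apply/eqP; rewrite -[RHS]rs.
rewrite [in RHS](bigD1 j1) //= leqnn subnn !hornerD [X in _ = _ + X](_ : _ = 0) ?addr0.
  rewrite !horner_sum; apply: eq_bigr => b _.
  have := horner_map_comp (r j1 b) 'X x y; rewrite comp_polyXr => E.
  by rewrite expr0 mul1r hornerZ !hornerM E !horner_exp Ge hornerX hornerC mulrC.
rewrite !horner_sum big1 // => a aj; rewrite !horner_sum big1 // => b _.
case: leqP => ja; last by rewrite !horner0.
rewrite !hornerM !horner_exp Fe expr0n subn_eq0 leqNgt ltn_neqAle ja eq_sym.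
by rewrite (inj_eq val_inj) aj mul0r mulr0.
Qed.
End Elim.

(** * Values of a polynomial on boxes *)

Module Analysis.
Import all_classical all_analysis numFieldNormedType.Exports.
Local Open Scope classical_set_scope.

Section A.
Variable R : realType.

Lemma continuous_poly2 (g : {poly {poly R}}) (T : topologicalType) (u v : T -> R) :
  continuous u -> continuous v -> continuous (fun t => g.[u t, v t]).
Proof.
move=> cu cv; have cp (p : {poly R}) : continuous (fun t => p.[v t]).
  elim/poly_ind: p => [|p c IH].
    by rewrite (_ : (fun t => _) = cst 0); [exact: cst_continuous|apply/funext=> t; rewrite horner0].
  rewrite (_ : (fun t => _) = (fun t => p.[v t] * v t + c)); last by apply/funext=> t; rewrite !hornerE.
  by move=> t; apply: cvgD; [apply: cvgM; [exact: IH|exact: cv]|exact: cvg_cst].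
elim/poly_ind: g => [|g p IH].
  by rewrite (_ : (fun t => _) = cst 0); [exact: cst_continuous|apply/funext=> t; rewrite !horner0].
rewrite (_ : (fun t => _) = (fun t => g.[u t, v t] * u t + p.[v t])); last by apply/funext=> t; rewrite !hornerE.
by move=> t; apply: cvgD; [apply: cvgM; [exact: IH|exact: cu]|exact: cp].
Qed.

Lemma poly2_box_min (g : {poly {poly R}}) (a b c e : R) : a <= b -> c <= e ->
  exists x y, [/\ a <= x <= b, c <= y <= e &
    forall x' y', a <= x' <= b -> c <= y' <= e -> g.[x, y] <= g.[x', y']].
Proof.
move=> ab ce.
have [|||[x y] xy H] := @compact_EVT_min (R * R)%type R (fun t => g.[t.1, t.2]) (`[a, b] `*` `[c, e]).
- by exists (a, c); split; rewrite /= in_itv /= lexx.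
- by apply: compact_setX; apply: segment_compact.
- by apply: continuous_subspaceT; apply: continuous_poly2; [move=> t; exact: cvg_fst|move=> t; exact: cvg_snd].
move: xy; rewrite inE /= !in_itv /= => -[xab yce]; exists x, y; split=> // x' y' x'ab y'ce.
by apply: (H (x', y')); rewrite inE /= !in_itv.
Qed.

(** Where [p] and [q] increase, the curve p(x) = q(y) is the graph of an increasing bijection [Y] of
    intervals. Such a map is continuous, and the intermediate value theorem applies to G(x,
    Y(x)). *)
Lemma curve_ivt_inc (p q : {poly R}) (G : {poly {poly R}}) (x1 x2 y1 y2 w : R) :
  x1 < x2 -> y1 <= y2 ->
  (forall x x', x1 <= x -> x < x' -> x' <= x2 -> p.[x] < p.[x']) ->
  (forall y y', y1 <= y -> y < y' -> y' <= y2 -> q.[y] < q.[y']) ->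
  p.[x1] = q.[y1] -> p.[x2] = q.[y2] ->
  (G.[x1, y1] - w) * (G.[x2, y2] - w) < 0 ->
  exists x y, [/\ x1 < x < x2, y1 <= y <= y2, p.[x] = q.[y] & G.[x, y] = w].
Proof.
move=> x12 y12 pinc qinc pq1 pq2 Gw.
have pW x x' : x1 <= x -> x <= x' -> x' <= x2 -> p.[x] <= p.[x'].
  by move=> a b c; case: (ltgtP x x') b => [b _|//|-> //]; rewrite ltW ?pinc.
have qW y y' : y1 <= y -> y <= y' -> y' <= y2 -> q.[y] <= q.[y'].
  by move=> a b c; case: (ltgtP y y') b => [b _|//|-> //]; rewrite ltW ?qinc.
have cw (r : {poly R}) (a b : R) : {within `[a, b], continuous (horner r)}.
  exact/continuous_subspaceT/continuous_horner.
have ivt (r : {poly R}) (a b v : R) : a <= b -> r.[a] <= v -> v <= r.[b] ->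
    exists y, a <= y <= b /\ r.[y] = v.
  move=> ab av vb; have rab := le_trans av vb.
  have [||y yab ry] := @IVT R (horner r) a b v ab; first exact: cw.
    by rewrite (min_idPl rab) (max_idPr rab) av.
  by exists y; split=> //; move: yab; rewrite in_itv.
have /choice[Y YP] : forall x, exists y, x1 <= x <= x2 -> y1 <= y <= y2 /\ q.[y] = p.[x].
  move=> x; have [/andP[xx1 xx2]|] := boolP (x1 <= x <= x2); last by exists 0.
  have [||y] := @ivt q y1 y2 p.[x] y12; first by rewrite -pq1 pW // ltW.
    by rewrite -pq2 pW // ltW.
  by exists y.
have Yin x : x1 <= x <= x2 -> y1 <= Y x <= y2 by move=> /YP[].
have Yq x : x1 <= x <= x2 -> q.[Y x] = p.[x] by move=> /YP[].
have Ymono : {in `[x1, x2]%R &, {mono Y : x y / x <= y}}.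
  move=> x x'; rewrite !in_itv /= => xi x'i.
  have [/andP[ya yb] /andP[ya' yb']] := (Yin _ xi, Yin _ x'i).
  case/andP: (xi) => xa xb; case/andP: (x'i) => xa' xb'.
  apply/idP/idP => [|xx'].
    by apply: contraTT; rewrite -!ltNge => xx'; rewrite ltNge; apply/negP=> /(qW _ _ ya)/(_ yb'); rewrite !Yq // leNgt pinc.
  by rewrite leNgt; apply/negP=> /(qinc _ _ ya')/(_ yb); rewrite !Yq // ltNge pW.
have x1i : x1 <= x1 <= x2 by rewrite lexx ltW.
have x2i : x1 <= x2 <= x2 by rewrite lexx ltW.
have qinj y y' : y1 <= y <= y2 -> y1 <= y' <= y2 -> q.[y] = q.[y'] -> y = y'.
  move=> /andP[ya yb] /andP[ya' yb'] qq; case: (ltgtP y y') => // h.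
    by have := qinc _ _ ya h yb'; rewrite qq ltxx.
  by have := qinc _ _ ya' h yb; rewrite qq ltxx.
have Yx1 : Y x1 = y1 by apply: qinj; [exact: Yin|rewrite lexx|rewrite Yq].
have Yx2 : Y x2 = y2 by apply: qinj; [exact: Yin|rewrite lexx andbT|rewrite Yq].
have Yc : {within `[x1, x2], continuous Y}.
  apply: segment_inc_surj_continuous => //.
  move=> y /=; rewrite in_itv /= Yx1 Yx2 => /andP[ya yb].
  have [||x [xi px]] := @ivt p x1 x2 q.[y] (ltW x12).
  - by rewrite pq1 qW.
  - by rewrite pq2 qW.
  exists x; first by rewrite /= in_itv.
  by apply: qinj; [exact: Yin|rewrite ya yb|rewrite Yq].
have Hc : {within `[x1, x2], continuous (fun x => G.[x, Y x])}.
  apply: (@continuous_poly2 G (subspace `[x1, x2]) id Y) => //.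
  exact: (@continuous_subspaceT _ _ _ (@idfun R) (fun x => cvg_id)).
have [|x] := @IVT R (fun x => G.[x, Y x]) x1 x2 w (ltW x12) Hc.
  rewrite Yx1 Yx2 ge_min le_max.
  move: Gw; set a := G.[x1, y1]; set b := G.[x2, y2] => Gw.
  have [h1|h1] := ltP a w; have [h2|h2] := ltP b w.
  - by exfalso; nra.
  - by apply/andP; split; apply/orP; [left; apply: ltW|right].
  - by apply/andP; split; apply/orP; [right; apply: ltW|left].
  - by exfalso; nra.
rewrite in_itv /= => xi Gx; exists x, (Y x); rewrite Yin // Yq //; split=> //.
case/andP: xi => a b; rewrite !lt_neqAle a b !andbT; apply/andP; split; apply/eqP=> e.
  by move: Gx Gw; rewrite -e Yx1 => ->; rewrite subrr mul0r ltxx.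
by move: Gx Gw; rewrite e Yx2 => ->; rewrite subrr mulr0 ltxx.
Qed.

Lemma poly_interior_min (p : {poly R}) (a b c : R) : a < c < b ->
  (forall x, a <= x <= b -> p.[c] <= p.[x]) -> p^`().[c] = 0.
Proof.
move=> cab pmin; have ab : a <= b by case/andP: cab => ac cb; apply: ltW (lt_trans ac cb).
have : is_derive c 1 (horner p) 0.
  apply: (derive1_at_min ab) => [t _|//|t tab]; first exact: derivable_horner.
  by apply: pmin; move: tab; rewrite in_itv /= => /andP[/ltW -> /ltW ->].
by move=> H; rewrite derivE derive1E; apply: derive_val.
Qed.
End A.
End Analysis.

Lemma card_le_roots (R : idomainType) (T : finType) (A : {set T}) (f : T -> R) (p : {poly R}) :
  p != 0 -> {in A &, injective f} -> {in A, forall t, root p (f t)} ->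
  (#|A| < size p)%N.
Proof.
move=> p0 finj fr; have := @max_poly_roots _ p [seq f t | t <- enum A] p0.
rewrite size_map -cardE; apply.
  by apply/allP=> _ /mapP[t tA ->]; apply: fr; rewrite -mem_enum.
by rewrite map_inj_in_uniq ?enum_uniq // => x y; rewrite !mem_enum; apply: finj.
Qed.

Section Small.
Variable R : realFieldType.

Lemma nonroot_small (p : {poly R}) (e : R) : p != 0 -> 0 < e -> exists2 x, 0 < x < e & p.[x] != 0.
Proof.
move=> p0 e0; pose s := [seq e / (i.+2)%:R | i <- iota 0 (size p)].
have us : uniq s.
  rewrite map_inj_uniq ?iota_uniq // => i j /(mulfI (lt0r_neq0 e0)) /invr_inj /eqP.
  by rewrite eqr_nat => /eqP[].
have : ~~ all (root p) s.
  by apply/negP=> rs; move/eqP: p0; apply; apply: infinite_root0 us rs _; rewrite size_map size_iota.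
rewrite -has_predC => /hasP[x /mapP[i _ ->] xr]; exists (e / (i.+2)%:R) => //.
by rewrite divr_gt0 ?ltr0n //= ltr_pdivrMr ?ltr0n // ltr_pMr // ltr1n.
Qed.

Lemma nonroot2_small (w : {poly {poly R}}) (e : R) : w != 0 -> 0 < e ->
  exists x y, [/\ 0 < x < e, 0 < y < e & w.[x, y] != 0].
Proof.
rewrite -swapXY_eq0 -lead_coef_eq0 => /nonroot_small H e0; have [x xe wx] := H e e0.
have : w.[x%:P] != 0.
  by apply/eqP=> /(congr1 (fun p : {poly R} => p`_(size (swapXY w)).-1)); rewrite coef0 horner_polyC coef_map; apply/eqP.
by move=> /nonroot_small/(_ e0)[y]; exists x, y.
Qed.
End Small.

Section Pits.
Variable R : realType.
Implicit Types g : {poly {poly R}}.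

(** A stable substitute for an interior local minimum: strict comparison with the whole boundary
    survives a small linear perturbation of [g]. *)
Definition pit g (a b c e : R) : Prop := exists x y, [/\ a < x < b, c < y < e,
  (forall y', c <= y' <= e -> g.[x, y] < g.[a, y'] /\ g.[x, y] < g.[b, y']) &
  (forall x', a <= x' <= b -> g.[x, y] < g.[x', c] /\ g.[x, y] < g.[x', e])].

(** The critical points of [g] may fill a curve, so a small gradient [(e1, e2)] is prescribed
    instead of zero: [g] minus e1 x + e2 y still attains its minimum over the closed box in the
    interior. *)
Lemma perturbed_pit g a b c e : pit g a b c e -> exists2 del, 0 < del &
  forall e1 e2, 0 < e1 < del -> 0 < e2 < del ->
    exists x y, [/\ a < x < b, c < y < e, (dX g).[x, y] = e1 & (dY g).[x, y] = e2].
Proof.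
move=> [x [y [/andP[ax xb] /andP[cy ye] sideX sideY]]].
have ab : a <= b by rewrite ltW // (lt_trans ax).
have ce : c <= e by rewrite ltW // (lt_trans cy).
have box a' b' c' e' : a' <= b' -> c' <= e' ->
    (forall x' y', a' <= x' <= b' -> c' <= y' <= e' -> g.[x, y] < g.[x', y']) ->
    exists2 gap, 0 < gap & forall x' y', a' <= x' <= b' -> c' <= y' <= e' -> g.[x, y] + gap <= g.[x', y'].
  move=> ab' ce' H; have [x0 [y0 [x0i y0i mn]]] := Analysis.poly2_box_min g ab' ce'.
  exists (g.[x0, y0] - g.[x, y]); first by rewrite subr_gt0 H.
  by move=> x' y' x'i y'i; rewrite addrC subrK mn.
have [|||g1 g1p G1] := box a a c e; rewrite ?lexx //.
  by move=> x' y'; rewrite -eq_le => /eqP <- /sideX[].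
have [|||g2 g2p G2] := box b b c e; rewrite ?lexx //.
  by move=> x' y'; rewrite -eq_le => /eqP <- /sideX[].
have [|||g3 g3p G3] := box a b c c; rewrite ?lexx //.
  by move=> x' y' x'i; rewrite -eq_le => /eqP <-; have [] := sideY x' x'i.
have [|||g4 g4p G4] := box a b e e; rewrite ?lexx //.
  by move=> x' y' x'i; rewrite -eq_le => /eqP <-; have [] := sideY x' x'i.
(* By compactness the boundary exceeds the pit by [gap]; a gradient below [gap / W] changes the
   linear term by less than [gap] over a box of half perimeter [W]. *)
pose gap := Num.min (Num.min g1 g2) (Num.min g3 g4).
have gap0 : 0 < gap by rewrite !lt_min g1p g2p g3p g4p.
pose W := (b - a) + (e - c).
have W0 : 0 < W by rewrite /W; lra.
exists (gap / W); first by rewrite divr_gt0.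
move=> e1 e2 /andP[e10]; rewrite ltr_pdivlMr // => e1W /andP[e20]; rewrite ltr_pdivlMr // => e2W.
pose h : {poly {poly R}} := g - (e1%:P *: 'X + (e2%:P * 'X)%:P).
have hE x' y' : h.[x', y'] = g.[x', y'] - (e1 * x' + e2 * y') by rewrite /h !hornerE.
have hX x' y' : (dX h).[x', y'] = (dX g).[x', y'] - e1.
  by rewrite /h dXB dXD dXC addr0 /dX derivZ derivX !hornerE.
have hY x' y' : (dY h).[x', y'] = (dY g).[x', y'] - e2.
  rewrite /h dYB dYD dYC (_ : dY (e1%:P *: 'X) = 0).
    by rewrite add0r derivM derivC derivX mul0r add0r mulr1 !hornerE.
  apply/polyP=> i; rewrite coef_dY coefZ coefX; case: (i == 1)%N; rewrite ?mulr1 ?mulr0 ?derivC ?deriv0 //; by rewrite coef0.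
have [x0 [y0 [x0i y0i mn]]] := Analysis.poly2_box_min h ab ce.
have hxy : h.[x0, y0] <= h.[x, y] by apply: mn; rewrite !ltW.
have gapi : (gap <= g1) && (gap <= g2) && (gap <= g3) && (gap <= g4) by rewrite !ge_min !lexx !orbT.
have bd x' y' gp : a <= x' <= b -> c <= y' <= e -> gap <= gp -> g.[x, y] + gp <= g.[x', y'] -> h.[x0, y0] < h.[x', y'].
  move=> /andP[? ?] /andP[? ?] ggp H; apply: le_lt_trans hxy _; rewrite !hE.
  have E1 : e1 * (x' - x) <= e1 * (b - a) by rewrite ler_pM2l //; lra.
  have E2 : e2 * (y' - y) <= e2 * (e - c) by rewrite ler_pM2l //; lra.
  have E3 : e1 * (b - a) + e2 * (e - c) < gap.
    have F1 : e1 * (b - a) < gap / W * (b - a) by rewrite ltr_pM2r ?ltr_pdivlMr //; lra.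
    have F2 : e2 * (e - c) < gap / W * (e - c) by rewrite ltr_pM2r ?ltr_pdivlMr //; lra.
    have F3 : gap / W * (b - a) + gap / W * (e - c) = gap by rewrite -mulrDr -/W divfK ?lt0r_neq0.
    lra.
  lra.
case/andP: gapi => /andP[/andP[gp1 gp2] gp3] gp4.
have x0a : a < x0 < b.
  case/andP: x0i => h1 h2; rewrite !lt_neqAle h1 h2 !andbT; apply/andP; split; apply/eqP=> E.
    by have := bd x0 y0 g1 _ y0i gp1; rewrite -E ?lexx ?ab G1 ?lexx // => /(_ isT isT); rewrite ltxx.
  by have := bd x0 y0 g2 _ y0i gp2; rewrite E ?lexx ?ab G2 ?lexx // => /(_ isT isT); rewrite ltxx.
have y0a : c < y0 < e.
  case/andP: y0i => h1 h2; rewrite !lt_neqAle h1 h2 !andbT; apply/andP; split; apply/eqP=> E.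
    by have := bd x0 y0 g3 x0i _ gp3; rewrite -E ?lexx ?ce G3 ?lexx // => /(_ isT isT); rewrite ltxx.
  by have := bd x0 y0 g4 x0i _ gp4; rewrite E ?lexx ?ce G4 ?lexx // => /(_ isT isT); rewrite ltxx.
exists x0, y0; split=> //.
  have : ((swapXY h).[y0%:P])^`().[x0] = 0.
    apply: (Analysis.poly_interior_min x0a) => x' x'i.
    by rewrite !horner2_swapXY mn.
  have -> : ((swapXY h).[y0%:P])^`() = (swapXY (dX h)).[y0%:P].
    by rewrite !horner_swapXY /dX deriv_map.
  by rewrite horner2_swapXY hX => /eqP; rewrite subr_eq0 => /eqP.
have : (h.[x0%:P])^`().[y0] = 0.
  by apply: (Analysis.poly_interior_min y0a) => y' y'i; rewrite mn.
have -> : (h.[x0%:P])^`() = (dY h).[x0%:P].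
  by rewrite !horner_polyC -dX_swap /dX deriv_map.
by rewrite hY => /eqP; rewrite subr_eq0 => /eqP.
Qed.

Definition hit g (a b c e v : R) : Prop :=
  exists x y, [/\ a < x < b, c < y < e & g.[x, y] = v].

Definition side (p : {poly R}) (c e v : R) : Prop := exists2 y, c <= y <= e & p.[y] = v.

Lemma side_above (p : {poly R}) (c e v : R) : ~ side p c e v ->
  (forall y y', c <= y <= e -> c <= y' <= e -> v < p.[y] -> v < p.[y']).
Proof.
move=> ns y y' yi y'i vy; rewrite ltNge; apply/negP=> py'.
have vp y0 : (p - v%:P).[y0] = p.[y0] - v by rewrite !hornerE.
have [|/ltW] := leP y y'; last first.
  move=> y'y; have neg : (p - v%:P).[y'] <= 0 <= (p - v%:P).[y] by rewrite !vp; lra.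
  have [z zi] := poly_ivt y'y neg; rewrite /root vp subr_eq0 => /eqP pz.
  by apply: ns; exists z => //; move: zi yi y'i => /andP[? ?] /andP[? ?] /andP[? ?]; apply/andP; split; lra.
move=> yy'; have neg : (- (p - v%:P)).[y] <= 0 <= (- (p - v%:P)).[y'] by rewrite !hornerN !vp; lra.
have [z zi] := poly_ivt yy' neg; rewrite /root hornerN vp oppr_eq0 subr_eq0 => /eqP pz.
by apply: ns; exists z => //; move: zi yi y'i => /andP[? ?] /andP[? ?] /andP[? ?]; apply/andP; split; lra.
Qed.

(** If no side takes the value [v], then [g - v] has constant sign on each side, hence on the
    boundary, since the sides share corners. The point where [g] equals [v] then lies strictly below
    or strictly above the boundary. *)
Lemma hit_cases g a b c e v : a < b -> c < e -> hit g a b c e v ->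
  [\/ side g.[a%:P] c e v \/ side g.[b%:P] c e v,
      side (swapXY g).[c%:P] a b v \/ side (swapXY g).[e%:P] a b v |
      pit g a b c e \/ pit (- g) a b c e].
Proof.
move=> ab ce [x [y [xab yce gv]]].
have [s1|n1] := pselect (side g.[a%:P] c e v); first by constructor 1; left.
have [s2|n2] := pselect (side g.[b%:P] c e v); first by constructor 1; right.
have [s3|n3] := pselect (side (swapXY g).[c%:P] a b v); first by constructor 2; left.
have [s4|n4] := pselect (side (swapXY g).[e%:P] a b v); first by constructor 2; right.
constructor 3.
have ai : a <= a <= b by rewrite lexx ltW.
have bi : a <= b <= b by rewrite lexx ltW.
have ci : c <= c <= e by rewrite lexx ltW.
have ei : c <= e <= e by rewrite lexx ltW.
have above (h : {poly {poly R}}) (u : R) : ~ side h.[a%:P] c e u -> ~ side h.[b%:P] c e u ->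
    ~ side (swapXY h).[c%:P] a b u -> ~ side (swapXY h).[e%:P] a b u ->
    h.[x, y] = u -> u < h.[a, c] -> pit h a b c e.
  move=> m1 m2 m3 m4 hu hac; exists x, y; rewrite hu; split=> //.
    have hbc : u < h.[b, c].
      rewrite -horner2_swapXY; apply: (side_above m3 ai bi); by rewrite horner2_swapXY.
    by move=> y' y'i; split; [exact: (side_above m1 ci)|exact: (side_above m2 ci)].
  have hae : u < h.[a, e] by exact: (side_above m1 ci ei).
  by move=> x' x'i; rewrite -!(horner2_swapXY h); split;
    [apply: (side_above m3 ai)|apply: (side_above m4 ai)]; rewrite ?horner2_swapXY.
have [gac|gac|gac] := ltgtP v g.[a, c].
- by left; apply: above gv gac.
- have sideN (p : {poly R}) c' e' : ~ side p c' e' v -> ~ side (- p) c' e' (- v).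
    by move=> np [y' y'i]; rewrite hornerN => /oppr_inj py'; apply: np; exists y'.
  right; apply: (above (- g) (- v)).
  + by rewrite hornerN; apply: sideN.
  + by rewrite hornerN; apply: sideN.
  + by rewrite raddfN hornerN; apply: sideN.
  + by rewrite raddfN hornerN; apply: sideN.
  + by rewrite !hornerN gv.
  + by rewrite !hornerN ltrN2.
- by case: n1; exists c.
Qed.

Lemma incr_lt_iff (xi : nat -> R) : (forall i, xi i < xi i.+1) ->
  forall i j, (i < j)%N -> xi i < xi j.
Proof. by move=> H i j; apply: (homo_ltn (r := fun u v => u < v)) => // u v w; apply: lt_trans. Qed.

Lemma open_block_inj (xi : nat -> R) : (forall i, xi i < xi i.+1) ->
  forall i j x, xi i < x < xi i.+1 -> xi j < x < xi j.+1 -> i = j.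
Proof.
move=> H i j x /andP[h1 h2] /andP[h3 h4]; apply/eqP; rewrite eqn_leq.
have mono u v : (u <= v)%N -> xi u <= xi v.
  by rewrite leq_eqVlt => /orP[/eqP ->|/(incr_lt_iff H)/ltW].
apply/andP; split; rewrite leqNgt; apply/negP=> /mono h; lra.
Qed.

(** One small generic gradient serves all pits at once. The points with that gradient have first
    coordinates among the roots of [p1] and second ones among the roots of [p2], and an open
    interval of the grid is determined by any of its points. *)
Lemma pits_count d : exists2 N : nat, (0 < N)%N &
  forall g (xi eta : nat -> R) r, bideg_le d g ->
    (forall i, xi i < xi i.+1) -> (forall i, eta i < eta i.+1) ->
    (#|[set t : 'I_r * 'I_r | `[< pit g (xi t.1) (xi t.1.+1) (eta t.2) (eta t.2.+1) >]]| <= N)%N.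
Proof.
have [N N0 H] := @generic_fibre R d; exists (N * N)%N => [|g xi eta r gd xii etai].
  by rewrite muln_gt0 N0.
set S := [set t | _].
have /choice[del delP] : forall t : 'I_r * 'I_r, exists del : R, 0 < del /\ (t \in S ->
   forall e1 e2, 0 < e1 < del -> 0 < e2 < del ->
    exists x y, [/\ xi t.1 < x < xi t.1.+1, eta t.2 < y < eta t.2.+1, (dX g).[x, y] = e1 & (dY g).[x, y] = e2]).
  move=> t; have [tS|_] := boolP (t \in S); last by exists 1.
  move: (tS); rewrite inE => /asboolP/perturbed_pit[del del0 D].
  by exists del; split.
pose e := \big[Num.min/1]_t del t.
have e0 : 0 < e.
  by apply: (big_ind (fun z => 0 < z)) => [//|u v u0 v0|t _]; [rewrite lt_min u0 v0|case: (delP t)].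
have edel t : e <= del t by rewrite /e (bigD1 t) //= ge_min lexx.
have [w w0 wP] := H _ _ (bideg_le_dX gd) (bideg_le_dY gd).
have [e1 [e2 [e1e e2e we]]] := nonroot2_small w0 e0.
have [p1 [p2 [p10 p20 p1N p2N pr]]] := wP _ _ we.
have crit t : t \in S -> exists x y, [/\ xi t.1 < x < xi t.1.+1, eta t.2 < y < eta t.2.+1, root p1 x & root p2 y].
  move=> tS; case: (delP t) => _ /(_ tS e1 e2) [||x [y [xt yt gx gy]]].
  - by case/andP: e1e => -> /lt_le_trans ->.
  - by case/andP: e2e => -> /lt_le_trans ->.
  by have [r1 r2] := pr x y gx gy; exists x, y.
have cnt (z : nat -> R) (p : {poly R}) : (forall i, z i < z i.+1) -> p != 0 -> (size p <= N)%N ->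
    (#|[set i : 'I_r | `[< exists2 x, (z i < x < z i.+1)%R & root p x >]]| <= N)%N.
  move=> zi p0 pN; apply: leq_trans pN; apply: ltnW.
  have /choice[f fP] : forall i : 'I_r, exists x, (exists2 x, z i < x < z i.+1 & root p x) -> z i < x < z i.+1 /\ root p x.
    by move=> i; have [[x ? ?]|n] := pselect (exists2 x, z i < x < z i.+1 & root p x); [exists x|exists 0].
  apply: (@card_le_roots _ _ _ f p p0) => [i j|i]; rewrite !inE; last by move=> /asboolP/fP[].
  move=> /asboolP/fP[h1 _] /asboolP/fP[h2 _] fij; apply/val_inj.
  by apply: (open_block_inj zi h1); rewrite fij.
apply: leq_trans (leq_mul (cnt xi p1 xii p10 p1N) (cnt eta p2 etai p20 p2N)).
rewrite -cardsX; apply/subset_leq_card/subsetP => t /crit[x [y [h1 h2 h3 h4]]].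
by rewrite !inE; apply/andP; split; apply/asboolP; [exists x|exists y].
Qed.

(** Closed intervals share endpoints: one [size p] counts the roots in half-open intervals, the
    other those at right endpoints. *)
Lemma side_count (p : {poly R}) (eta : nat -> R) r : (forall i, eta i < eta i.+1) -> p != 0 ->
  (#|[set j : 'I_r | `[< side p (eta j) (eta j.+1) 0 >]]| <= 2 * size p)%N.
Proof.
move=> etai p0.
pose A := [set j : 'I_r | `[< exists2 y, eta j <= y < eta j.+1 & root p y >]].
pose B := [set j : 'I_r | root p (eta j.+1)].
have etaW i j : (i <= j)%N -> eta i <= eta j.
  by rewrite leq_eqVlt => /orP[/eqP ->|/(incr_lt_iff etai)/ltW].
apply: (@leq_trans #|A :|: B|).
  apply/subset_leq_card/subsetP => j; rewrite !inE => /asboolP[y /andP[y1 y2] py].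
  have [E|ne] := eqVneq y (eta j.+1); first by rewrite /root -E py eqxx orbT.
  by apply/orP; left; apply/asboolP; exists y; rewrite ?y1 ?lt_neqAle ?ne //= /root py.
apply: leq_trans (leq_card_setU _ _) _; rewrite mul2n -addnn; apply: leq_add; apply: ltnW.
  have /choice[f fP] : forall i : 'I_r, exists x, (exists2 x, eta i <= x < eta i.+1 & root p x) -> eta i <= x < eta i.+1 /\ root p x.
    by move=> i; have [[x ? ?]|n] := pselect (exists2 x, eta i <= x < eta i.+1 & root p x); [exists x|exists 0].
  apply: (@card_le_roots _ _ _ f p p0) => [i j|i]; rewrite !inE; last by move=> /asboolP/fP[].
  move=> /asboolP/fP[/andP[h1 h2] _] /asboolP/fP[/andP[h3 h4] _] fij; apply/val_inj/eqP.
  rewrite eqn_leq; apply/andP; split; rewrite leqNgt; apply/negP=> /etaW h; lra.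
apply: (@card_le_roots _ _ _ (fun j : 'I_r => eta j.+1) p p0) => [i j _ _ E|i]; last by rewrite inE.
by apply/val_inj/eqP; rewrite eqn_leq; apply/andP; split; rewrite leqNgt; apply/negP; rewrite -ltnS => /(incr_lt_iff etai); rewrite E ltxx.
Qed.

(** The summand [r] pays for a line on which [g] is constant: it meets all [r] intervals, but for
    one value only, as [val] is injective. *)
Lemma sides_count d g (line eta : nat -> R) r M (val : 'I_M -> R) : (forall i, eta i < eta i.+1) ->
  bideg_le d g -> injective val ->
  (#|[set t : 'I_r * 'I_r * 'I_M | `[< side g.[(line t.1.1)%:P] (eta t.1.2) (eta t.1.2.+1) (val t.2) >]]|
    <= r * (2 * d.+1 * M + r))%N.
Proof.
move=> etai /andP[_ gY] vinj; set S := [set t | _].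
have -> : #|S| = (\sum_(i < r) \sum_(k < M) #|[set j : 'I_r | `[< side g.[(line i)%:P] (eta j) (eta j.+1) (val k) >]]|)%N.
  pose Q (i j : 'I_r) k := `[< side g.[(line i)%:P] (eta j) (eta j.+1) (val k) >].
  rewrite (card_setX_sum (fun u k => Q u.1 u.2 k)) -(pair_bigA _ (fun i j => #|[set k | Q i j k]|)) /=.
  apply: eq_bigr => i _; under eq_bigr do rewrite card_set_sum.
  by rewrite exchange_big; apply: eq_bigr => k _; rewrite card_set_sum.
rewrite -[X in (_ <= X * _)%N]card_ord -sum_nat_const; apply: leq_sum => i _.
set p := g.[_]; have pd : (size p <= d.+1)%N by apply: leq_trans (max_size_evalC _ _) gY.
have bnd k : (#|[set j : 'I_r | `[< side p (eta j) (eta j.+1) (val k) >]]| <= 2 * d.+1 + (if p == (val k)%:P then r else 0))%N.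
  have [_|npk] := eqVneq p (val k)%:P.
    by apply: leq_trans (max_card _) _; rewrite card_ord leq_addl.
  rewrite addn0; have pk0 : p - (val k)%:P != 0 by rewrite subr_eq0.
  apply: leq_trans (leq_trans (side_count r etai pk0) _).
    apply/subset_leq_card/subsetP => j; rewrite !inE => /asboolP[y yi py]; apply/asboolP; exists y => //.
    by rewrite !hornerE py subrr.
  rewrite leq_mul2l /=; apply: leq_trans (size_polyD _ _) _; rewrite size_polyN geq_max pd.
  exact: leq_trans (size_polyC_leq1 _) _.
apply: (@leq_trans (\sum_(k < M) (2 * d.+1 + (if p == (val k)%:P then r else 0)))%N); first by apply: leq_sum => k _; apply: bnd.
rewrite big_split /= sum_nat_const card_ord mulnC leq_add2l.
have [k /eqP pk|npk] := pickP (fun k => p == (val k)%:P); last by rewrite big1 // => k _; rewrite npk.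
rewrite (bigD1 k) //= pk eqxx big1 ?addn0 // => k' k'k; case: eqP => // /polyC_inj /vinj E.
by rewrite E eqxx in k'k.
Qed.

Lemma hits_count d : exists C : nat,
  forall g (xi eta : nat -> R) r M (val : 'I_M -> R), bideg_le d g -> injective val ->
    (forall i, xi i < xi i.+1) -> (forall i, eta i < eta i.+1) -> (0 < r)%N ->
  (#|[set t : 'I_r * 'I_r * 'I_M |
      `[< hit g (xi t.1.1) (xi t.1.1.+1) (eta t.1.2) (eta t.1.2.+1) (val t.2) >]]|
    <= C * (r * M + r * r))%N.
Proof.
(* Four families of sides cost [r * (2 * d.+1 * M + r)] each; the at most [2 * N] boxes that are
   pits of [g] or of [- g] may each contain all [M] values. *)
have [N N0 H] := pits_count d; exists (8 * d.+1 + 4 + 2 * N)%N.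
move=> g xi eta r M val gd vinj xii etai r0; set S := [set t | _].
have gsd : bideg_le d (swapXY g) by rewrite bideg_le_swap.
have gnd : bideg_le d (- g) by rewrite bideg_leN.
pose T := ('I_r * 'I_r * 'I_M)%type.
pose sw (t : T) : T := (t.1.2, t.1.1, t.2).
pose V (line : nat -> R) := [set t : T | `[< side g.[(line t.1.1)%:P] (eta t.1.2) (eta t.1.2.+1) (val t.2) >]].
pose U (line : nat -> R) := [set t : T | `[< side (swapXY g).[(line t.1.1)%:P] (xi t.1.2) (xi t.1.2.+1) (val t.2) >]].
pose P h := [set t : 'I_r * 'I_r | `[< pit h (xi t.1) (xi t.1.+1) (eta t.2) (eta t.2.+1) >]].
have V1 line : (#|V line| <= r * (2 * d.+1 * M + r))%N by exact: sides_count.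
have U1 line : (#|U line| <= r * (2 * d.+1 * M + r))%N by exact: sides_count.
have P1 : (#|P g| <= N)%N by exact: H.
have P2 : (#|P (- g)| <= N)%N by exact: H.
have sub : S \subset (V xi :|: V (fun i => xi i.+1)) :|:
   (sw @: U eta :|: sw @: U (fun i => eta i.+1)) :|: setX (P g :|: P (- g)) [set: 'I_M].
  apply/subsetP=> -[[i j] k]; rewrite inE /= => /asboolP/(hit_cases (xii _) (etai _)) [[]|[]|[]] h.
  - by rewrite !inE; apply/orP; left; apply/orP; left; apply/orP; left; apply/asboolP.
  - by rewrite !inE; apply/orP; left; apply/orP; left; apply/orP; right; apply/asboolP.
  - have -> : (i, j, k) = sw (j, i, k) by [].
    by rewrite 2!inE; apply/orP; left; apply/orP; right; rewrite inE; apply/orP; left; apply: imset_f; rewrite inE; apply/asboolP.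
  - have -> : (i, j, k) = sw (j, i, k) by [].
    by rewrite 2!inE; apply/orP; left; apply/orP; right; rewrite inE; apply/orP; right; apply: imset_f; rewrite inE; apply/asboolP.
  - by rewrite !inE; apply/orP; right; rewrite andbT; apply/orP; left; apply/asboolP.
  - by rewrite !inE; apply/orP; right; rewrite andbT; apply/orP; right; apply/asboolP.
have B1 := leq_trans (subset_leq_card sub) (leq_card_setU _ _).
have B2 := (leq_card_setU (V xi :|: V (fun i => xi i.+1)) (sw @: U eta :|: sw @: U (fun i => eta i.+1))).1.
have B3 := (leq_card_setU (V xi) (V (fun i => xi i.+1))).1.
have B4 := (leq_card_setU (sw @: U eta) (sw @: U (fun i => eta i.+1))).1.
have B5 : (#|sw @: U eta| <= #|U eta|)%N := leq_imset_card _ _.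
have B6 : (#|sw @: U (fun i => eta i.+1)| <= #|U (fun i => eta i.+1)|)%N := leq_imset_card _ _.
have B7 := (leq_card_setU (P g) (P (- g))).1.
move: B1; rewrite cardsX cardsT card_ord => B1.
have B8 : (#|P g :|: P (- g)| * M <= 2 * N * M)%N by rewrite leq_mul2r; apply/orP; right; lia.
have := (V1 xi, V1 (fun i => xi i.+1), U1 eta, U1 (fun i => eta i.+1)) => -[[[V1a V1b] U1a] U1b].
have rM : (2 * N * M <= 2 * N * (r * M))%N by nia.
have -> : ((8 * d.+1 + 4 + 2 * N) * (r * M + r * r) =
  4 * (r * (2 * d.+1 * M + r)) + 2 * N * (r * M) + (4 * (r * M) + (8 * d.+1 + 2 * N) * (r * r)))%N by ring.
lia.
Qed.
End Pits.

(** * An incidence bound for level curves *)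

Section Incidences.
Local Open Scope nat_scope.

Section KST.
Variables (P G : finType) (inc : P -> G -> bool) (tr : P -> P -> G -> bool).
Variables (K S : nat).
Hypothesis few_nontransversal : forall p g, inc p g -> #|[set q | inc q g && ~~ tr p q g]| <= K.
Hypothesis few_common : forall p q, #|[set g | [&& inc p g, inc q g & tr p q g]]| <= S.

(** Kovari-Sos-Turan double counting of pairs of points on a curve: a point has at most [K]
    nontransversal partners on a curve, and a transversal pair lies on at most [S] curves. The
    parameter [sig] stands for the square root of the number of curves. *)
Lemma kst_cell (Pc : {set P}) (Gc : {set G}) (B sig : nat) :
  (forall p g, p \in Pc -> inc p g -> g \in Gc) -> #|Gc| <= B * sig ^ 2 -> 0 < K ->
  \sum_(p in Pc) #|[set g | inc p g]| <= K * #|Gc| + (S * K + S + B) * (sig * #|Pc|).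
Proof.
move=> PG GcB K0.
pose i g := #|[set p in Pc | inc p g]|.
pose tp g := #|[set t : P * P | [&& t.1 \in Pc, t.2 \in Pc, inc t.1 g, inc t.2 g & tr t.1 t.2 g]]|.
have -> : \sum_(p in Pc) #|[set g | inc p g]| = \sum_(g in Gc) i g.
  transitivity (\sum_(p in Pc) \sum_(g in Gc) inc p g).
    apply: eq_bigr => p pP; rewrite -sum1_card big_mkcond [RHS]big_mkcond; apply: eq_bigr => g _.
    by rewrite inE; case: ifP => pg; [rewrite (PG p)|case: ifP].
  rewrite exchange_big; apply: eq_bigr => g _.
  by rewrite /i -sum1_card big_mkcond [RHS]big_mkcond; apply: eq_bigr => p _; rewrite inE; case: (p \in Pc) => //=; case: inc.
have sq g : i g * i g <= K * i g + tp g.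
  have -> : i g * i g = #|[set t : P * P | [&& t.1 \in Pc, t.2 \in Pc, inc t.1 g & inc t.2 g]]|.
    rewrite /i -cardsX; apply: eq_card => t; rewrite !inE.
    by case: (t.1 \in Pc); case: (t.2 \in Pc); case: inc.
  set A := [set t | _].
  rewrite -(cardsID [set t : P * P | tr t.1 t.2 g] A) addnC; apply: leq_add.
    apply: (@leq_trans #|[set t : P * P | (t.1 \in Pc) && inc t.1 g && (inc t.2 g && ~~ tr t.1 t.2 g)]|).
      apply/subset_leq_card/subsetP => t; rewrite !inE.
      by case/andP => -> /and4P[-> _ -> ->].
    rewrite (card_setX_sum (fun a b => (a \in Pc) && inc a g && (inc b g && ~~ tr a b g))).
    rewrite /i mulnC -sum_nat_const big_mkcond [X in _ <= X]big_mkcond; apply: leq_sum => p _.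
    rewrite [X in if X then K else 0]inE; case: ifP => [/andP[pP pg]|/negP npg]; last first.
      by rewrite leqn0 cards_eq0; apply/eqP/setP=> q; rewrite !inE; case: (boolP (_ && inc p g)) npg.
    apply: leq_trans (few_nontransversal pg); apply/subset_leq_card/subsetP => q; rewrite !inE.
    by case/andP.
  apply/subset_leq_card/subsetP => t; rewrite !inE.
  by case/andP => /and4P[-> -> -> ->].
have tpS : \sum_(g in Gc) tp g <= S * (#|Pc| * #|Pc|).
  rewrite -cardsX mulnC -sum_nat_const.
  apply: (@leq_trans (\sum_(t in setX Pc Pc) #|[set g in Gc | [&& inc t.1 g, inc t.2 g & tr t.1 t.2 g]]|)).
    rewrite /tp; under eq_bigr do rewrite -sum1_card.
    rewrite (exchange_big_dep (mem (setX Pc Pc))) /=; last first.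
      by move=> g t _; rewrite !inE => /and5P[-> ->].
    apply: leq_sum => t tP; rewrite -sum1_card; apply: eq_leq; apply: eq_bigl => g.
    by rewrite !inE; move: tP; rewrite inE => /andP[-> ->].
  apply: leq_sum => t _; apply: leq_trans (few_common t.1 t.2).
  by apply/subset_leq_card/subsetP => g; rewrite !inE => /andP[].
set I := \sum_(g in Gc) i g; set N := #|Pc|.
have sumsq : \sum_(g in Gc) i g * i g <= K * I + S * (N * N).
  apply: (@leq_trans (\sum_(g in Gc) (K * i g + tp g))); first by apply: leq_sum => g _; apply: sq.
  by rewrite big_split /= -big_distrr leq_add2l.
(* With many points, the quadratic inequality [sq] enters a weighted arithmetic-geometric mean; with
   few, it is weakened to [i g <= K + tp g]. *)
have [NK|NK] := leqP (K * sig) N.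
  have [|sig0] := posnP (sig * N); first last.
    have amgm : 2 * (sig * N) * I <= sig ^ 2 * (K * I + S * (N * N)) + #|Gc| * (N * N).
      apply: leq_trans (leq_add (leq_mul (leqnn _) sumsq) (leqnn _)).
      rewrite !big_distrr /= -sum_nat_const -big_split; apply: leq_sum => g _ /=.
      have <- : 2 * (sig * i g * N) = 2 * (sig * N) * i g by ring.
      rewrite mulnn -expnMn mulnn; exact: (nat_Cauchy (sig * i g) N).
    have : sig * N * I <= (S + B) * (sig * N) * (sig * N).
      have : #|Gc| * (N * N) <= B * sig ^ 2 * (N * N) by rewrite leq_mul2r GcB orbT.
      have : sig * (K * sig) * I <= sig * N * I by rewrite leq_mul2r leq_mul2l NK !orbT.
      move: amgm; rewrite !expnS !expn0; nia.
    rewrite mulnC leq_pmul2r //; nia.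
  move/eqP; rewrite muln_eq0 => sN0; suff -> : I = 0 by [].
  case/orP: sN0 => /eqP E0.
    move: GcB; rewrite E0 exp0n // muln0 leqn0 cards_eq0 => /eqP Gc0.
    by rewrite /I Gc0 big_set0.
  apply: big1 => g _; apply/eqP; rewrite -leqn0 -E0.
  by apply/subset_leq_card/subsetP => p; rewrite inE => /andP[].
have lin g : i g <= K + tp g.
  by have := sq g; case: (leqP (i g) K) => h; [lia|nia].
have : I <= K * #|Gc| + S * (N * N).
  apply: (@leq_trans (\sum_(g in Gc) (K + tp g))); first by apply: leq_sum => g _; apply: lin.
  by rewrite big_split /= sum_nat_const mulnC leq_add2l.
have : S * (N * N) <= S * (K * sig * N) by rewrite leq_mul2l leq_mul2r (ltnW NK) !orbT.
nia.
Qed.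
End KST.

(** With truncated subtraction the right side is the distance of [a] and [b]. It is walked in unit
    steps, and two consecutive integers are separated by a multiple of [rho] for at most one
    offset. *)
Lemma floor_changes (rho a b : nat) : 0 < rho ->
  \sum_(th < rho) ((a + th) %/ rho != (b + th) %/ rho) <= (a - b) + (b - a).
Proof.
move=> rho0; wlog ab : a b / a <= b.
  move=> H; have [/H//|/ltnW/H] := leqP a b.
  by rewrite addnC; under eq_bigr do rewrite eq_sym.
rewrite (eqP ab) add0n -{1}(subnKC ab); elim: (b - a) => [|m IH].
  by rewrite big1 // => th _; rewrite addn0 eqxx.
apply: (@leq_trans (\sum_(th < rho) ((a + th) %/ rho != (a + m + th) %/ rho) +
                    \sum_(th < rho) ((a + m + th) %/ rho != (a + m.+1 + th) %/ rho))).
  rewrite -big_split; apply: leq_sum => th _ /=.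
  by have [->|_] := eqVneq ((a + th) %/ rho) ((a + m + th) %/ rho); last by case: (_ != _).
rewrite -[X in _ <= X]addn1; apply: leq_add IH _.
have H (th : 'I_rho) : (a + m + th) %/ rho != (a + m.+1 + th) %/ rho -> (a + m + th) %% rho = rho.-1.
  apply: contraNeq => ne; apply/eqP.
  have -> : a + m.+1 + th = (a + m + th).+1 by lia.
  have := ltn_pmod (a + m + th) rho0; move: ne.
  rewrite [in X in _ = X](divn_eq (a + m + th) rho) -addnS divnMDl //.
  set r := (a + m + th) %% rho => ne lt; rewrite (@divn_small r.+1) ?addn0 //.
  by rewrite ltn_neqAle lt andbT; apply: contra ne => /eqP <-.
have [th0 Hth0|none] := pickP (fun th : 'I_rho => (a + m + th) %/ rho != (a + m.+1 + th) %/ rho).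
  move: Hth0 => /= Hth0; rewrite (bigD1 th0) // Hth0 big1 // => th thn; apply/eqP; rewrite eqb0 negbK.
  apply: contraTT thn => /H E1; have E2 := H _ Hth0; rewrite negbK; apply/eqP/val_inj => /=.
  have : a + m + th = a + m + th0 %[mod rho] by rewrite E1 E2.
  by move/eqP; rewrite eqn_modDl !modn_small ?ltn_ord // => /eqP.
by rewrite big1 // => th _; rewrite none.
Qed.

Lemma dist_card (T : finType) (A B : {set T}) :
  (#|A| - #|B|) + (#|B| - #|A|) <= \sum_t ((t \in A) != (t \in B)).
Proof.
have -> : \sum_t ((t \in A) != (t \in B)) = #|A :\: B| + #|B :\: A|.
  rewrite -!sum1_card [X in _ = X + _]big_mkcond [X in _ = _ + X]big_mkcond -big_split; apply: eq_bigr => t _ /=.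
  by rewrite !inE; case: (t \in A); case: (t \in B).
have := cardsID B A; have := cardsID A B; rewrite setIC; lia.
Qed.

(* [h k g] is the ordinate of the curve [g] at the [k]-th abscissa, defined where [alive k g]. The curves of
   one level, taken in bunches of successive entries into that level, play the role of the cells of a cutting. *)
Section Levels.
Variables (R : realDomainType) (n : nat) (G : finType).
Variables (alive : nat -> G -> bool) (h : nat -> G -> R) (rho mu0 D : nat).

Definition below k y g := alive k g && (h k g < y)%R.
Definition rank k y := #|[set g | below k y g]|.

Hypothesis rho0 : 0 < rho.
Hypothesis few_at_point : forall k y, k < n -> #|[set g | alive k g && (h k g == y)]| <= mu0.
Hypothesis few_changes : forall g g',
  #|[set k : 'I_n | [&& k.+1 < n, alive k g, alive k.+1 g &
      below k (h k g) g' != below k.+1 (h k.+1 g) g']]| <= D.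
(** In other words, the abscissae where a curve is alive form an interval. *)
Hypothesis one_birth : forall g,
  #|[set k : 'I_n | alive k g && ((k == 0 :> nat) || ~~ alive k.-1 g)]| <= 1.

(** Ranks count the curves strictly below, so fewer than [rho] curves lie from the lowest member of
    the window up to, but not including, the ordinate of the highest; [mu0] covers the ties with the
    highest. *)
Lemma rank_window k x : k < n ->
  #|[set g | alive k g && (x <= rank k (h k g) < x + rho)]| <= rho + mu0.
Proof.
move=> kn; set A := [set g | _].
have [->|[g0 g0A]] := set_0Vmem A; first by rewrite cards0.
have [g1 g1A g1max] := @Order.TotalTheory.arg_maxP _ R G g0 (fun g => g \in A) (h k) g0A.
have [g2 g2A g2min] := @Order.TotalTheory.arg_minP _ R G g0 (fun g => g \in A) (h k) g0A.
pose B y := [set g | below k y g].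
have sub : A \subset (B (h k g1) :\: B (h k g2)) :|: [set g | alive k g && (h k g == h k g1)].
  apply/subsetP=> g gA; move: (g1max g gA) (g2min g gA); rewrite !inE /below.
  move: (gA); rewrite inE => /andP[-> _] /= h1 h2; rewrite -leNgt h2 /=.
  by move: h1; rewrite le_eqVlt orbC.
apply: leq_trans (subset_leq_card sub) _; apply: leq_trans (leq_card_setU _ _) _.
apply: leq_add (few_at_point _ kn).
have := cardsID (B (h k g2)) (B (h k g1)).
have -> : B (h k g1) :&: B (h k g2) = B (h k g2).
  apply/setIidPr/subsetP => g; rewrite !inE /below => /andP[-> /lt_le_trans -> //].
  by apply: g1max.
move: g1A g2A; rewrite !inE /rank -/(B _) -/(B _) => /and3P[_ _ r1] /and3P[_ r2 _]; lia.
Qed.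

Definition rk k g := rank k (h k g).

(** The rank of [g] moves by at most the number of curves whose order with [g] changes, and each
    pair changes its order at most [D] times. *)
Lemma total_variation :
  \sum_g \sum_(k < n | [&& k.+1 < n, alive k g & alive k.+1 g]) ((rk k g - rk k.+1 g) + (rk k.+1 g - rk k g))
    <= #|G| * (#|G| * D).
Proof.
rewrite -[X in _ <= X]sum_nat_const; apply: leq_sum => g _.
apply: (@leq_trans (\sum_(k < n | [&& k.+1 < n, alive k g & alive k.+1 g])
   \sum_g' (below k (h k g) g' != below k.+1 (h k.+1 g) g'))).
  apply: leq_sum => k _; apply: leq_trans (dist_card _ _) _.
  by apply: leq_sum => g' _; rewrite !inE.
rewrite exchange_big -[X in _ <= X]sum_nat_const; apply: leq_sum => g' _ /=.
apply: leq_trans (few_changes g g'); rewrite -sum1_card big_mkcond [X in _ <= X]big_mkcond.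
by apply: leq_sum => k _; rewrite inE !andbA; case: ifP => //= _; case: (_ != _).
Qed.

Definition lev th k g := (rk k g + th) %/ rho.
Definition crossings th := \sum_g \sum_(k < n | [&& k.+1 < n, alive k g & alive k.+1 g])
  (lev th k g != lev th k.+1 g).

(* Averaging over the offset of the levels: a curve cannot oscillate around most of the level boundaries. *)
Lemma good_offset : exists2 th, th < rho & rho * crossings th <= #|G| * (#|G| * D).
Proof.
have tot : \sum_(th < rho) crossings th <= #|G| * (#|G| * D).
  apply: leq_trans total_variation; rewrite /crossings exchange_big; apply: leq_sum => g _ /=.
  rewrite exchange_big; apply: leq_sum => k _ /=; exact: floor_changes.
have [th _ thmin] := @Order.TotalTheory.arg_minP _ _ _ (Ordinal rho0) predT (fun th : 'I_rho => crossings th) isT.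
exists th => //; apply: leq_trans tot; rewrite -[X in X * _]card_ord -sum_nat_const.
by apply: leq_sum => i _; apply: thmin.
Qed.

Section Cells.
Variable th : nat.
Hypothesis th_rho : th < rho.
Let mu := rho + mu0.

Definition entry k g := alive k g && [|| k == 0, ~~ alive k.-1 g | lev th k.-1 g != lev th k g].
Definition entries j k := #|[set t : 'I_n * G | [&& t.1 <= k, entry t.1 t.2 & lev th t.1 t.2 == j]]|.
Definition all_entries j := #|[set t : 'I_n * G | entry t.1 t.2 && (lev th t.1 t.2 == j)]|.

(** A cell is a level together with a range of abscissae that ends once the number of entries into
    the level has passed the next multiple of [mu]; [e] numbers these ranges. *)
Definition cell_curves j e : {set G} :=
  [set g | [exists k : 'I_n, [&& alive k g, lev th k g == j & entries j k %/ mu == e]]].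

(** At the first abscissa of the cell the level holds at most [mu] curves, by [rank_window]. All
    other curves enter later, and fewer than [mu] entries separate two abscissae of one range. *)
Lemma card_cell_curves j e : #|cell_curves j e| <= 2 * mu.
Proof.
have mu_gt0 : 0 < mu by rewrite addn_gt0 rho0.
pose Q (k : 'I_n) := entries j k %/ mu == e.
have [k9 k9Q|none] := pickP Q; last first.
  rewrite (_ : cell_curves j e = set0) ?cards0 //; apply/setP=> g; rewrite !inE.
  by apply/existsP => -[k /and3P[_ _]]; have := none k; rewrite /Q => ->.
have [k0 k0Q k0min] := @Order.TotalTheory.arg_minP _ _ _ k9 Q (fun k : 'I_n => (k : nat)) k9Q.
have [k1 k1Q k1max] := @Order.TotalTheory.arg_maxP _ _ _ k9 Q (fun k : 'I_n => (k : nat)) k9Q.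
pose X := [set g | alive k0 g && (lev th k0 g == j)].
pose Y := [set t : 'I_n * G | [&& k0 < t.1, t.1 <= k1, entry t.1 t.2 & lev th t.1 t.2 == j]].
have sub : cell_curves j e \subset X :|: (snd @: Y).
  apply/subsetP=> g; rewrite !inE => /existsP[k /and3P[ak lk kQ]].
  have k0k : k0 <= k by exact: k0min.
  have kk1 : k <= k1 by exact: k1max.
  rewrite -orbC.
  have [//|nX] := boolP (alive k0 g && _); first by rewrite orbT.
  rewrite orbF.
  have ex : exists m, [&& k0 < m, m <= k, alive m g & lev th m g == j].
    exists k; rewrite ak lk leqnn !andbT ltn_neqAle k0k andbT.
    by apply: contraNneq nX => ->; rewrite ak lk.
  case: (ex_minnP ex) => m /and4P[k0m mk am lm] mmin.
  have mn : m < n by apply: leq_ltn_trans mk _.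
  apply/imsetP; exists (Ordinal mn, g) => //; rewrite inE /= k0m (leq_trans mk) //= lm andbT /entry am /=.
  case: m k0m mk am lm mmin {mn} => // m k0m mk am lm mmin /=.
  rewrite -implybE; apply/implyP=> am'; apply/eqP=> E.
  move: k0m; rewrite ltnS leq_eqVlt => /orP[/eqP k0m|k0m].
    by move: nX; rewrite k0m am' E lm.
  by have := mmin m; rewrite k0m am' E lm (ltnW mk) ltnn => /(_ isT).
apply: leq_trans (subset_leq_card sub) _; apply: leq_trans (leq_card_setU _ _) _.
rewrite mul2n -addnn; apply: leq_add.
  have := @rank_window k0 (j * rho - th) (ltn_ord k0).
  have := @rank_window k0 0 (ltn_ord k0).
  (* When [j * rho < th] the lowest level is cut off by the offset, and its ranks start at 0. *)
  have [jth|jth] := leqP th (j * rho) => _ W.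
    apply: leq_trans W; apply/subset_leq_card/subsetP => g; rewrite !inE => /andP[-> /eqP <-] /=.
    rewrite /lev /rk; have := leq_trunc_div (rk k0 g + th) rho; have := ltn_ceil (rk k0 g + th) rho0.
    by rewrite /rk mulSn; move: jth; lia.
  apply: leq_trans (@rank_window k0 0 (ltn_ord k0)); apply/subset_leq_card/subsetP => g; rewrite !inE => /andP[-> /eqP lj] /=.
  have := ltn_ceil (rk k0 g + th) rho0; move: lj jth; rewrite /lev => ->; rewrite mulSn /rk; lia.
apply: leq_trans (leq_imset_card _ _) _.
have EY : entries j k0 + #|Y| <= entries j k1.
  rewrite /entries.
  have -> : #|[set t : 'I_n * G | [&& t.1 <= k1, entry t.1 t.2 & lev th t.1 t.2 == j]]| =
     #|[set t : 'I_n * G | [&& t.1 <= k0, entry t.1 t.2 & lev th t.1 t.2 == j]]| + #|Y|; last by [].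
  rewrite -cardsUI [X in _ + X](_ : _ = 0) ?addn0.
    apply: eq_card => t; rewrite !inE; have : k0 <= k1 by exact: k0min.
    move: (entry _ _ && _) => b.
    rewrite !andbA; case: b; rewrite ?andbF ?andbT //=; have := leqP t.1 k0; lia.
  by apply/eqP; rewrite cards_eq0; apply/eqP/setP=> t; rewrite !inE; case: ltnP; rewrite ?andbF.
move: k0Q k1Q; rewrite /Q => /eqP q0 /eqP q1.
have := ltn_ceil (entries j k1) mu_gt0; have := leq_trunc_div (entries j k0) mu.
rewrite q0 q1 mulSn; lia.
Qed.

(** An entry is the birth of a curve or a crossing between levels. *)
Lemma sum_all_entries J : \sum_(j < J) all_entries j <= #|G| + crossings th.
Proof.
apply: (@leq_trans #|[set t : G * 'I_n | entry t.2 t.1]|).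
  rewrite /all_entries; under eq_bigr do rewrite -sum1_card.
  under eq_bigr do rewrite big_mkcond.
  rewrite exchange_big -sum1_card [X in _ <= X]big_mkcond /=.
  pose sw (t : 'I_n * G) := (t.2, t.1).
  rewrite [X in _ <= X](reindex sw) /=; last by exists (fun t => (t.2, t.1)) => -[].
  apply: leq_sum => t _; rewrite inE /=; case: (boolP (entry _ _)) => et; last first.
    by rewrite big1 // => j _; rewrite inE (negPf et).
  have [j0 j0P|none] := pickP (fun j : 'I_J => lev th t.1 t.2 == j); last first.
    by rewrite big1 // => j _; rewrite inE none andbF.
  rewrite (bigD1 j0) //= big1 ?addn0; first by case: ifP.
  move=> j jj0; rewrite inE (eqP j0P); case: eqP; rewrite ?andbF // => E.
  by move/eqP: jj0; case; apply/val_inj.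
rewrite (card_setX_sum (fun g k => entry (k : 'I_n) g)) -sum1_card -big_split.
apply: leq_sum => g _ /=.
pose X := [set k : 'I_n | alive k g && ((k == 0 :> nat) || ~~ alive k.-1 g)].
pose Y := [set k : 'I_n | [&& 0 < k, alive k.-1 g, alive k g & lev th k.-1 g != lev th k g]].
apply: (@leq_trans #|X :|: Y|).
  apply/subset_leq_card/subsetP => k; rewrite !inE /entry => /andP[-> /=].
  have [k0|k0] := posnP k; first by rewrite k0.
  by case: (alive k.-1 g).
apply: leq_trans (leq_card_setU _ _) _; apply: leq_add; first exact: one_birth.
pose pr (k : 'I_n) : 'I_n := Ordinal (leq_ltn_trans (leq_pred k) (ltn_ord k)).
rewrite -(card_in_imset (f := pr)); last first.
  by move=> k k'; rewrite !inE => /and4P[k0 _ _ _] /and4P[k'0 _ _ _] /(congr1 val) /= E; apply/val_inj => /=; lia.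
rewrite -sum1_card big_mkcond [X in _ <= X]big_mkcond; apply: leq_sum => k _ /=.
case: ifP => // /imsetP[k']; rewrite inE => /and4P[k'0 a1 a2 l12] ->.
by rewrite /= prednK // ltn_ord a1 a2 l12.
Qed.
End Cells.

Variables (P : finType) (kp : P -> 'I_n) (pos : P -> R) (inc : P -> G -> bool) (tr : P -> P -> G -> bool).
Variables (K S B sig : nat).
Hypothesis inc_alive : forall p g, inc p g -> alive (kp p) g /\ h (kp p) g = pos p.
Hypothesis few_nontransversal : forall p g, inc p g -> #|[set q | inc q g && ~~ tr p q g]| <= K.
Hypothesis few_common : forall p q, #|[set g | [&& inc p g, inc q g & tr p q g]]| <= S.

(** [kst_cell] is summed over all cells. A level with E entries has at most E / [mu] + 1 nonempty
    cells of at most [2 * mu] curves, so the total number of curves in cells is governed by the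
    number of levels and of entries, and the latter by the crossings for a good offset. The factor
    [rho] on both sides avoids a division. *)
Theorem incidence_bound : 0 < K -> 2 * (rho + mu0) <= B * sig ^ 2 ->
  rho * \sum_p #|[set g | inc p g]| <=
    rho * (K * (2 * (rho + mu0) * (#|G| %/ rho + 2) + 2 * #|G|) + (S * K + S + B) * (sig * #|P|)) +
    2 * K * (#|G| * (#|G| * D)).
Proof.
move=> K0 muB; have [th thrho cross] := good_offset.
set mu := rho + mu0 in muB *.
have mu_gt0 : 0 < mu by rewrite addn_gt0 rho0.
pose J := #|G| %/ rho + 2; pose E := (n * #|G|).+1.
pose jp p := (rank (kp p) (pos p) + th) %/ rho.
pose ep p := entries th (jp p) (kp p) %/ mu.
have jpJ p : jp p < J.
  rewrite ltn_divLR // /J mulnDl; have : rank (kp p) (pos p) <= #|G| by exact: max_card.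
  have := ltn_ceil #|G| rho0; rewrite mulSn; lia.
have entE j k : entries th j k < E.
  by rewrite ltnS -[X in X * _]card_ord -card_prod max_card.
have epE p : ep p < E by apply: leq_ltn_trans (leq_div _ _) (entE _ _).
pose cellp p : 'I_J * 'I_E := (Ordinal (jpJ p), Ordinal (epE p)).
rewrite (partition_big cellp predT) //=.
have cellb (c : 'I_J * 'I_E) : \sum_(p | cellp p == c) #|[set g | inc p g]| <=
    K * #|cell_curves th c.1 c.2| + (S * K + S + B) * (sig * #|[set p | cellp p == c]|).
  have := @kst_cell P G inc tr K S few_nontransversal few_common [set p | cellp p == c] (cell_curves th c.1 c.2) B sig.
  rewrite (eq_bigl (fun p => cellp p == c)); last by move=> p; rewrite inE.
  apply=> //; last by exact: leq_trans (card_cell_curves thrho c.1 c.2) muB.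
  move=> p g; rewrite inE => /eqP <- pg; have [ag hg] := inc_alive pg; rewrite inE /=.
  by apply/existsP; exists (kp p); rewrite ag /ep /lev /rk hg /jp !eqxx.
have sumP : \sum_(c : 'I_J * 'I_E) #|[set p | cellp p == c]| = #|P|.
  rewrite -sum1_card (partition_big cellp predT) //=; apply: eq_bigr => c _.
  by rewrite -sum1_card; apply: eq_bigl => p; rewrite inE.
have sumG : \sum_(c : 'I_J * 'I_E) #|cell_curves th c.1 c.2| <= 2 * mu * J + 2 * (#|G| + crossings th).
  rewrite -(pair_bigA _ (fun (j : 'I_J) (e : 'I_E) => #|cell_curves th j e|)) /=.
  apply: (@leq_trans (\sum_(j < J) (2 * mu + 2 * all_entries th j))); last first.
    rewrite big_split /= sum_nat_const card_ord mulnC leq_add2l -big_distrr /= leq_mul2l /=.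
    exact: sum_all_entries.
  apply: leq_sum => j _.
  apply: (@leq_trans (\sum_(e < E) (if e <= all_entries th j %/ mu then 2 * mu else 0))).
    apply: leq_sum => e _; case: ifP => [_|/negbT]; first exact: card_cell_curves thrho _ _.
    rewrite -ltnNge => ne.
    rewrite leqn0 cards_eq0; apply/eqP/setP=> g; rewrite !inE; apply/existsP=> -[k /and3P[_ _ /eqP ek]].
    move: ne; rewrite ltnNge -ek => /negP; apply; apply: leq_div2r.
    by apply/subset_leq_card/subsetP => t; rewrite !inE => /and3P[_ -> ->].
  rewrite -big_mkcond sum_nat_const.
  apply: (@leq_trans ((all_entries th j %/ mu).+1 * (2 * mu))).
    rewrite leq_mul2r; apply/orP; right.
    rewrite -[X in _ <= X]card_ord; pose f (e : 'I_E) : 'I_(all_entries th j %/ mu).+1 := inord e.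
    apply: (@leq_trans #|f @: [set e : 'I_E | e <= all_entries th j %/ mu]|); last exact: max_card.
    rewrite card_in_imset; first by apply/subset_leq_card/subsetP => e; rewrite inE.
    move=> e e'; rewrite !inE => h1 h2 /(congr1 val) /=; rewrite !inordK ?ltnS // => ee; exact/val_inj.
  rewrite mulSn leq_add2l mulnCA leq_mul2l /=; exact: leq_trunc_div.
apply: (@leq_trans (rho * \sum_(c : 'I_J * 'I_E) (K * #|cell_curves th c.1 c.2| + (S * K + S + B) * (sig * #|[set p | cellp p == c]|)))).
  by rewrite leq_mul2l; apply/orP; right; apply: leq_sum => c _; apply: cellb.
rewrite big_split /= -!big_distrr /= sumP.
have : rho * (K * \sum_(c : 'I_J * 'I_E) #|cell_curves th c.1 c.2|) <= rho * (K * (2 * mu * J + 2 * (#|G| + crossings th))).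
  by rewrite !leq_mul2l sumG !orbT.
have : 2 * K * (rho * crossings th) <= 2 * K * (#|G| * (#|G| * D)) by rewrite leq_mul2l cross orbT.
rewrite -/J !(mulnDr rho).
have -> : rho * (K * (2 * mu * J + 2 * (#|G| + crossings th))) =
  rho * (K * (2 * mu * J + 2 * #|G|)) + 2 * K * (rho * crossings th) by ring.
move=> H1 H2; rewrite [X in _ <= X]addnAC leq_add2r.
by apply: leq_trans H2 _; rewrite leq_add2l.
Qed.
End Levels.

End Incidences.

(** * Monotone arcs of polynomial curves *)

Section Monotone.
Variable R : realType.
Implicit Types p q : {poly R}.

Definition inc_on p (a b : R) : Prop :=
  forall x x', a <= x -> x < x' -> x' <= b -> p.[x] < p.[x'].

Definition smono_on p a b : Prop := inc_on p a b \/ inc_on (- p) a b.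

Lemma inc_onW p a b a' b' : a <= a' -> b' <= b -> inc_on p a b -> inc_on p a' b'.
Proof. by move=> h1 h2 H x x' h3 h4 h5; apply: H => //; [apply: le_trans h3|apply: le_trans h2]. Qed.

Lemma smono_onW p a b a' b' : a <= a' -> b' <= b -> smono_on p a b -> smono_on p a' b'.
Proof. by move=> h1 h2 [] /(inc_onW h1 h2); [left|right]. Qed.

Lemma inc_on_inj p a b x y : inc_on p a b -> a <= x <= b -> a <= y <= b -> p.[x] = p.[y] -> x = y.
Proof.
move=> H /andP[h1 h2] /andP[h3 h4] E; case: (ltgtP x y) => // h.
  by have := H _ _ h1 h h4; rewrite E ltxx.
by have := H _ _ h3 h h2; rewrite E ltxx.
Qed.

Lemma smono_on_inj p a b x y : smono_on p a b -> a <= x <= b -> a <= y <= b -> p.[x] = p.[y] -> x = y.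
Proof.
case=> H h1 h2 E; apply: inc_on_inj H h1 h2 _ => //; by rewrite !hornerN E.
Qed.

Lemma inc_on_lt p a b x y : inc_on p a b -> a <= x <= b -> a <= y <= b -> (p.[x] < p.[y]) = (x < y).
Proof.
move=> H /andP[h1 h2] /andP[h3 h4]; case: (ltgtP x y) => h.
- by rewrite (H _ _ h1 h h4).
- by apply/negbTE; rewrite -leNgt ltW // (H _ _ h3 h h2).
- by rewrite h ltxx.
Qed.

Lemma noroot_smono p a b : (forall x, a < x < b -> ~~ root p^`() x) -> smono_on p a b.
Proof.
move=> nr; have [ab|ba] := ltP a b; last first.
  by left=> x x' h1 h2 h3; move: (lt_le_trans (le_lt_trans h1 h2) h3); rewrite ltNge ba.
have nr' : {in `]a, b[, forall x, ~~ root p^`() x} by move=> x; rewrite in_itv /= => /nr.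
have sg := polyrN0_itv nr'.
have mid : (a + b) / 2 \in `]a, b[ by rewrite in_itv /=; lra.
have [pos|neg|z] := ltgtP 0 (p^`()).[(a + b) / 2].
- left=> x x' h1 h2 h3; apply: (@ltr_hornerW _ p a b) => //; rewrite ?in_itv /=; try lra.
  by move=> y yi; rewrite -sgr_cp0 (sg _ _ mid yi) gtr0_sg.
- right=> x x' h1 h2 h3; apply: (@ltr_hornerW _ (- p) a b) => //; rewrite ?in_itv /=; try lra.
  by move=> y yi; rewrite derivN hornerN oppr_gt0 -sgr_cp0 (sg _ _ mid yi) ltr0_sg.
- by have := nr' _ mid; rewrite /root -z eqxx.
Qed.

(** The cuts are [lo], the roots of the derivative and [hi]; repeating [hi] adds degenerate
    intervals, which makes the number of pieces independent of [p]. *)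
Lemma monotone_pieces p (d : nat) (lo hi : R) : lo < hi -> (size p <= d.+1)%N -> p^`() != 0 ->
  exists c : nat -> R, [/\
    forall i, lo <= c i, forall i, c i <= hi, forall i, c i <= c i.+1,
    forall x, lo < x <= hi -> exists i : 'I_d.+1, c i < x <= c i.+1 &
    forall i, smono_on p (c i) (c i.+1)].
Proof.
move=> lohi pd p0; pose rs := roots p^`() lo hi.
pose s := lo :: rcons rs hi.
have rsin x : x \in rs -> lo < x < hi by move/roots_in; rewrite in_itv.
have srt : sorted <%R s.
  rewrite /s /= rcons_path; apply/andP; split; first exact: path_roots.
  by have := mem_last lo rs; rewrite inE => /orP[/eqP ->//|/rsin/andP[]].
have szs : size s = (size rs).+2 by rewrite /s /= size_rcons.
have rsd : (size rs < d.+1)%N.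
  rewrite ltnS; have : (size rs < size p^`())%N.
    apply: max_poly_roots p0 _ (uniq_roots _ _ _).
    by apply/allP=> x /root_roots.
  by move=> h; have := size_poly (size p).-1 (fun i => p`_i.+1 *+ i.+1); rewrite -/(p^`()) => h2; move: h h2 pd; rewrite /deriv; lia.
pose c i := nth hi s i.
have cin i : lo <= c i <= hi.
  have [iz|iz] := ltnP i (size s); last by rewrite /c nth_default // lexx ltW.
  have := mem_nth hi iz; rewrite -/(c i) /s inE mem_rcons inE => /or3P[/eqP ->|/eqP ->|/rsin/andP[? ?]]; rewrite ?lexx ?ltW //.
have cS i : c i <= c i.+1.
  have [iz|iz] := ltnP i.+1 (size s).
    by rewrite ltW // (sorted_ltn_nth lt_trans) // inE ltnW.
  by rewrite /c [nth hi s i.+1]nth_default //; case/andP: (cin i).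
exists c; split=> //; try by move=> i; case/andP: (cin i).
- move=> x /andP[xlo xhi].
  have ex : exists i, x <= c i by exists (size s); rewrite /c nth_default.
  case: (ex_minnP ex) => -[|i]; first by rewrite /c /= leNgt xlo.
  move=> xi imin; have ilt : (i < d.+1)%N.
    rewrite ltnNge; apply/negP=> id; have := imin (size rs).+1.
    rewrite /c /s /= nth_rcons ltnn eqxx xhi => /(_ isT). by rewrite ltnS => h; have := leq_ltn_trans h rsd; rewrite ltnS leqNgt id.
  exists (Ordinal ilt); rewrite /= xi andbT ltNge; apply/negP=> /imin; by rewrite ltnn.
move=> i; apply: noroot_smono => x /andP[x1 x2]; apply/negP=> xr.
have xrs : x \in s.
  rewrite /s inE mem_rcons inE; apply/orP; right; apply/orP; right.
  rewrite /rs -root_is_roots //; rewrite in_itv /=.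
  by case/andP: (cin i) => l1 _; case/andP: (cin i.+1) => _ l2; apply/andP; split; lra.
have [k ks xk] := nthP hi xrs; move: x1 x2; rewrite -xk /c.
have mono u v : (u <= v)%N -> nth hi s u <= nth hi s v.
  by move=> uv; rewrite -/(c u) -/(c v); apply: (homo_leq (r := fun u v => u <= v)) uv => // ? ? ?; apply: le_trans.
move=> x1 x2; have [/mono|/mono] := leqP k i; by [rewrite leNgt x1|rewrite leNgt x2].
Qed.

Lemma horner_reflect (G : {poly {poly R}}) x y :
  (map_poly (comp_poly (- 'X)) G).[x, y] = G.[x, - y].
Proof.
elim/poly_ind: G => [|G p IH]; first by rewrite rmorph0 !horner0.
by rewrite rmorphD rmorphM /= map_polyX map_polyC /= !hornerE IH horner_comp hornerN hornerX.
Qed.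

(** Reduction to increasing arcs: negating both [p] and [q] makes [p] increasing, and the reflection
    of [y] then turns a decreasing [q] into an increasing one. *)
Lemma curve_ivt p q (G : {poly {poly R}}) (x1 x2 y1 y2 c e w : R) :
  x1 < x2 -> smono_on p x1 x2 -> smono_on q c e -> c <= y1 <= e -> c <= y2 <= e ->
  p.[x1] = q.[y1] -> p.[x2] = q.[y2] -> (G.[x1, y1] - w) * (G.[x2, y2] - w) < 0 ->
  exists x y, [/\ x1 < x < x2, c <= y <= e, p.[x] = q.[y] & G.[x, y] = w].
Proof.
move=> x12 pm; wlog: p q pm / inc_on p x1 x2.
  move=> H qm y1i y2i e1 e2 Gw; case: (pm) => pinc; first exact: (H p q).
  have [||||x [y [? ? E ?]]] := H (- p) (- q) _ pinc _ y1i y2i _ _ Gw; rewrite ?hornerN ?e1 ?e2 //.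
  - by left.
  - by case: qm; [right; rewrite opprK|left].
  by exists x, y; split=> //; move: E; rewrite !hornerN => /oppr_inj.
move=> pinc [qinc|qdec] y1i y2i e1 e2 Gw.
  have y12 : y1 < y2 by rewrite -(inc_on_lt qinc) // -e1 -e2 (inc_on_lt pinc) ?lexx ?ltW.
  have [|x [y [? yi ? ?]]] := Analysis.curve_ivt_inc x12 (ltW y12) pinc _ e1 e2 Gw.
    by apply: inc_onW qinc; [case/andP: y1i|case/andP: y2i].
  exists x, y; split=> //; case/andP: yi => h1 h2; case/andP: y1i => h3 _; case/andP: y2i => _ h4.
  by rewrite (le_trans h3 h1) (le_trans h2 h4).
have y21 : y2 < y1.
  by rewrite -(inc_on_lt qdec) // !hornerN ltrN2 -e1 -e2 (inc_on_lt pinc) ?lexx ?ltW.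
pose q' := q \Po - 'X; pose G' := map_poly (comp_poly (- 'X)) G.
have q'E y : q'.[y] = q.[- y] by rewrite /q' horner_comp hornerN hornerX.
have [|||||x [y [xi yi E1 E2]]] := @Analysis.curve_ivt_inc R p q' G' x1 x2 (- y1) (- y2) w x12 _ pinc.
- by rewrite lerN2 ltW.
- move=> y y' h1 h2 h3; rewrite !q'E.
  rewrite -ltrN2 -!hornerN; apply: qdec.
  + by case/andP: y2i => h _; apply: le_trans h _; lra.
  + by rewrite ltrN2.
  + by case/andP: y1i => _ h; apply: le_trans h; lra.
- by rewrite q'E opprK.
- by rewrite q'E opprK.
- by rewrite !horner_reflect !opprK.
exists x, (- y); split=> //.
- by case/andP: y1i => _ h1; case/andP: y2i => h2 _; case/andP: yi => h3 h4; apply/andP; split; lra.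
- by rewrite E1 q'E.
- by rewrite -horner_reflect.
Qed.
End Monotone.

(** * The curves f(x, y) = f(x', y') *)

Section Univariate.
Variable R : realType.
Implicit Types p q : {poly R}.

Lemma hornerXpart p x y : (map_poly polyC p).[x, y] = p.[x].
Proof. by rewrite horner_map /= hornerC. Qed.

Lemma hornerYpart p x y : (p%:P).[x, y] = p.[y].
Proof. by rewrite hornerC. Qed.

Lemma bideg_le_Ypart d p : (size p <= d.+1)%N -> bideg_le d (p%:P).
Proof.
move=> pd; rewrite /bideg_le (leq_trans (size_polyC_leq1 _)) //=.
apply/bigmax_leqP => i _; rewrite coefC; case: eqP => // _; by rewrite size_poly0.
Qed.

Lemma bideg_le_Xpart d p : (size p <= d.+1)%N -> bideg_le d (map_poly polyC p).
Proof. by move=> pd; rewrite -bideg_le_swap swapXY_map_polyC bideg_le_Ypart. Qed.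

Lemma dX_Xpart p : dX (map_poly polyC p) = map_poly polyC p^`().
Proof. exact: deriv_map. Qed.

Lemma dY_Xpart p : dY (map_poly polyC p) = 0.
Proof. by apply/polyP=> i; rewrite coef_dY coef_map /= derivC coef0. Qed.

Lemma between_value q (c e y y' v : R) : c < y <= e -> c < y' <= e ->
  (q.[y] - v) * (q.[y'] - v) <= 0 -> exists2 z, c < z <= e & q.[z] = v.
Proof.
wlog yy' : y y' / y <= y'.
  move=> H h1 h2; have [|/ltW] := leP y y'; first by move/H; apply.
  by rewrite mulrC => /H; apply.
move=> /andP[y1 y2] /andP[y3 y4] Hs; have vp (r : {poly R}) y0 : (r - v%:P).[y0] = r.[y0] - v by rewrite !hornerE.
have [qv|qv] := leP q.[y] v; last first.
  have neg : (- (q - v%:P)).[y] <= 0 <= (- (q - v%:P)).[y'] by rewrite !hornerN !vp; nra.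
  have [z /andP[z1 z2]] := poly_ivt yy' neg; rewrite /root hornerN vp oppr_eq0 subr_eq0 => /eqP qz.
  by exists z => //; rewrite (lt_le_trans y1) //= (le_trans z2).
have [E|nE] := eqVneq q.[y] v; first by exists y; rewrite ?y1.
have qlt : q.[y] < v by rewrite lt_neqAle nE.
have neg : (q - v%:P).[y] <= 0 <= (q - v%:P).[y'] by rewrite !vp; nra.
have [z /andP[z1 z2]] := poly_ivt yy' neg; rewrite /root vp subr_eq0 => /eqP qz.
by exists z => //; rewrite (lt_le_trans y1) //= (le_trans z2).
Qed.

Lemma branch_below q (c e v u : R) : inc_on q c e -> c <= e ->
  (exists y, [/\ c < y <= e, v = q.[y] & y < u]) <->
  [&& c < u, q.[c] < v & if e < u then ~~ (q.[e] < v) else v < q.[u]].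
Proof.
move=> inc ce; have lt := inc_on_lt inc.
have ci : c <= c <= e by rewrite lexx ce.
have ei : c <= e <= e by rewrite lexx ce.
have vp (r : {poly R}) y0 : (r - v%:P).[y0] = r.[y0] - v by rewrite !hornerE.
have ivt z : c <= z <= e -> q.[c] < v -> v <= q.[z] -> exists y, [/\ c < y <= e, v = q.[y] & y <= z].
  move=> /andP[cz ze] qc qz; have neg : (q - v%:P).[c] <= 0 <= (q - v%:P).[z] by rewrite !vp; lra.
  have [y /andP[cy yz]] := poly_ivt cz neg; rewrite /root vp subr_eq0 => /eqP qy.
  exists y; split=> //; rewrite (le_trans yz) // andbT lt_neqAle cy andbT; apply/eqP=> E.
  by move: qc; rewrite -qy E ltxx.
split=> [[y [/andP[cy ye] -> yu]]|/and3P[cu qc]].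
  have yi : c <= y <= e by rewrite ye ltW.
  rewrite (lt_trans cy yu) lt // cy /=.
  case: ifP => [_|/negbT]; first by rewrite lt // -leNgt.
  by rewrite -leNgt => ue; rewrite lt // ue andbT ltW // (lt_trans cy).
case: ifP => [eu|/negbT]; first by rewrite -leNgt => /(ivt _ ei qc)[y [h1 h2 ye]]; exists y; split=> //; apply: le_lt_trans eu.
rewrite -leNgt => ue vq; have ui : c <= u <= e by rewrite ltW.
have [y [h1 h2]] := ivt _ ui qc (ltW vq).
rewrite le_eqVlt => /orP[/eqP yu|yu]; last by exists y.
by move: vq; rewrite h2 yu ltxx.
Qed.
End Univariate.

Section Curves.
Variables (R : realType) (d : nat) (f : {poly {poly R}}) (a b : nat -> R) (s : nat).
Hypothesis fd : bideg_le d f.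
Hypothesis s0 : (0 < s)%N.
Hypothesis a_incr : forall i, a i < a i.+1.
Hypothesis b_incr : forall i, b i < b i.+1.
Let n := (s * s)%N.

Definition phi l : {poly R} := (swapXY f).[(b l)%:P].
(** Codes a pair of indices of one block: the second index is given by its offset [o] in the block
    of [k]. *)
Definition mate k o := (k %/ s * s + o)%N.
Hypothesis phi_nonconst : forall l, (l < n)%N -> (phi l)^`() != 0.
Hypothesis col_nonconst : forall k v, (k < n)%N -> f.[(a k)%:P] != v%:P.

Lemma phiE l x : (phi l).[x] = f.[x, b l].
Proof. by rewrite /phi horner2_swapXY. Qed.

Lemma size_phi l : (size (phi l) <= d.+1)%N.
Proof.
apply: leq_trans (max_size_evalC _ _) _.
by have := fd; rewrite -bideg_le_swap => /andP[].
Qed.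

Lemma mate_lt k o : (k < n)%N -> (o < s)%N -> (mate k o < n)%N.
Proof.
move=> kn os; rewrite /mate /n; have : (k %/ s < s)%N by rewrite ltn_divLR.
nia.
Qed.

Lemma a_lt i j : (i < j)%N -> a i < a j. Proof. exact: incr_lt_iff. Qed.
Lemma b_lt i j : (i < j)%N -> b i < b j. Proof. exact: incr_lt_iff. Qed.
Lemma a_inj : injective a.
Proof. by move=> i j E; case: (ltngtP i j) => // /a_lt; rewrite E ltxx. Qed.
Lemma b_inj : injective b.
Proof. by move=> i j E; case: (ltngtP i j) => // /b_lt; rewrite E ltxx. Qed.

Variable cut : nat -> nat -> R.
Hypothesis cut_mono : forall l i, (l < n)%N -> smono_on (phi l) (cut l i) (cut l i.+1).
Hypothesis cut_incr : forall l i, (l < n)%N -> cut l i <= cut l i.+1.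

(** A curve consists of two rows [l], [l'] of one block, the second coded by its offset, and of one
    monotone piece of each. It lies in the plane of pairs (x, x') of first coordinates of [f], so
    the ordinate [y] in [onc] is an x'. *)
Let G : finType := ('I_n * 'I_s * ('I_d.+1 * 'I_d.+1))%type.
Definition gl (g : G) : nat := g.1.1.
Definition gl' (g : G) : nat := mate g.1.1 g.1.2.

Lemma gl_lt g : (gl g < n)%N. Proof. exact: ltn_ord. Qed.
Lemma gl'_lt g : (gl' g < n)%N. Proof. by rewrite mate_lt. Qed.

Definition onc k (g : G) y : Prop :=
  [/\ cut (gl g) g.2.1 < a k <= cut (gl g) g.2.1.+1,
      cut (gl' g) g.2.2 < y <= cut (gl' g) g.2.2.+1 &
      (phi (gl g)).[a k] = (phi (gl' g)).[y]].

Lemma onc_uniq k g y y' : onc k g y -> onc k g y' -> y = y'.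
Proof.
move=> [_ /andP[y1 y2] e1] [_ /andP[y3 y4] e2].
by apply: (smono_on_inj (cut_mono g.2.2 (gl'_lt g))); rewrite ?y2 ?y4 ?andbT ?ltW // -e1.
Qed.

Variable h : nat -> G -> R.
Hypothesis hP : forall k g, (exists y, onc k g y) -> onc k g (h k g).
Definition alive k g : bool := `[< exists y, onc k g y >].

Lemma aliveP k g : alive k g -> onc k g (h k g).
Proof. by move/asboolP/hP. Qed.

Lemma alive_onc k g y : onc k g y -> alive k g /\ h k g = y.
Proof. by move=> H; have A : alive k g by [apply/asboolP; exists y]; split=> //; apply: onc_uniq H; apply: aliveP. Qed.

(** The first row is monotone on its piece, so its value at [a m] lies between those at [a k] and
    [a k'], and the second row attains it in between. *)
Lemma alive_convex k m k' g : (k < m)%N -> (m < k')%N -> alive k g -> alive k' g -> alive m g.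
Proof.
move=> km mk' /aliveP[/andP[x1 x2] y1 e1] /aliveP[/andP[x3 x4] y2 e2].
have am1 := a_lt km; have am2 := a_lt mk'.
have mi : cut (gl g) g.2.1 < a m <= cut (gl g) g.2.1.+1.
  by rewrite (lt_trans x1) //= (le_trans (ltW am2)).
have [|z zi qz] := @between_value _ (phi (gl' g)) _ _ _ _ (phi (gl g)).[a m] y1 y2; last first.
  by apply/asboolP; exists z; split.
rewrite -e1 -e2; have [inc|dec] := cut_mono g.2.1 (gl_lt g).
  have := inc _ _ (ltW x1) am1 (le_trans (ltW am2) x4).
  have := inc _ _ (le_trans (ltW x1) (ltW am1)) am2 x4; nra.
have := dec _ _ (ltW x1) am1 (le_trans (ltW am2) x4).
have := dec _ _ (le_trans (ltW x1) (ltW am1)) am2 x4; rewrite !hornerN; nra.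
Qed.

Lemma one_birth g :
  (#|[set k : 'I_n | alive k g && ((k == 0 :> nat) || ~~ alive k.-1 g)]| <= 1)%N.
Proof.
rewrite leqNgt; apply/negP => /card_gt1P[k [k' [kS k'S]]].
wlog kk' : k k' kS k'S / (k < k')%N.
  move=> H ne; have [lt|lt|E] := ltngtP k k'; first exact: (H k k').
    by apply: (H k' k) => //; rewrite eq_sym.
  by move/eqP: ne; apply; apply/val_inj.
move=> _; move: kS k'S; rewrite !inE => /andP[ak _] /andP[ak'].
case: (nat_of_ord k') kk' ak' => // m; rewrite ltnS leq_eqVlt /= => /orP[/eqP <-|km] am.
  by rewrite ak.
by rewrite (alive_convex km (ltnSn m) ak am).
Qed.

(** Given [y] and the second row, the equation restricts the first row to [d] choices, because the
    column of [a k] is nonconstant; the last factor counts the pieces. *)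
Lemma few_at_point k y : (k < n)%N ->
  (#|[set g | alive k g && (h k g == y)]| <= n * d * (d.+1 * d.+1))%N.
Proof.
move=> kn; pose Q (l l' : 'I_n) := f.[a k, b l] == f.[y, b l'].
pose tw (g : G) : 'I_n * 'I_n * ('I_d.+1 * 'I_d.+1) := (Ordinal (gl'_lt g), g.1.1, g.2).
have tw_inj : injective tw.
  move=> [[l o] ij] [[l1 o1] ij1] [] /= E E1 E2; subst; congr (_, _, _); apply/val_inj.
  by move: E; rewrite /gl' /mate /= => /addnI.
pose X := [set t : 'I_n * 'I_n | Q t.2 t.1].
apply: (@leq_trans #|setX X [set: 'I_d.+1 * 'I_d.+1]|).
  rewrite -(card_imset _ tw_inj); apply/subset_leq_card/subsetP => _ /imsetP[g + ->].
  rewrite !inE => /andP[/aliveP[_ _ e] /eqP hy]; rewrite andbT /Q /=.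
  by move: e; rewrite hy !phiE => ->.
rewrite cardsX cardsT card_prod !card_ord leq_mul2r; apply/orP; right.
rewrite (card_setX_sum (fun l' l => Q l l')) -[X in (_ <= X * _)%N]card_ord -sum_nat_const.
apply: leq_sum => l' _; set v := f.[y, b l'].
have p0 : f.[(a k)%:P] - v%:P != 0 by rewrite subr_eq0 col_nonconst.
rewrite -ltnS; apply: (@leq_trans (size (f.[(a k)%:P] - v%:P))).
  apply: (@card_le_roots _ _ _ (fun l : 'I_n => b l) _ p0).
    by move=> l l1 _ _ /b_inj/val_inj.
  by move=> l; rewrite inE /Q /root !hornerE => /eqP ->; rewrite subrr.
apply: leq_trans (size_polyD _ _) _; rewrite size_polyN geq_max.
rewrite (leq_trans (max_size_evalC _ _)) ?(leq_trans (size_polyC_leq1 _)) //.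
by case/andP: fd.
Qed.

Variable N : nat.
Hypothesis fibreP : forall F H : {poly {poly R}}, bideg_le d.+1 F -> bideg_le d.+1 H -> F != 0 ->
  exists2 w : {poly R}, w != 0 &
  forall e, w.[e] != 0 -> exists p : {poly R},
    [/\ p != 0, (size p <= N)%N &
    forall x y, F.[x, y] = 0 -> H.[x, y] = e -> root p x].

Definition Fcurve (g : G) : {poly {poly R}} := map_poly polyC (phi (gl g)) - (phi (gl' g))%:P.

Lemma Fcurve_bideg e g : (d <= e)%N -> bideg_le e (Fcurve g).
Proof.
move=> de; apply: bideg_leW de _.
by apply: bideg_leB; [apply: bideg_le_Xpart|apply: bideg_le_Ypart]; apply: size_phi.
Qed.

Lemma FcurveE g x y : (Fcurve g).[x, y] = (phi (gl g)).[x] - (phi (gl' g)).[y].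
Proof. by rewrite /Fcurve !hornerD !hornerN hornerXpart hornerC. Qed.

Lemma Fcurve_neq0 g : Fcurve g != 0.
Proof.
apply/eqP=> F0; have := phi_nonconst (gl_lt g).
have -> : phi (gl g) = ((phi (gl' g)).[0])%:P.
  apply: poly_fun_eq => x; rewrite hornerC; apply/eqP; rewrite -subr_eq0 -FcurveE F0.
  by rewrite !horner0.
by rewrite derivC eqxx.
Qed.

(** Where the test changes between neighbouring abscissae, [H] attains on the arc between them each
    positive value below all positive sampled ones. A generic such value [om] is attained at
    boundedly many abscissae, even if [H] vanishes on a part of the curve. *)
Lemma test_changes (H : {poly {poly R}}) g : bideg_le d.+1 H ->
  (#|[set k : 'I_n | [&& (k.+1 < n)%N, alive k g, alive k.+1 g &
      (0 < H.[a k, h k g])%R != (0 < H.[a k.+1, h k.+1 g])%R]]| <= N)%N.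
Proof.
move=> Hd; set S := [set k | _].
have [w w0 wP] := fibreP (Fcurve_bideg g (leqnSn d)) Hd (Fcurve_neq0 g).
pose ep := \big[Num.min/1]_(k < n.+1) (if 0 < H.[a k, h k g] then H.[a k, h k g] else 1).
have ep0 : 0 < ep.
  by apply: (big_ind (fun z => 0 < z)) => [//|u v u0 v0|k _]; [rewrite lt_min u0 v0|case: ifP].
have epk (k : 'I_n.+1) : 0 < H.[a k, h k g] -> ep <= H.[a k, h k g].
  by move=> pos; rewrite /ep (bigD1 k) //= pos ge_min lexx.
have [om /andP[om0 omep] wom] := nonroot_small w0 ep0.
have [p [p0 pN pr]] := wP _ wom.
have cross (k : 'I_n) : k \in S -> exists2 x, a k < x < a k.+1 & root p x.
  rewrite inE => /and4P[kn /aliveP[/andP[x1 x2] /andP[y1 y2] e1] /aliveP[/andP[x3 x4] /andP[y3 y4] e2] ch].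
  have [||||x [y [xi _ Ex Hx]]] := @curve_ivt _ (phi (gl g)) (phi (gl' g)) H (a k) (a k.+1) (h k g) (h k.+1 g) (cut (gl' g) g.2.2) (cut (gl' g) g.2.2.+1) om (a_incr k) _ (cut_mono g.2.2 (gl'_lt g)) _ _ e1 e2.
  - by apply: smono_onW (cut_mono g.2.1 (gl_lt g)); [apply: ltW|].
  - by rewrite y2 ltW.
  - by rewrite y4 ltW.
  - have kn1 : (k < n.+1)%N by apply: ltnW; rewrite ltnS.
    have kn2 : (k.+1 < n.+1)%N by rewrite ltnS ltn_ord.
    have := epk (Ordinal kn1); have := epk (Ordinal kn2) => /=.
    set u := H.[_, h k.+1 g] in ch *; set v := H.[_, h k g] in ch *.
    case: (ltP 0 v) ch => v0; case: (ltP 0 u) => u0 //= _ A B.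
      by have := B isT; nra.
    by have := A isT; nra.
  by exists x => //; apply: pr Hx; rewrite FcurveE Ex subrr.
have /choice[X XP] : forall k : 'I_n, exists x, k \in S -> a k < x < a k.+1 /\ root p x.
  move=> k; have [kS|_] := boolP (k \in S); last by exists 0.
  by have [x ? ?] := cross k kS; exists x.
apply: leq_trans pN; apply: ltnW; apply: (@card_le_roots _ _ _ X p p0) => [k k' kS k'S E|k /XP[]//].
have [k1 _] := XP k kS; have [k2 _] := XP k' k'S; apply/val_inj.
by apply: (open_block_inj a_incr k1); rewrite E.
Qed.

Lemma card_changes7 (g : G) (T1 T2 T3 T4 T5 T6 T7 T : nat -> bool) (B : bool -> bool -> bool -> bool -> bool -> bool -> bool -> bool) :
  (forall k, alive k g -> T k = B (T1 k) (T2 k) (T3 k) (T4 k) (T5 k) (T6 k) (T7 k)) ->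
  let ch (Q : nat -> bool) := [set k : 'I_n | [&& (k.+1 < n)%N, alive k g, alive k.+1 g & Q k != Q k.+1]] in
  (#|ch T1| <= N -> #|ch T2| <= N -> #|ch T3| <= N -> #|ch T4| <= N -> #|ch T5| <= N -> #|ch T6| <= N ->
   #|ch T7| <= N -> #|ch T| <= 7 * N)%N.
Proof.
move=> TE ch c1 c2 c3 c4 c5 c6 c7.
have : ch T \subset ch T1 :|: (ch T2 :|: (ch T3 :|: (ch T4 :|: (ch T5 :|: (ch T6 :|: ch T7))))).
  apply/subsetP=> k; rewrite !inE => /and4P[-> ak ak1]; rewrite ak ak1 /= !TE //.
  apply: contraNT; rewrite !negb_or !negbK.
  by case/andP=> /eqP-> /andP[/eqP-> /andP[/eqP-> /andP[/eqP-> /andP[/eqP-> /andP[/eqP-> /eqP->]]]]].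
move=> sub; apply: leq_trans (subset_leq_card sub) _.
have U (X Y : {set 'I_n}) x y : (#|X| <= x -> #|Y| <= y -> #|X :|: Y| <= x + y)%N.
  by move=> Xx Yy; apply: leq_trans (leq_card_setU _ _) _; apply: leq_add.
rewrite (_ : 7 * N = N + (N + (N + (N + (N + (N + N))))))%N; last by lia.
by do ![apply: (U _ _ _ _) => //].
Qed.

(** The position of [g'] relative to [g] is decided by seven polynomial tests along [g]: two locate
    [a k] in the first piece of [g'], and five come from [branch_below]. *)
Lemma few_changes g g' :
  (#|[set k : 'I_n | [&& (k.+1 < n)%N, alive k g, alive k.+1 g &
      below alive h k (h k g) g' != below alive h k.+1 (h k.+1 g) g']]| <= 7 * N)%N.
Proof.
pose c1 := cut (gl g') g'.2.1; pose c2 := cut (gl g') g'.2.1.+1.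
pose c := cut (gl' g') g'.2.2; pose e := cut (gl' g') g'.2.2.+1.
pose p := phi (gl g'); pose q := phi (gl' g').
have ce : c <= e by rewrite cut_incr ?gl'_lt.
have belowE k : alive k g -> below alive h k (h k g) g' <->
    exists y, [/\ c1 < a k <= c2, c < y <= e, p.[a k] = q.[y] & y < h k g].
  move=> ak; rewrite /below; split.
    by case/andP=> /aliveP[? ? ?] hlt; exists (h k g').
  by move=> [y [h1 h2 h3 h4]]; have [-> ->] := @alive_onc k g' y (And3 h1 h2 h3).
pose tst (H : {poly {poly R}}) k := 0 < H.[a k, h k g].
pose X (u : R) : {poly {poly R}} := 'X - u%:P%:P.
pose Y (u : R) : {poly {poly R}} := 'Y - u%:P%:P.
have Xb u : bideg_le d.+1 (X u) by apply: bideg_leB (bideg_le_X _ _) (bideg_leCC _ _).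
have Yb u : bideg_le d.+1 (Y u) by apply: bideg_leB (bideg_le_Y _ _) (bideg_leCC _ _).
have Pb u : bideg_le d.+1 (map_poly polyC p - u%:P%:P).
  by apply: bideg_leB (bideg_leCC _ _); apply/bideg_le_Xpart/leqW/size_phi.
have Eb : bideg_le d.+1 (map_poly polyC p - q%:P).
  by apply: bideg_leB; [apply/bideg_le_Xpart/leqW/size_phi|apply/bideg_le_Ypart/leqW/size_phi].
have XE u k : tst (X u) k = (u < a k) by rewrite /tst /X !hornerE subr_gt0.
have YE u k : tst (Y u) k = (u < h k g) by rewrite /tst /Y !hornerE subr_gt0.
have PE u k : tst (map_poly polyC p - u%:P%:P) k = (u < p.[a k]).
  by rewrite /tst hornerD hornerN hornerD hornerN hornerXpart !hornerC subr_gt0.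
have PNE u k : tst (- (map_poly polyC p - u%:P%:P)) k = (p.[a k] < u).
  by rewrite /tst !hornerN hornerD hornerN hornerD hornerN hornerXpart !hornerC oppr_gt0 subr_lt0.
have EE k : tst (map_poly polyC p - q%:P) k = (q.[h k g] < p.[a k]).
  by rewrite /tst hornerD hornerN hornerD hornerN hornerXpart !hornerC subr_gt0.
have ENE k : tst (- (map_poly polyC p - q%:P)) k = (p.[a k] < q.[h k g]).
  by rewrite /tst !hornerN hornerD hornerN hornerD hornerN hornerXpart !hornerC oppr_gt0 subr_lt0.
pose B t1 t2 t3 t4 t5 t6 t7 := [&& t1, ~~ t2 & [&& t3, t4 & if t5 then ~~ t6 else t7]].
have reduce k (r : {poly R}) v : alive k g -> inc_on r c e ->
    (forall y, (p.[a k] = q.[y]) <-> (v = r.[y])) ->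
    below alive h k (h k g) g' = [&& c1 < a k, ~~ (c2 < a k) &
      [&& c < h k g, r.[c] < v & if e < h k g then ~~ (r.[e] < v) else v < r.[h k g]]].
  move=> ak inc E; rewrite -leNgt; apply/idP/idP.
    move/(belowE k ak) => [y [/andP[-> ->] cye /E vy yh]] /=.
    by apply/(branch_below _ _ inc ce); exists y.
  case/and3P=> k1 k2 /(branch_below _ _ inc ce)[y [cye /E vy yh]]; apply/(belowE k ak).
  by exists y; rewrite k1 k2.
have [inc|dec] := cut_mono g'.2.2 (gl'_lt g').
  apply: (@card_changes7 g (tst (X c1)) (tst (X c2)) (tst (Y c)) (tst (map_poly polyC p - (q.[c])%:P%:P))
     (tst (Y e)) (tst (map_poly polyC p - (q.[e])%:P%:P)) (tst (- (map_poly polyC p - q%:P))) (fun k => below alive h k (h k g) g') B);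
   try (by apply: test_changes; rewrite ?bideg_leN).
  by move=> k ak; rewrite /B !XE !YE !PE ENE (reduce k q p.[a k]).
(* Now [- q] increases, and the three tests that compare values of [p] with values of [q] are
   reversed. *)
apply: (@card_changes7 g (tst (X c1)) (tst (X c2)) (tst (Y c)) (tst (- (map_poly polyC p - (q.[c])%:P%:P)))
     (tst (Y e)) (tst (- (map_poly polyC p - (q.[e])%:P%:P))) (tst (map_poly polyC p - q%:P)) (fun k => below alive h k (h k g) g') B);
   try (by apply: test_changes; rewrite ?bideg_leN).
move=> k ak; rewrite /B !XE !YE !PNE EE (reduce k (- q) (- p.[a k])) ?hornerN ?ltrN2 //.
by move=> y; rewrite hornerN; split=> [->|/oppr_inj].
Qed.

Let m := dX f * dY f.
Let n2 := dX (dY f).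
(** [n2 / m] is f_xy / (f_x f_y). On the curve of rows [l], [l'], the points at which it takes equal
    values on both rows have their abscissae among the roots of [Phi l l']. The construction of
    [Phi] is left to [quads_bound]. *)
Variables (Phi : nat -> nat -> {poly R}) (e N1 K2 : nat).
Hypothesis size_Phi : forall l l', (size (Phi l l') <= e)%N.
Hypothesis PhiP : forall l l' x x', m.[x, b l] != 0 -> m.[x', b l'] != 0 ->
  f.[x, b l] = f.[x', b l'] -> n2.[x, b l] * m.[x', b l'] = n2.[x', b l'] * m.[x, b l] ->
  root (Phi l l') x.
Hypothesis N1_gt0 : (0 < N1)%N.
Hypothesis nonsingularP : forall G1 G2 : {poly {poly R}}, bideg_le d G1 -> bideg_le d G2 ->
  exists p1 p2 : {poly R}, [/\ p1 != 0, p2 != 0, (size p1 <= N1)%N, (size p2 <= N1)%N &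
    forall x y, G1.[x, y] = 0 -> G2.[x, y] = 0 -> (jac G1 G2).[x, y] != 0 ->
      root p1 x /\ root p2 y].

Let P : finType := ('I_n * 'I_s)%type.
Definition mt (p : P) : nat := mate p.1 p.2.
Definition pos (p : P) : R := a (mt p).

Lemma mt_lt p : (mt p < n)%N. Proof. by rewrite mate_lt. Qed.

Definition inc (p : P) (g : G) : bool :=
  [&& alive p.1 g, h p.1 g == pos p, Phi (gl g) (gl' g) != 0,
      m.[a p.1, b (gl g)] != 0 & m.[pos p, b (gl' g)] != 0].

(** Nonvanishing of the Jacobian, in the row variables (y, y'), of the two conditions that the curve
    passes through [p] and through [q]. *)
Definition transversal (p q : P) (g : G) : bool :=
  (dY f).[a p.1, b (gl g)] * (dY f).[pos q, b (gl' g)] !=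
  (dY f).[pos p, b (gl' g)] * (dY f).[a q.1, b (gl g)].

Lemma inc_f p g : inc p g -> f.[a p.1, b (gl g)] = f.[pos p, b (gl' g)].
Proof. by case/and5P=> /aliveP[_ _ E] /eqP hp _ _ _; rewrite -hp -!phiE. Qed.

Lemma inc_inj g p q : inc p g -> inc q g -> a p.1 = a q.1 -> p = q.
Proof.
case: p q => [k o] [k' o'] /and5P[_ /eqP h1 _ _ _] /and5P[_ /eqP h2 _ _ _] /= /a_inj/val_inj kk.
subst k'; move: h2; rewrite h1 /pos => /a_inj; rewrite /mt /mate /= => /addnI/val_inj.
by move=> ->.
Qed.

Definition psi l : {poly R} := (swapXY (dY f)).[(b l)%:P].

Lemma psiE l x : (psi l).[x] = (dY f).[x, b l].
Proof. by rewrite /psi horner2_swapXY. Qed.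

Lemma size_psi l : (size (psi l) <= d.+1)%N.
Proof.
apply: leq_trans (max_size_evalC _ _) _.
by have := bideg_le_dY fd; rewrite -bideg_le_swap => /andP[].
Qed.

Lemma deriv_slice (g : {poly {poly R}}) y x : ((swapXY g).[y%:P])^`().[x] = (dX g).[x, y].
Proof. by rewrite horner_swapXY /dX deriv_map -horner_swapXY horner2_swapXY. Qed.

Lemma deriv_col (g : {poly {poly R}}) x y : (g.[x%:P])^`().[y] = (dY g).[x, y].
Proof. by rewrite -horner2_swapXY -dX_swap -(deriv_slice (swapXY g)) swapXYK. Qed.

Lemma jac_split (p1 q1 p2 q2 : {poly R}) x y :
  (jac (map_poly polyC p1 - q1%:P) (map_poly polyC p2 - q2%:P)).[x, y] =
  q1^`().[y] * p2^`().[x] - p1^`().[x] * q2^`().[y].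
Proof.
rewrite /jac !dXB !dYB !dX_Xpart !dY_Xpart !dXC !dYC !subr0 !sub0r.
by rewrite !(hornerD, hornerN, hornerM) !hornerXpart !hornerYpart; ring.
Qed.

(** For fixed [p], nontransversality is a second equation [E = 0] along the curve. Its nonsingular
    solutions are bounded by [nonsingularP]; where the Jacobian vanishes as well, the equations
    combine to the equality of [n2 / m] on both rows, and the abscissa is a root of [Phi]. *)
Lemma few_nontransversal p g : inc p g ->
  (#|[set q | inc q g && ~~ transversal p q g]| <= N1 + e)%N.
Proof.
move=> pg; have /and5P[_ _ Phi0 mp mp'] := pg.
set la := (dY f).[a p.1, b (gl g)]; set la' := (dY f).[pos p, b (gl' g)].
have la0 : la != 0 by move: mp; rewrite /m !hornerM mulf_eq0 negb_or => /andP[].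
pose E : {poly {poly R}} := map_poly polyC (la' *: psi (gl g)) - (la *: psi (gl' g))%:P.
have Ed : bideg_le d E.
  apply: bideg_leB; [apply: bideg_le_Xpart|apply: bideg_le_Ypart];
    by apply: leq_trans (size_scale_leq _ _) (size_psi _).
have [p1 [p2 [p10 _ p1N _ pr]]] := nonsingularP (Fcurve_bideg g (leqnn d)) Ed.
pose A := [set q : P | inc q g && root p1 (a q.1)].
pose B := [set q : P | inc q g && root (Phi (gl g) (gl' g)) (a q.1)].
have cA : (#|A| <= N1)%N.
  apply: leq_trans p1N; apply: ltnW; apply: (@card_le_roots _ _ _ (fun q : P => a q.1) _ p10).
    by move=> q q'; rewrite !inE => /andP[qg _] /andP[q'g _]; apply: inc_inj qg q'g.
  by move=> q; rewrite inE => /andP[].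
have cB : (#|B| <= e)%N.
  apply: leq_trans (size_Phi (gl g) (gl' g)); apply: ltnW.
  apply: (@card_le_roots _ _ _ (fun q : P => a q.1) _ Phi0).
    by move=> q q'; rewrite !inE => /andP[qg _] /andP[q'g _]; apply: inc_inj qg q'g.
  by move=> q; rewrite inE => /andP[].
apply: leq_trans (leq_add cA cB); apply: leq_trans (leq_card_setU _ _).
apply/subset_leq_card/subsetP => q; rewrite !inE => /andP[qg]; rewrite qg /= negbK => /eqP tq.
have qf := inc_f qg; have /and5P[_ _ _ mq mq'] := qg.
have [J0|Jn] := eqVneq (jac (Fcurve g) E).[a q.1, pos q] 0; last first.
  have [||-> //] := pr (a q.1) (pos q) _ _ Jn; first by rewrite FcurveE !phiE qf subrr.
  by rewrite /E hornerD hornerN hornerD hornerN hornerXpart hornerYpart !hornerZ !psiE -/la -/la' tq subrr.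
apply/orP; right; apply: PhiP mq mq' qf _.
move: J0; rewrite jac_split !derivZ !hornerZ !deriv_slice -/n2 => /eqP; rewrite subr_eq0 => /eqP J0.
apply: (mulfI la0); rewrite /m !hornerM.
rewrite -/la -/la' in tq.
transitivity ((dX f).[pos q, b (gl' g)] * n2.[a q.1, b (gl g)] * (la * (dY f).[pos q, b (gl' g)])); first by ring.
rewrite tq; transitivity ((dX f).[pos q, b (gl' g)] * (la' * n2.[a q.1, b (gl g)]) * (dY f).[a q.1, b (gl g)]); first by ring.
by rewrite J0; ring.
Qed.

Definition tw (g : G) : 'I_n * 'I_n * ('I_d.+1 * 'I_d.+1) := (Ordinal (gl'_lt g), g.1.1, g.2).

Lemma tw_inj : injective tw.
Proof.
move=> [[l o] ij] [[l1 o1] ij1] [] /= E E1 E2; subst; congr (_, _, _); apply/val_inj.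
by move: E; rewrite /gl' /mate /= => /addnI.
Qed.

(** Transversality makes [(b (gl g), b (gl' g))] a nonsingular common zero of two polynomials in the
    row variables. *)
Lemma few_common p q :
  (#|[set g | [&& inc p g, inc q g & transversal p q g]]| <= N1 * N1 * (d.+1 * d.+1))%N.
Proof.
have colb x : (size f.[x%:P] <= d.+1)%N.
  by apply: leq_trans (max_size_evalC _ _) _; case/andP: fd.
pose G1 x x' : {poly {poly R}} := map_poly polyC f.[x%:P] - (f.[x'%:P])%:P.
have Gd x x' : bideg_le d (G1 x x').
  by apply: bideg_leB; [apply: bideg_le_Xpart|apply: bideg_le_Ypart]; apply: colb.
have [p1 [p2 [p10 p20 p1N p2N pr]]] := nonsingularP (Gd (a p.1) (pos p)) (Gd (a q.1) (pos q)).
pose A (r : {poly R}) := [set l : 'I_n | root r (b l)].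
have cA (r : {poly R}) : r != 0 -> (size r <= N1)%N -> (#|A r| <= N1)%N.
  move=> r0 rN; apply: leq_trans rN; apply: ltnW; apply: (@card_le_roots _ _ _ (fun l : 'I_n => b l) _ r0).
    by move=> l l' _ _ /b_inj/val_inj.
  by move=> l; rewrite inE.
rewrite -(card_imset _ tw_inj).
apply: (@leq_trans #|setX (setX (A p2) (A p1)) [set: 'I_d.+1 * 'I_d.+1]|); last first.
  by rewrite !cardsX cardsT card_prod !card_ord leq_mul2r leq_mul ?cA ?orbT.
apply/subset_leq_card/subsetP => _ /imsetP[g + ->]; rewrite !inE andbT /= => /and3P[pg qg tpq].
have zero r : inc r g -> (G1 (a r.1) (pos r)).[b (gl g), b (gl' g)] = 0.
  by move=> /inc_f E; rewrite /G1 hornerD hornerN hornerD hornerN hornerXpart hornerYpart E subrr.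
have [] := pr (b (gl g)) (b (gl' g)) (zero p pg) (zero q qg).
  by rewrite jac_split !deriv_col subr_eq0 eq_sym.
by rewrite /gl => -> ->.
Qed.

Lemma incidences_le :
  (n * \sum_p #|[set g | inc p g]| <=
    n * ((N1 + e) * (2 * (n + n * d * (d.+1 * d.+1)) * (#|G| %/ n + 2) + 2 * #|G|) +
      (N1 * N1 * (d.+1 * d.+1) * (N1 + e) + N1 * N1 * (d.+1 * d.+1) + 2 * (1 + d * (d.+1 * d.+1))) * (s * #|P|)) +
    2 * (N1 + e) * (#|G| * (#|G| * (7 * N))))%N.
Proof.
(* Levels of width [n] match the multiplicity bound, and with [sig = s] a cell has O([s ^ 2])
   curves: the balanced choice for about [s ^ 3] points and [s ^ 3] curves. *)
apply: (@incidence_bound R n G alive h n (n * d * (d.+1 * d.+1)) (7 * N) _ few_at_point few_changes one_birth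
  P (fun p => p.1) pos inc transversal) => //.
- by rewrite /n muln_gt0 s0.
- by move=> p g /and5P[-> /eqP ->].
- exact: few_nontransversal.
- exact: few_common.
- by rewrite addn_gt0 N1_gt0.
- by rewrite /n expnS expn1; apply: eq_leq; ring.
Qed.

Hypothesis in_piece : forall l k, (l < n)%N -> (k < n)%N ->
  exists i : 'I_d.+1, cut l i < a k <= cut l i.+1.
Hypothesis row_neq0 : forall l, (l < n)%N -> (swapXY m).[(b l)%:P] != 0.
Hypothesis size_row : forall l, (size (swapXY m).[(b l)%:P] <= e)%N.
Hypothesis few_bad : forall l, (l < n)%N -> (#|[set l' : 'I_n | Phi l l' == 0%R]| <= K2)%N.

Definition quad (t : P * P) : bool := f.[a t.1.1, b t.2.1] == f.[pos t.1, b (mt t.2)].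

Let zeros := [set lk : 'I_n * 'I_n | m.[a lk.2, b lk.1] == 0].

Lemma card_zeros : (#|zeros| <= n * e)%N.
Proof.
rewrite (card_setX_sum (fun l k : 'I_n => m.[a k, b l] == 0)) -[X in (_ <= X * _)%N]card_ord -sum_nat_const.
apply: leq_sum => l _; apply: leq_trans (size_row l); apply: ltnW.
apply: (@card_le_roots _ _ _ (fun k : 'I_n => a k) _ (row_neq0 (ltn_ord l))).
  by move=> k k' _ _ /a_inj/val_inj.
by move=> k; rewrite inE /root horner2_swapXY.
Qed.

(** Degenerate quadruples are counted trivially: a zero of [m] for the first pair, and free offsets
    for the second. *)
Lemma card_quads1 : (#|[set t | quad t & m.[a t.1.1, b t.2.1] == 0%R]| <= n * e * (s * s))%N.
Proof.
pose r (t : P * P) := ((t.2.1, t.1.1), (t.1.2, t.2.2)).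
have rinj : injective r by move=> [[? ?] [? ?]] [[? ?] [? ?]] [-> -> -> ->].
rewrite -(card_imset _ rinj); apply: (@leq_trans #|setX zeros [set: 'I_s * 'I_s]|).
  by apply/subset_leq_card/subsetP => _ /imsetP[t + ->]; rewrite !inE /= andbT => /andP[].
by rewrite cardsX cardsT card_prod !card_ord leq_mul2r card_zeros orbT.
Qed.

Definition mtI (p : P) : 'I_n := Ordinal (mt_lt p).
Definition offI (p : P) : 'I_s := Ordinal (ltn_pmod p.1 s0).

Lemma mtI_inj p p' : mtI p = mtI p' -> offI p = offI p' -> p = p'.
Proof.
case: p p' => [k o] [k' o'] /(congr1 val) /= + /(congr1 val) /=; rewrite /mt /mate /= => E1 E2.
have E : (k %/ s = k' %/ s)%N.
  have := congr1 (fun z => z %/ s)%N E1.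
  by rewrite !divnMDl // (divn_small (ltn_ord o)) (divn_small (ltn_ord o')) !addn0.
move: E1; rewrite E => /addnI/val_inj ->; congr (_, _); apply/val_inj => /=.
by rewrite (divn_eq k s) (divn_eq k' s) E E2.
Qed.

Lemma card_quads2 : (#|[set t | quad t & m.[pos t.1, b (mt t.2)] == 0%R]| <= n * e * (s * s))%N.
Proof.
pose r (t : P * P) := ((mtI t.2, mtI t.1), (offI t.1, offI t.2)).
have rinj : injective r.
  by move=> [p1 p2] [q1 q2] [] /= E1 E2 E3 E4; congr (_, _); apply: mtI_inj; apply/val_inj.
rewrite -(card_imset _ rinj); apply: (@leq_trans #|setX zeros [set: 'I_s * 'I_s]|).
  by apply/subset_leq_card/subsetP => _ /imsetP[t + ->]; rewrite !inE /= andbT => /andP[].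
by rewrite cardsX cardsT card_prod !card_ord leq_mul2r card_zeros orbT.
Qed.

(** For a bad pair of rows and a given x, the equation f(x, y) = f(x', y') leaves at most [d] values
    of x'. *)
Lemma card_quads3 : (#|[set t | quad t & Phi t.2.1 (mt t.2) == 0%R]| <= n * K2 * (n * d))%N.
Proof.
pose r (t : P * P) := ((t.2.1, mtI t.2), (t.1.1, mtI t.1)).
have rinj : injective r.
  move=> [[k o] [l o']] [[k1 o1] [l1 o1']] [] /= -> E1 -> E2; congr (_, _, (_, _)); apply/val_inj.
    by move: E2; rewrite /mt /mate /= => /addnI.
  by move: E1; rewrite /mt /mate /= => /addnI.
rewrite -(card_imset _ rinj).
pose Q (u v : 'I_n * 'I_n) := (Phi u.1 u.2 == 0) && (f.[a v.1, b u.1] == f.[a v.2, b u.2]).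
apply: (@leq_trans #|[set t | Q t.1 t.2]|).
  apply/subset_leq_card/subsetP => _ /imsetP[t + ->]; rewrite !inE /Q /=.
  by case/andP=> qt ->.
rewrite card_setX_sum.
apply: (@leq_trans (\sum_(u in [set u : 'I_n * 'I_n | Phi u.1 u.2 == 0%R]) n * d)%N).
  rewrite [X in (_ <= X)%N]big_mkcond; apply: leq_sum => u _; rewrite inE /Q.
  case: ifP => [_|ne]; last by rewrite leqn0 cards_eq0; apply/eqP/setP=> v; rewrite !inE.
  rewrite /= (card_setX_sum (fun k k' : 'I_n => f.[a k, b u.1] == f.[a k', b u.2])).
  rewrite -[X in (_ <= X * _)%N]card_ord -sum_nat_const; apply: leq_sum => k _.
  set v := f.[a k, b u.1].
  have p0 : phi u.2 - v%:P != 0.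
    apply/eqP=> E; have := phi_nonconst (ltn_ord u.2).
    by rewrite (subr0_eq E) derivC eqxx.
  rewrite -ltnS; apply: (@leq_trans (size (phi u.2 - v%:P))).
    apply: (@card_le_roots _ _ _ (fun k' : 'I_n => a k') _ p0).
      by move=> k1 k2 _ _ /a_inj/val_inj.
    by move=> k'; rewrite inE /root hornerD hornerN hornerC phiE => /eqP ->; rewrite subrr.
  apply: leq_trans (size_polyD _ _) _; rewrite size_polyN geq_max size_phi.
  exact: leq_trans (size_polyC_leq1 _) _.
rewrite sum_nat_const leq_mul2r; apply/orP; right.
rewrite (card_setX_sum (fun l l' : 'I_n => Phi l l' == 0)) -[X in (_ <= X * _)%N]card_ord -sum_nat_const.
by apply: leq_sum => l _; apply: few_bad.
Qed.

(** A quadruple outside the three degenerate families becomes an incidence once the pieces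
    containing the two abscissae are chosen. *)
Lemma card_quads : (#|[set t | quad t]| <=
  n * e * (s * s) + n * e * (s * s) + n * K2 * (n * d) + \sum_p #|[set g | inc p g]|)%N.
Proof.
pose Q4 := [set t : P * P | [&& quad t, m.[a t.1.1, b t.2.1] != 0, m.[pos t.1, b (mt t.2)] != 0 & Phi t.2.1 (mt t.2) != 0]].
have c4 : (#|Q4| <= \sum_p #|[set g | inc p g]|)%N.
  rewrite -card_setX_sum; pose r (t : P * G) : P * P := (t.1, t.2.1).
  apply: leq_trans (leq_imset_card r _); apply/subset_leq_card/subsetP => -[p [l o]].
  rewrite inE /= => /and4P[/eqP pl m1 m2 Ph].
  have [i ii] := in_piece (ltn_ord l) (ltn_ord p.1).
  have lo : (mate l o < n)%N by rewrite mate_lt.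
  have [j jj] := in_piece lo (mt_lt p).
  pose g : G := ((l, o), (i, j)).
  have : onc p.1 g (pos p) by split=> //; rewrite !phiE.
  case/alive_onc => ag hg; apply/imsetP; exists (p, g) => //.
  by rewrite inE /inc ag hg eqxx Ph m1 m2.
pose Q1 := [set t | quad t & m.[a t.1.1, b t.2.1] == 0].
pose Q2 := [set t | quad t & m.[pos t.1, b (mt t.2)] == 0].
pose Q3 := [set t | quad t & Phi t.2.1 (mt t.2) == 0].
have sub : [set t | quad t] \subset Q1 :|: Q2 :|: Q3 :|: Q4.
  apply/subsetP => t; rewrite !inE => qt; rewrite qt /=.
  by case: (_ == _); case: (_ == _); case: (_ == _).
have B1 := (leq_card_setU (Q1 :|: Q2 :|: Q3) Q4).1.
have B2 := (leq_card_setU (Q1 :|: Q2) Q3).1.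
have B3 := (leq_card_setU Q1 Q2).1.
have := subset_leq_card sub; have := card_quads1; have := card_quads2; have := card_quads3.
rewrite -/Q1 -/Q2 -/Q3; lia.
Qed.

(** The value of [C] is part of the statement, so that [quads_bound] can fix it before [f] and the
    sequences are given. *)
Lemma quads_le : exists2 C : nat, (C = 2 * e + K2 * d +
    ((N1 + e) * (2 * (1 + d * (d.+1 * d.+1)) * (d.+1 * d.+1 + 2) + 2 * (d.+1 * d.+1)) +
    (N1 * N1 * (d.+1 * d.+1) * (N1 + e) + N1 * N1 * (d.+1 * d.+1) + 2 * (1 + d * (d.+1 * d.+1))) +
    2 * (N1 + e) * (d.+1 * d.+1 * (d.+1 * d.+1) * (7 * N))))%N & (#|[set t | quad t]| <= C * s ^ 4)%N.
Proof.
eexists; first by reflexivity.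
apply: leq_trans card_quads _.
have n0 : (0 < n)%N by rewrite muln_gt0 s0.
have cG : #|G| = (n * (s * (d.+1 * d.+1)))%N by rewrite !card_prod !card_ord -!mulnA.
have cP : #|P| = (n * s)%N by rewrite card_prod !card_ord.
have I := incidences_le; rewrite cG cP mulKn // in I.
set dd := (d.+1 * d.+1)%N in I *.
set K := (N1 + e)%N in I *; set L := (N1 * N1 * dd * K + N1 * N1 * dd + 2 * (1 + d * dd))%N in I *.
set X := \sum_p _ in I *.
have {}I : (X <= K * (2 * (n + n * d * dd) * (s * dd + 2) + 2 * (n * (s * dd))) + L * (s * (n * s)) + 2 * K * (s * dd * (n * (s * dd)) * (7 * N)))%N.
  rewrite -(leq_pmul2l n0); apply: leq_trans I _; apply: eq_leq; ring.
have s1 : (s <= s ^ 4)%N by rewrite -{1}[s]expn1 leq_pexp2l.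
have s3 : (s ^ 3 <= s ^ 4)%N by rewrite leq_pexp2l.
have s2 : (s ^ 2 <= s ^ 4)%N by rewrite leq_pexp2l.
apply: leq_trans (leq_add (leqnn _) I) _.
rewrite /n.
have -> : (s * s * e * (s * s) + s * s * e * (s * s) + s * s * K2 * (s * s * d) +
 (K * (2 * (s * s + s * s * d * dd) * (s * dd + 2) + 2 * (s * s * (s * dd))) + L * (s * (s * s * s)) + 2 * K * (s * dd * (s * s * (s * dd)) * (7 * N))) =
 (2 * e + K2 * d) * s ^ 4 + K * (2 * (1 + d * dd) * (dd * s ^ 3 + 2 * s ^ 2) + 2 * dd * s ^ 3) + L * s ^ 4 + 2 * K * (dd * dd * (7 * N)) * s ^ 4)%N by ring.
have : (K * (2 * (1 + d * dd) * (dd * s ^ 3 + 2 * s ^ 2) + 2 * dd * s ^ 3) <=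
  K * (2 * (1 + d * dd) * (dd * s ^ 4 + 2 * s ^ 4) + 2 * dd * s ^ 4))%N.
  rewrite leq_mul2l; apply/orP; right; apply: leq_add; last by rewrite leq_mul2l s3 orbT.
  by rewrite leq_mul2l; apply/orP; right; apply: leq_add; rewrite leq_mul2l ?s3 ?s2 orbT.
move: (s ^ 4)%N (s ^ 3)%N (s ^ 2)%N => x4 x3 x2 H.
rewrite [X in (_ <= X)%N](_ : _ = (2 * e + K2 * d) * x4 + K * (2 * (1 + d * dd) * (dd * x4 + 2 * x4) + 2 * dd * x4) + L * x4 + 2 * K * (dd * dd * (7 * N)) * x4)%N; last by ring.
by rewrite !leq_add2r leq_add2l.
Qed.
End Curves.

(** * Algebraic dependence on [f] and vanishing Jacobians *)

Section Dependence.
Variable R : numFieldType.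
Implicit Types f g h m n : {poly {poly R}}.

Lemma generic_slice d g : g != 0 -> bideg_le d g ->
  exists p : {poly R}, [/\ p != 0, (size p <= d.+1)%N & forall x, p.[x] != 0 -> g.[x%:P] != 0].
Proof.
move=> g0 /andP[gX gY]; exists (lead_coef (swapXY g)); split.
- by rewrite lead_coef_eq0 swapXY_eq0.
- by apply: leq_trans (max_size_lead_coefXY _) _; rewrite sizeYE swapXYK.
- move=> x; apply: contraNneq => /(congr1 (fun q : {poly R} => q`_(size (swapXY g)).-1)).
  by rewrite coef0 horner_polyC coef_map => E; apply/eqP.
Qed.

Lemma jacM g h f : jac (g * h) f = jac g f * h + g * jac h f.
Proof. by rewrite /jac dXM dYM; ring. Qed.

Lemma jacD g h f : jac (g + h) f = jac g f + jac h f.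
Proof. by rewrite /jac dXD dYD; ring. Qed.

Lemma jac0 f : jac 0 f = 0.
Proof. by rewrite /jac -polyC0 dXC dYC deriv0 polyC0; ring. Qed.

Lemma jac_sum (I : Type) (r : seq I) (P : pred I) (F : I -> {poly {poly R}}) f :
  jac (\sum_(i <- r | P i) F i) f = \sum_(i <- r | P i) jac (F i) f.
Proof. by elim/big_rec2: _ => [|i u v _ <-]; [exact: jac0|exact: jacD]. Qed.

Lemma jacX g k f : jac (g ^+ k) f = (g ^+ k.-1 * jac g f) *+ k.
Proof.
elim: k => [|k IH]; first by rewrite expr0 /jac -polyC1 dXC dYC derivC polyC0 mulr0n; ring.
rewrite exprS jacM IH /=; case: k {IH} => [|k]; first by rewrite expr0 mulr0n mulr1n; ring.
by rewrite /= exprS !mulrSr; ring.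
Qed.

Lemma jacCC (c : R) f : jac c%:P%:P f = 0.
Proof. by rewrite /jac dXC dYC derivC polyC0; ring. Qed.

Lemma jac_self f : jac f f = 0. Proof. by rewrite /jac; ring. Qed.

Lemma jacMn g k f : jac (g *+ k) f = jac g f *+ k.
Proof. by elim: k => [|k IH]; rewrite ?mulr0n ?jac0 // !mulrS jacD IH. Qed.

Lemma mulrn2_eq0 g k : g *+ k.+1 = 0 -> g = 0.
Proof.
move/polyP=> H; apply/polyP=> i; apply/polyP=> j; have /polyP/(_ j)/eqP := H i.
by rewrite !coefMn !coef0 mulrn_eq0 => /eqP.
Qed.

(* Differentiate a homogeneous relation of minimal degree along the derivation [jac _ f]; Euler's identity
   eliminates one of the two partial derivatives. *)
Lemma homogeneous_dependence f n m (N : nat) (c : nat -> {poly {poly R}}) :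
  m != 0 -> (forall k, jac (c k) f = 0) -> (exists2 k, (k <= N)%N & c k != 0) ->
  \sum_(k < N.+1) c k * (n ^+ k * m ^+ (N - k)) = 0 ->
  m * jac n f = n * jac m f.
Proof.
move=> m0; elim: N c => [|N IH] c c0 [k0 k0N ck0] rel.
  move: k0N ck0; rewrite leqn0 => /eqP ->; rewrite big_ord1 in rel.
  by move: rel; rewrite !expr0 !mulr1 => ->; rewrite eqxx.
pose Pn := \sum_(k < N.+1) (c k.+1 *+ k.+1) * (n ^+ k * m ^+ (N - k)).
pose Pm := \sum_(k < N.+1) (c k *+ (N.+1 - k)) * (n ^+ k * m ^+ (N - k)).
have E1 : Pn * jac n f + Pm * jac m f = 0.
  have := congr1 (fun g => jac g f) rel; rewrite jac0 => {rel} rel; rewrite -[RHS]rel jac_sum.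
  transitivity (\sum_(k < N.+2) (c k * ((n ^+ k.-1 * jac n f) *+ k * m ^+ (N.+1 - k)) +
       c k * (n ^+ k * ((m ^+ (N.+1 - k).-1 * jac m f) *+ (N.+1 - k))))); last first.
    by apply: eq_bigr => k _; rewrite jacM c0 mul0r add0r jacM !jacX [RHS]mulrDr.
  rewrite big_split /=; congr (_ + _).
    rewrite big_ord_recl /= mulr0n !mul0r mulr0 add0r mulr_suml; apply: eq_bigr => k _ /=.
    by rewrite subSS !mulrnAl !mulrnAr; congr (_ *+ _); ring.
  rewrite big_ord_recr /= subnn mulr0n !mulr0 addr0 mulr_suml; apply: eq_bigr => k _ /=.
  have -> : (N.+1 - k).-1 = (N - k)%N by rewrite subSn //= -ltnS.
  by rewrite !mulrnAr !mulrnAl; congr (_ *+ _); ring.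
have E2 : n * Pn + m * Pm = 0.
  have -> : n * Pn = \sum_(k < N.+2) (c k * (n ^+ k * m ^+ (N.+1 - k))) *+ k.
    rewrite big_ord_recl /= mulr0n add0r mulr_sumr; apply: eq_bigr => k _ /=.
    by rewrite subSS !mulrnAl mulrnAr exprS; congr (_ *+ _); ring.
  have -> : m * Pm = \sum_(k < N.+2) (c k * (n ^+ k * m ^+ (N.+1 - k))) *+ (N.+1 - k).
    rewrite big_ord_recr /= subnn mulr0n addr0 mulr_sumr; apply: eq_bigr => k _ /=.
    have kN : (k <= N)%N by rewrite -ltnS.
    by rewrite !mulrnAl mulrnAr (subSn kN) [m ^+ (N - k).+1]exprS; congr (_ *+ _); ring.
  rewrite -big_split /= (eq_bigr (fun k : 'I_N.+2 => (c k * (n ^+ k * m ^+ (N.+1 - k))) *+ N.+1)).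
    by rewrite sumrMnl rel mul0rn.
  by move=> k _; rewrite -mulrnDr subnKC // -ltnS.
have E3 : Pn * (m * jac n f - n * jac m f) = 0.
  transitivity (m * (Pn * jac n f + Pm * jac m f) - (n * Pn + m * Pm) * jac m f); first by ring.
  by rewrite E1 E2; ring.
move/eqP: E3; rewrite mulf_eq0 subr_eq0 => /orP[/eqP Pn0|/eqP //].
apply: (IH (fun k => c k.+1 *+ k.+1)) Pn0.
  by move=> k; rewrite jacMn c0 mul0rn.
case: k0 k0N ck0 => [|k] k0N ck0; last first.
  by exists k => //; apply: contraNneq ck0 => /mulrn2_eq0 ->.
have [[k1 /andP[k1N ck]]|none] := boolp.pselect (exists k1, (k1 <= N)%N && (c k1.+1 != 0)).
  by exists k1 => //; apply: contraNneq ck => /mulrn2_eq0 ->.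
move: rel; rewrite big_ord_recl big1; last first.
  move=> k _; have [-> |ck] := eqVneq (c (lift ord0 k)) 0; first by rewrite mul0r.
  by case: none; exists k; rewrite -ltnS ltn_ord.
by rewrite /= expr0 mul1r addr0 => /eqP; rewrite mulf_eq0 (negPf ck0) expf_eq0 (negPf m0) andbF.
Qed.

(** On a line where [f] is not constant it restricts to a nonconstant univariate polynomial, which
    satisfies no nontrivial equation with constant coefficients. *)
Lemma transcendental f (p : nat -> R) (N : nat) : dX f != 0 ->
  \sum_(j < N) (p j)%:P%:P * f ^+ j = 0 -> forall j, (j < N)%N -> p j = 0.
Proof.
move=> fx0 rel j jN.
have : swapXY (dX f) != 0 by rewrite swapXY_eq0.
case/(nonroot2) => y [x fxy].
pose u := (swapXY f).[y%:P].
have u1 : (1 < size u)%N.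
  rewrite ltnNge; apply/negP=> /size1_polyC uC.
  have : (swapXY (dX f)).[y%:P] = u^`() by rewrite /u !horner_swapXY /dX deriv_map.
  by rewrite uC derivC => E; move: fxy; rewrite E horner0 eqxx.
have : (\poly_(j < N) p j) \Po u = 0.
  apply: poly_fun_eq => z; rewrite horner_comp horner0 horner_poly.
  have := congr1 (fun g : {poly {poly R}} => g.[z, y]) rel; rewrite !horner0 => rel'.
  rewrite -[RHS]rel' !horner_sum; apply: eq_bigr => i _.
  by rewrite !hornerM !hornerC !horner_exp /u horner2_swapXY.
move/eqP; rewrite comp_poly_eq0 // => /eqP/(congr1 (fun q : {poly R} => q`_j)).
by rewrite coef_poly jN coef0.
Qed.

(** The coefficients are polynomials in [f], hence killed by [jac _ f]. The conclusion is the
    vanishing of the Jacobian of [n / m] and [f], cleared of denominators. *)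
Lemma dependence f n m (N : nat) (q : nat -> nat -> R) : dX f != 0 -> m != 0 ->
  (exists j k, [&& (j < N)%N, (k < N)%N & q j k != 0]) ->
  \sum_(j < N) \sum_(k < N) (q j k)%:P%:P * (f ^+ j * (n ^+ k * m ^+ (N.-1 - k))) = 0 ->
  m * jac n f = n * jac m f.
Proof.
move=> fx0 m0 [j [k /and3P[jN kN qjk]]] rel.
case: N jN kN rel => // N jN kN rel.
pose c k := \sum_(j < N.+1) (q j k)%:P%:P * f ^+ j.
apply: (@homogeneous_dependence f n m N c) => //.
- move=> k'; rewrite /c jac_sum big1 // => j' _.
  by rewrite jacM jacCC mul0r add0r jacX jac_self mulr0 mul0rn mulr0.
- exists k => //; apply: contraNneq qjk => ck.
  by rewrite (@transcendental f (fun j => q j k) N.+1 fx0 ck j jN).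
- rewrite -[RHS]rel exchange_big /=; apply: eq_bigr => k' _; rewrite /c mulr_suml.
  by apply: eq_bigr => j' _; ring.
Qed.
End Dependence.

Lemma cauchy_schwarz_fibres (X Y : finType) (cl : X -> Y) :
  (#|X| * #|X| <= #|cl @: X| * #|[set t : X * X | cl t.1 == cl t.2]|)%N.
Proof.
pose I := cl @: X; pose m y := #|[set x | cl x == y]|.
have sm : (#|X| = \sum_(y in I) m y)%N.
  rewrite -sum1_card (partition_big cl (mem I)) /=; last by move=> x _; apply: imset_f.
  by apply: eq_bigr => y _; rewrite /m -sum1_card; apply: eq_bigl => x; rewrite inE.
have sm2 : (#|[set t : X * X | cl t.1 == cl t.2]| = \sum_(y in I) m y * m y)%N.
  rewrite (card_setX_sum (fun x x' => cl x == cl x')).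
  rewrite (partition_big cl (mem I)) /=; last by move=> x _; apply: imset_f.
  apply: eq_bigr => y _; rewrite (eq_bigr (fun _ => m y)); last first.
    by move=> x /eqP <-; apply: eq_card => x'; rewrite !inE eq_sym.
  by rewrite sum_nat_const; congr (_ * _)%N; apply: eq_card => x; rewrite inE.
rewrite sm2 sm -(leq_pmul2l (isT : 0 < 2)%N).
have -> : (2 * ((\sum_(y in I) m y) * (\sum_(y in I) m y)) = \sum_(y in I) \sum_(z in I) 2 * (m y * m z))%N.
  rewrite big_distrl big_distrr /=; apply: eq_bigr => y _.
  by rewrite big_distrr big_distrr.
apply: (@leq_trans (\sum_(y in I) \sum_(z in I) (m y * m y + m z * m z))%N).
  by apply: leq_sum => y _; apply: leq_sum => z _; rewrite !mulnn; exact: (nat_Cauchy (m y) (m z)).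
under eq_bigr do rewrite big_split sum_nat_const.
rewrite big_split /= sum_nat_const -big_distrr /= -/I; lia.
Qed.

Section Bivariate.
Variable R : realType.
Implicit Types f : {poly {poly R}}.

(* [W = f_xy / (f_x f_y)] is not a function of [f]: the Jacobian of the pair [(f, W)], cleared of denominators, is nonzero. *)
Definition nonspecial f : bool :=
  let m := dX f * dY f in let n := dX (dY f) in m * jac n f != n * jac m f.

Lemma nonspecial_neq0 f : nonspecial f -> dX f * dY f != 0.
Proof. by apply: contraNneq => ->; rewrite !(mul0r, jac0, mulr0). Qed.

(** ['Y], [f], [n2], [m] satisfy a relation homogeneous in [(n2, m)]. If [f] and [n2 / m] agree at
    (x, y) and (x', y'), the relation at (x', y') can be rewritten at (x, y) except for the powers
    of y'; this gives [Phi]. Nonspeciality keeps it nontrivial. *)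
Lemma quads_bound (d : nat) : exists C K : nat, forall f, bideg_le d f -> nonspecial f ->
  exists e1 e2 : {poly R}, [/\ e1 != 0, e2 != 0, (size e1 <= K)%N, (size e2 <= K)%N &
  forall (a b : nat -> R) (s : nat), (0 < s)%N ->
    (forall i, a i < a i.+1) -> (forall i, b i < b i.+1) ->
    (forall k, (k < s * s)%N -> e1.[a k] != 0) -> (forall l, (l < s * s)%N -> e2.[b l] != 0) ->
    (#|[set t | @quad R f a b s t]| <= C * s ^ 4)%N].
Proof.
(* Covers both the bidegree [d + d] of [m] and that of the variable ['Y]. *)
pose D := (2 * d + 1)%N.
have [N N0 elimP] := @elimination R D.
have [N1 N10 nsP] := @nonsingular_zeros R d.
have [N2 N20 fibP] := @fibre_on_curve R d.+1.
pose e := (2 * D * N).+1.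
eexists; exists (d.+1 + (e + e))%N => f fd fns.
have m0 := nonspecial_neq0 fns; have := m0; rewrite mulf_eq0 negb_or => /andP[fx0 fy0].
have [m mE] : exists m, m = dX f * dY f by eexists.
rewrite -mE in m0; pose n2 := dX (dY f).
have mb : bideg_le D m.
  by rewrite mE; apply: (@bideg_leW _ (d + d)); [rewrite /D; lia|apply: bideg_leM; [apply: bideg_le_dX|apply: bideg_le_dY]].
have dD : (d <= D)%N by rewrite /D; lia.
have nb : bideg_le D n2 by apply: bideg_leW dD _; apply/bideg_le_dX/bideg_le_dY.
have yb : bideg_le D ('Y : {poly {poly R}}) by rewrite /D addn1; apply: bideg_le_Y.
have [q [[i0 [j0 [k0 /and4P[i0N j0N k0N q0]]]] rel]] := elimP 'Y f n2 m yb (bideg_leW dD fd) nb mb.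
set S := \sum_(i < N) _ in rel.
(* The part of the relation that carries ['Y ^+ i]. Were [Psi i0] zero, [f] and [n2 / m] would be
   dependent over the constants, against nonspeciality. *)
pose Psi i : {poly {poly R}} := \sum_(j < N) \sum_(k < N) (q i j k)%:P%:P * (f ^+ j * (n2 ^+ k * m ^+ (N.-1 - k))).
have Psi_neq0 : Psi i0 != 0.
  apply: contraNneq fns => Psi0; rewrite /nonspecial -mE; apply/eqP.
  by apply: (@dependence _ f n2 m N (q i0)) => //; exists j0, k0; rewrite j0N k0N.
have Psib i : bideg_le (2 * D * N) (Psi i).
  apply: bideg_le_sum => j _; apply: bideg_le_sum => k _.
  have pw (g : {poly {poly R}}) (u : nat) : bideg_le D g -> bideg_le (D * u) (g ^+ u) by apply: bideg_leX.
  apply: (@bideg_leW _ (0 + (D * j + (D * k + D * (N.-1 - k))))).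
    have := ltn_ord j; have := ltn_ord k; rewrite -!mulnDr; nia.
  apply: bideg_leM; first exact: bideg_leCC.
  by apply: bideg_leM; [apply/pw/(bideg_leW dD)|apply: bideg_leM; apply: pw].
pose sl (g : {poly {poly R}}) y : {poly R} := (swapXY g).[y%:P].
have slE g y x : (sl g y).[x] = g.[x, y] by rewrite /sl horner2_swapXY.
have size_sl g y E : bideg_le E g -> (size (sl g y) <= E.+1)%N.
  rewrite -bideg_le_swap => /andP[_ gY]; exact: leq_trans (max_size_evalC _ _) gY.
(* [e1] excludes the columns on which f_y vanishes, [ea] the rows on which [m] does, and [eb] those
   on which [Psi i0] does. *)
have [e1 [e10 e1s e1P]] := generic_slice fy0 (bideg_le_dY fd).
have [||ea [ea0 eas eaP]] := @generic_slice R (2 * D * N) (swapXY m).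
- by rewrite swapXY_eq0.
- by rewrite bideg_le_swap; apply: bideg_leW mb; rewrite mulnAC leq_pmull // muln_gt0.
have [||eb [eb0 ebs ebP]] := @generic_slice R (2 * D * N) (swapXY (Psi i0)).
- by rewrite swapXY_eq0.
- by rewrite bideg_le_swap.
exists e1, (ea * eb); split; [exact: e10|by rewrite mulf_neq0| | |].
- by apply: leq_trans e1s _; rewrite leq_addr.
- apply: leq_trans (size_polyMleq _ _) _.
  apply: (@leq_trans (size ea + size eb)); first exact: leq_pred.
  by apply: (@leq_trans (e + e)); [apply: leq_add|apply: leq_addl].
move=> a b s s0 ai bi e1a e2b.
set n := (s * s)%N in e1a e2b.
have row_neq0 l : (l < n)%N -> sl m (b l) != 0.
  by move=> ln; apply: eaP; have := e2b l ln; rewrite hornerM mulf_eq0 negb_or => /andP[].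
have Psil l : (l < n)%N -> sl (Psi i0) (b l) != 0.
  by move=> ln; apply: ebP; have := e2b l ln; rewrite hornerM mulf_eq0 negb_or => /andP[].
have phi_nc l : (l < n)%N -> (phi f b l)^`() != 0.
  move=> ln; have := row_neq0 l ln; apply: contraNneq => ph0.
  apply/eqP/poly_fun_eq => x; rewrite slE mE !hornerM -deriv_slice -/(phi f b l) ph0 !horner0.
  by rewrite mul0r.
have col_nc k v : (k < n)%N -> f.[(a k)%:P] != v%:P.
  move=> kn; have := e1P _ (e1a k kn); apply: contraNneq => E.
  by apply/eqP/poly_fun_eq => y; rewrite -deriv_col E derivC !horner0.
have size_row l : (size (sl m (b l)) <= e)%N.
  by apply: leq_trans (size_sl _ _ _ mb) _; rewrite ltnS mulnAC leq_pmull // muln_gt0.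
pose Phi l l' := \sum_(i < N) (b l') ^+ i *: sl (Psi i) (b l).
have size_Phi l l' : (size (Phi l l') <= e)%N by apply: size_sum_scale => i; apply: size_sl.
have PhiE l l' x : (Phi l l').[x] = \sum_(i < N) \sum_(j < N) \sum_(k < N)
    q i j k * ((b l') ^+ i * f.[x, b l] ^+ j * (n2.[x, b l] ^+ k * m.[x, b l] ^+ (N.-1 - k))).
  rewrite /Phi horner_sum; apply: eq_bigr => i _; rewrite hornerZ slE !horner_sum mulr_sumr.
  apply: eq_bigr => j _; rewrite !horner_sum mulr_sumr; apply: eq_bigr => k _.
  set mx := m.[x, b l]; rewrite !hornerM !hornerC !horner_exp -/mx; ring.
have PhiP l l' x x' : m.[x, b l] != 0 -> m.[x', b l'] != 0 -> f.[x, b l] = f.[x', b l'] ->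
    n2.[x, b l] * m.[x', b l'] = n2.[x', b l'] * m.[x, b l] -> root (Phi l l') x.
  move=> mx mx' fE nE; rewrite /root PhiE.
  have := congr1 (fun g : {poly {poly R}} => g.[x', b l']) rel; rewrite !horner0 => rel'.
  apply/eqP; transitivity ((m.[x, b l] / m.[x', b l']) ^+ N.-1 * S.[x', b l']); last by rewrite rel' mulr0.
  rewrite /S horner_sum horner_sum mulr_sumr.
  apply: eq_bigr => i _; rewrite !horner_sum mulr_sumr; apply: eq_bigr => j _.
  rewrite !horner_sum mulr_sumr; apply: eq_bigr => k _.
  move: nE mx mx'; set M := m.[x, b l]; set M' := m.[x', b l'] => nE mx mx'.
  rewrite !(hornerM, hornerC, horner_exp, hornerX) fE -/M'.
  have -> : n2.[x, b l] = (M / M') * n2.[x', b l'].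
    by apply: (mulIf mx'); rewrite nE; field.
  set r := M / M'; have -> : M = r * M' by rewrite /r; field.
  have kN : (k <= N.-1)%N by rewrite -ltnS prednK.
  have -> : r ^+ N.-1 = r ^+ k * r ^+ (N.-1 - k) by rewrite -exprD subnKC.
  by rewrite !exprMn; ring.
(* At a point of the row [l] where [Psi i0] is nonzero, [Phi l l' = 0] becomes a nontrivial equation
   of degree below [N] for [b l']. *)
have few_bad l : (l < n)%N -> (#|[set l' : 'I_n | Phi l l' == 0%R]| <= N)%N.
  move=> ln; have [x0 px0] := nonroot (Psil l ln).
  pose r := \poly_(i < N) (Psi i).[x0, b l].
  have r0 : r != 0.
    apply: contraNneq px0 => /(congr1 (fun p : {poly R} => p`_i0)).
    by rewrite coef_poly i0N coef0 slE => ->.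
  apply: leq_trans (size_poly N (fun i => (Psi i).[x0, b l])); rewrite -/r; apply: ltnW.
  apply: (@card_le_roots _ _ _ (fun l' : 'I_n => b l') _ r0).
    by move=> l1 l2 _ _ /(b_inj bi)/val_inj.
  move=> l'; rewrite inE => /eqP P0; rewrite /root /r horner_poly.
  have := congr1 (fun p : {poly R} => p.[x0]) P0; rewrite /Phi horner0 horner_sum => E.
  apply/eqP; rewrite -[RHS]E; by apply: eq_bigr => i _; rewrite hornerZ slE mulrC.
have size_phi' l : (size (phi f b l) <= d.+1)%N by apply: size_phi.
have a0k k : a 0%N <= a k by case: k => // k; rewrite ltW // incr_lt_iff.
have lohi : a 0%N - 1 < a n by have := a0k n; lra.
have /choice[cut cutP] : forall l, exists c : nat -> R, (l < n)%N -> [/\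
    forall i, c i <= c i.+1, forall x, a 0%N - 1 < x <= a n -> exists i : 'I_d.+1, c i < x <= c i.+1 &
    forall i, smono_on (phi f b l) (c i) (c i.+1)].
  move=> l; have [ln|_] := boolP (l < n)%N; last by exists (fun=> 0).
  by have [c [_ _ c3 c4 c5]] := monotone_pieces lohi (size_phi' l) (phi_nc l ln); exists c.
have cm l i : (l < n)%N -> smono_on (phi f b l) (cut l i) (cut l i.+1) by move=> /cutP[].
have ci l i : (l < n)%N -> cut l i <= cut l i.+1 by move=> /cutP[].
have ip l k : (l < n)%N -> (k < n)%N -> exists i : 'I_d.+1, cut l i < a k <= cut l i.+1.
  move=> /cutP[_ H _] kn; apply: H; have := a0k k; have := incr_lt_iff ai kn; lra.
pose G := ('I_n * 'I_s * ('I_d.+1 * 'I_d.+1))%type.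
have /choice[hh hhP] : forall t : nat * G, exists y, (exists y', @onc R d f a b s cut t.1 t.2 y') -> @onc R d f a b s cut t.1 t.2 y.
  by move=> t; have [[y Hy]|ne] := pselect (exists y', @onc R d f a b s cut t.1 t.2 y'); [exists y|exists 0].
have hP k (g : G) : (exists y, @onc R d f a b s cut k g y) -> @onc R d f a b s cut k g (hh (k, g)) by exact: (hhP (k, g)).
subst m.
have [C -> H] := @quads_le R d f a b s fd s0 ai bi phi_nc col_nc cut cm ci (fun k g => hh (k, g)) hP N2 fibP
   Phi e N1 N size_Phi PhiP N10 nsP ip row_neq0 size_row few_bad.
exact: H.
Qed.
End Bivariate.

(** * Growth *)

Section Growth.
Variable R : realType.
Implicit Types f : {poly {poly R}}.

(** The cuts lie halfway between the last element of a block and the first of the next, which makes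
    every element interior to its interval; [A] adds a predecessor to the first element. *)
Lemma block_cuts (a : nat -> R) (s : nat) : (forall i, a i < a i.+1) -> (0 < s)%N ->
  exists xi : nat -> R, (forall i, xi i < xi i.+1) /\ forall k, xi (k %/ s)%N < a k < xi (k %/ s).+1.
Proof.
move=> ai s0; pose A j := if j is j'.+1 then a j' else a 0%N - 1.
have Ai j : A j < A j.+1 by case: j => [|j] /=; [rewrite ltrBlDr ltrDl ltr01|exact: ai].
have Alt := incr_lt_iff Ai.
have Ale i j : (i <= j)%N -> A i <= A j.
  by rewrite leq_eqVlt => /orP[/eqP ->|/Alt/ltW].
pose xi i := (A (i * s)%N + A (i * s).+1) / 2; exists xi.
have lo i : A (i * s)%N < xi i by rewrite /xi; have := Ai (i * s)%N; lra.
have hi i : xi i < A (i * s).+1 by rewrite /xi; have := Ai (i * s)%N; lra.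
split=> [i|k].
  apply: lt_trans (hi i) (le_lt_trans _ (lo i.+1)); apply: Ale.
  by rewrite mulSn; lia.
change (a k) with (A k.+1); apply/andP; split.
  by apply: lt_le_trans (hi _) (Ale _ _ _); rewrite ltnS leq_trunc_div.
by apply: le_lt_trans (Ale _ _ _) (lo _); rewrite ltn_ceil.
Qed.

(** The classes are triples of two blocks and a value. Cauchy-Schwarz gives s^8 <= C2 (s M + s^2) C1
    s^4, with the boxes hit in the first factor and the quadruples in the second; division by s^5
    leaves the claim. *)
Lemma bivariate_growth (d : nat) : exists C K : nat, forall f, bideg_le d f -> nonspecial f ->
  exists e1 e2 : {poly R}, [/\ e1 != 0, e2 != 0, (size e1 <= K)%N, (size e2 <= K)%N &
  forall (a b : nat -> R) (s M : nat) (val : 'I_M -> R), (0 < s)%N ->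
    (forall i, a i < a i.+1) -> (forall i, b i < b i.+1) ->
    (forall k, (k < s * s)%N -> e1.[a k] != 0) -> (forall l, (l < s * s)%N -> e2.[b l] != 0) ->
    injective val ->
    (forall k l, (k < s * s)%N -> (l < s * s)%N -> exists v, f.[a k, b l] = val v) ->
    (s ^ 3 <= C * (M + s))%N].
Proof.
have [C1 [K Q]] := quads_bound R d; have [C2 hits] := hits_count R d.
exists (C2 * C1)%N, K => f fd fns; have [e1 [e2 [e10 e20 e1K e2K H]]] := Q f fd fns.
exists e1, e2; split=> // a b s M val s0 ai bi e1a e2b vinj vals.
have {H Q}quads := H a b s s0 ai bi e1a e2b.
have [xi [xii xia]] := block_cuts ai s0; have [eta [etai etab]] := block_cuts bi s0.
have {}hits := hits f xi eta s M val fd vinj xii etai s0.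
set n := (s * s)%N in e1a e2b vals quads.
have /choice[vv vvP] : forall t : 'I_n * 'I_n, exists v, f.[a t.1, b t.2] = val v by move=> t; apply: vals.
have blk (k : 'I_n) : (k %/ s < s)%N by rewrite ltn_divLR.
pose cl (t : 'I_n * 'I_n) : 'I_s * 'I_s * 'I_M := (Ordinal (blk t.1), Ordinal (blk t.2), vv t).
have CS := cauchy_schwarz_fibres cl; rewrite card_prod !card_ord in CS.
have I1 : (#|cl @: {: 'I_n * 'I_n}| <= C2 * (s * M + s * s))%N.
  apply: leq_trans hits; apply/subset_leq_card/subsetP => _ /imsetP[t _ ->]; rewrite inE; apply/asboolP => /=.
  by exists (a t.1), (b t.2); rewrite xia etab.
have I2 : (#|[set t : ('I_n * 'I_n) * ('I_n * 'I_n) | cl t.1 == cl t.2]| <= C1 * s ^ 4)%N.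
  apply: leq_trans quads.
  pose off (k : 'I_n) : 'I_s := Ordinal (ltn_pmod k s0).
  pose r (t : ('I_n * 'I_n) * ('I_n * 'I_n)) := ((t.1.1, off t.2.1), (t.1.2, off t.2.2)).
  have offK (k k' : 'I_n) : (k %/ s = k' %/ s)%N -> mate s k (off k') = k'.
    by move=> E; rewrite /mate E /= -divn_eq.
  have rinj : {in [set t : ('I_n * 'I_n) * ('I_n * 'I_n) | cl t.1 == cl t.2] &, injective r}.
    move=> [[k l] [k' l']] [[k1 l1] [k1' l1']]; rewrite !inE /cl /= => /eqP[E1 E2 _] /eqP[E3 E4 _].
    move=> [F1 F2 F3 F4]; subst k1 l1; congr (_, _, (_, _)); apply/val_inj => /=.
      by rewrite (divn_eq k' s) (divn_eq k1' s) -E1 -E3 F2.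
    by rewrite (divn_eq l' s) (divn_eq l1' s) -E2 -E4 F4.
  rewrite -(card_in_imset rinj); apply/subset_leq_card/subsetP => _ /imsetP[[[k l] [k' l']] + ->].
  rewrite !inE /cl /= => /eqP[E1 E2 E3]; rewrite /quad /pos /mt /= !offK //.
  by apply/eqP; have := vvP (k, l); have := vvP (k', l'); rewrite /= E3 => -> ->.
have : (n * n * (n * n) <= C2 * (s * M + s * s) * (C1 * s ^ 4))%N by apply: leq_trans CS (leq_mul I1 I2).
have -> : (n * n * (n * n) = s ^ 3 * (s * s ^ 4))%N by rewrite /n; ring.
have -> : (C2 * (s * M + s * s) * (C1 * s ^ 4) = C2 * C1 * (M + s) * (s * s ^ 4))%N by ring.
by rewrite leq_pmul2r // muln_gt0 s0 expn_gt0 s0.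
Qed.

(** A class of size m with nd nondegenerate pairs satisfies m^2 <= K m + nd, hence m <= K + nd as m
    is an integer. This linear form is enough when the nondegenerate pairs are fewer than the
    elements. *)
Lemma fibre_bound (X Y : finType) (T : {set X}) (cl : X -> Y) (deg : rel X) (K : nat) :
  (forall x, x \in T -> #|[set x' in T | (cl x' == cl x) && deg x x']| <= K)%N ->
  (#|T| <= K * #|cl @: T| +
    #|[set t : X * X | [&& t.1 \in T, t.2 \in T, cl t.1 == cl t.2 & ~~ deg t.1 t.2]]|)%N.
Proof.
move=> degK; pose I := cl @: T; pose m y := #|[set x in T | cl x == y]|.
pose nd y := (\sum_(x in T | cl x == y) #|[set x' in T | (cl x' == cl x) && ~~ deg x x']|)%N.
have sT : (#|T| = \sum_(y in I) m y)%N.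
  rewrite -sum1_card (partition_big cl (mem I)) /=; last by move=> x xT; apply: imset_f.
  by apply: eq_bigr => y _; rewrite /m -sum1_card; apply: eq_bigl => x; rewrite inE.
have sN : (#|[set t : X * X | [&& t.1 \in T, t.2 \in T, cl t.1 == cl t.2 & ~~ deg t.1 t.2]]| = \sum_(y in I) nd y)%N.
  rewrite (card_setX_sum (fun x x' => [&& x \in T, x' \in T, cl x == cl x' & ~~ deg x x'])).
  rewrite (bigID (mem T)) /= [X in (_ + X)%N]big1 ?addn0; last first.
    by move=> x /negPf xT; apply/eqP; rewrite cards_eq0; apply/eqP/setP=> x'; rewrite !inE xT.
  rewrite (partition_big cl (mem I)) /=; last by move=> x xT; apply: imset_f.
  apply: eq_bigr => y _; apply: eq_bigr => x /andP[xT _]; apply: eq_card => x'.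
  by rewrite !inE xT /= [cl x == _]eq_sym.
rewrite sT sN mulnC -sum_nat_const -big_split /=; apply: leq_sum => y _.
have : (m y * m y <= K * m y + nd y)%N.
  pose Sy := [set x in T | cl x == y].
  have -> : (m y * m y = \sum_(x in Sy) m y)%N by rewrite sum_nat_const.
  have -> : (K * m y = \sum_(x in Sy) K)%N by rewrite sum_nat_const mulnC.
  have -> : nd y = (\sum_(x in Sy) #|[set x' in T | (cl x' == cl x) && ~~ deg x x']|)%N.
    by apply: eq_bigl => x; rewrite inE.
  rewrite -big_split /=; apply: leq_sum => x; rewrite inE => /andP[xT /eqP xy].
  apply: leq_trans (leq_add (degK x xT) (leqnn _)); apply: leq_trans (leq_card_setU _ _).
  apply/subset_leq_card/subsetP => x'; rewrite !inE => /andP[-> /eqP ->] /=; rewrite xy eqxx /=.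
  by case: (deg x x').
by case: (leqP (m y) K) => h; nia.
Qed.

(** Triples of one class share the blocks, the third coordinate and the value. If they also share
    the polynomial [u], both slices [F c0] and [F c1] agree at the two points, which leaves [N * N]
    choices by nonsingularity; otherwise the two polynomials agree at no more than [d] third
    coordinates. *)
Lemma trivariate_growth (d : nat) : exists C K : nat,
  forall (F : R -> {poly {poly R}}) (u : R -> R -> {poly R}) (c0 c1 : R),
    (forall c, bideg_le d (F c)) -> (forall x y, size (u x y) <= d.+1)%N ->
    (forall x y c, (u x y).[c] = (F c).[x, y]) -> jac (F c0) (F c1) != 0 ->
  exists e1 : {poly R}, [/\ e1 != 0, (size e1 <= K)%N &
  forall (a b cc : nat -> R) (s M : nat) (val : 'I_M -> R), (0 < s)%N ->
    (forall i, a i < a i.+1) -> (forall i, b i < b i.+1) -> injective cc ->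
    (forall k, (k < d.+1 * s * s)%N -> e1.[a k] != 0) ->
    injective val ->
    (forall k l i, (k < d.+1 * s * s)%N -> (l < d.+1 * s * s)%N -> (i < d.+1 * s * s)%N ->
       exists v, (F (cc i)).[a k, b l] = val v) ->
    (s ^ 3 <= C * (M + s))%N].
Proof.
have [N N0 nsP] := @nonsingular_zeros R d; have [C2 hits] := hits_count R d.
exists (N * N * C2 * d.+1 + (d + d).+1)%N, (d + d).+1 => F u c0 c1 Fd ud uE J0.
set J := jac _ _ in J0.
have Jd : bideg_le (d + d) J.
  by apply: bideg_leB; apply: bideg_leM; rewrite ?bideg_le_dX ?bideg_le_dY.
have [e1 [e10 e1s e1P]] := generic_slice J0 Jd.
exists e1; split=> // a b cc s M val s0 ai bi cci e1a vinj vals.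
(* The side of the grid is [d.+1 * s * s] because distinct polynomials may cost [d] coincidences per
   pair: the factor [d.+1] leaves a surplus of [s ^ 3] after these are subtracted. *)
set t := (d.+1 * s)%N in e1a vals; set n := (t * s)%N in e1a vals.
have t0 : (0 < t)%N by rewrite muln_gt0 s0.
have [xi [xii xia]] := block_cuts ai s0; have [eta [etai etab]] := block_cuts bi s0.
have blk (k : 'I_n) : (k %/ s < t)%N by rewrite ltn_divLR.
pose X := ('I_n * 'I_n * 'I_n)%type.
pose good (p : 'I_n * 'I_n) := J.[a p.1, b p.2] != 0.
pose T := [set x : X | good x.1].
have /choice[vv vvP] : forall x : X, exists v, (F (cc x.2)).[a x.1.1, b x.1.2] = val v by move=> x; apply: vals.
pose up (p : 'I_n * 'I_n) := u (a p.1) (b p.2).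
pose cl (x : X) : 'I_t * 'I_t * 'I_n * 'I_M := (Ordinal (blk x.1.1), Ordinal (blk x.1.2), x.2, vv x).
pose deg (x x' : X) := up x.1 == up x'.1.
have degK x : x \in T -> (#|[set x' in T | (cl x' == cl x) && deg x x']| <= N * N)%N.
  rewrite inE => xg.
  have Gd c : bideg_le d (F c - (F c).[a x.1.1, b x.1.2]%:P%:P) by apply: bideg_leB (Fd c) (bideg_leCC _ _).
  have [p1 [p2 [p10 p20 p1N p2N pr]]] := nsP _ _ (Gd c0) (Gd c1).
  pose A (f : nat -> R) (r : {poly R}) := [set k : 'I_n | root r (f k)].
  have cA (f : nat -> R) (r : {poly R}) : injective f -> r != 0 -> (size r <= N)%N -> (#|A f r| <= N)%N.
    move=> fi r0 rN; apply: leq_trans rN; apply: ltnW; apply: (@card_le_roots _ _ _ (fun k : 'I_n => f k) _ r0).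
      by move=> k k' _ _ /fi/val_inj.
    by move=> k; rewrite inE.
  apply: (@leq_trans #|setX (A a p1) (A b p2)|); last first.
    by rewrite cardsX leq_mul // cA //; [exact: a_inj|exact: b_inj].
  pose r (x' : X) := x'.1.
  rewrite -(card_in_imset (f := r)); last first.
    move=> [p c] [p' c']; rewrite !inE /= => /and3P[_ /eqP h1 _] /and3P[_ /eqP h2 _]; rewrite /r /= => ->.
    by move: h1 h2 => [_ _ -> _] [_ _ -> _].
  apply/subset_leq_card/subsetP => _ /imsetP[x' + ->]; rewrite !inE => /and3P[x'g _ /eqP E].
  have EF c : (F c).[a x.1.1, b x.1.2] = (F c).[a x'.1.1, b x'.1.2] by rewrite -!uE -/(up x.1) E.
  have [] := pr (a x'.1.1) (b x'.1.2).
  - by rewrite !hornerE EF subrr.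
  - by rewrite !hornerE EF subrr.
  - rewrite /jac !dXB !dYB !dXC !dYC !derivC !polyC0 !subr0; exact: x'g.
  by move=> -> ->.
have cI : (#|cl @: T| <= n * (C2 * (t * M + t * t)))%N.
  pose r (z : 'I_t * 'I_t * 'I_n * 'I_M) := (z.1.2, (z.1.1, z.2)).
  have ri : injective r by move=> [[[? ?] ?] ?] [[[? ?] ?] ?] [-> -> -> ->].
  rewrite -(card_imset _ ri).
  pose Q (c : 'I_n) (z : 'I_t * 'I_t * 'I_M) := `[< hit (F (cc c)) (xi z.1.1) (xi z.1.1.+1) (eta z.1.2) (eta z.1.2.+1) (val z.2) >].
  apply: (@leq_trans #|[set w : 'I_n * ('I_t * 'I_t * 'I_M) | Q w.1 w.2]|).
    apply/subset_leq_card/subsetP => _ /imsetP[_ /imsetP[x _ ->] ->]; rewrite inE; apply/asboolP => /=.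
    by exists (a x.1.1), (b x.1.2); rewrite xia etab.
  rewrite card_setX_sum -[X in (_ <= X * _)%N]card_ord -sum_nat_const; apply: leq_sum => c _.
  exact: hits.
have cND : (#|[set w : X * X | [&& w.1 \in T, w.2 \in T, cl w.1 == cl w.2 & ~~ deg w.1 w.2]]| <= n * n * (s * s) * d)%N.
  pose off (k : 'I_n) : 'I_s := Ordinal (ltn_pmod k s0).
  pose r (w : X * X) := ((w.1.1, (off w.2.1.1, off w.2.1.2)), w.1.2).
  have mtn (k : 'I_n) (o : 'I_s) : (mate s k o < n)%N.
    have := blk k; have := ltn_ord o; rewrite /mate /n; nia.
  pose mtI k o : 'I_n := Ordinal (mtn k o).
  have offK (k k' : 'I_n) : (k %/ s = k' %/ s)%N -> mtI k (off k') = k'.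
    by move=> E; apply/val_inj; rewrite /= /mate E -divn_eq.
  set S := [set _ | _].
  have rinj : {in S &, injective r}.
    move=> [[[k l] c] [[k' l'] c']] [[[k1 l1] c1'] [[k1' l1'] c1'']]; rewrite !inE /=.
    move=> /and4P[_ _ /eqP[E1 E2 E5 _] _] /and4P[_ _ /eqP[E3 E4 E6 _] _] [F1 F2 F3 F4 F5].
    subst k1 l1 c1' c' c1''.
    by rewrite -(offK _ _ E1) -(offK _ _ E2) -(offK _ _ E3) -(offK _ _ E4); congr (_, (_, _, _)); congr (mtI _ _); apply/val_inj.
  rewrite -(card_in_imset rinj).
  pose Q (z : 'I_n * 'I_n * ('I_s * 'I_s)) (c : 'I_n) :=
    (up z.1 != up (mtI z.1.1 z.2.1, mtI z.1.2 z.2.2)) && root (up z.1 - up (mtI z.1.1 z.2.1, mtI z.1.2 z.2.2)) (cc c).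
  apply: (@leq_trans #|[set z | Q z.1 z.2]|).
    apply/subset_leq_card/subsetP => _ /imsetP[[[[k l] c] [[k' l'] c']] + ->]; rewrite !inE /Q /=.
    move=> /and4P[_ _ /eqP[E1 E2 E3 E4]]; rewrite !offK // /deg /= => -> /=; subst c'.
    rewrite /root hornerD hornerN subr_eq0; apply/eqP; rewrite /up !uE /=.
    by have := vvP (k, l, c); have := vvP (k', l', c); rewrite /= E4 => -> ->.
  rewrite card_setX_sum.
  have -> : (n * n * (s * s) * d = \sum_(z : 'I_n * 'I_n * ('I_s * 'I_s)) d)%N.
    by rewrite sum_nat_const !card_prod !card_ord.
  apply: leq_sum => z _; rewrite /Q; set p := up z.1; set p' := up _.
  have [E|ne] := eqVneq p p'.
    by rewrite (_ : [set _ | _] = set0) ?cards0 //; apply/setP=> c; rewrite !inE E eqxx.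
  have pp0 : p - p' != 0 by rewrite subr_eq0.
  rewrite -ltnS; apply: (@leq_trans (size (p - p'))); last first.
    by apply: leq_trans (size_polyD _ _) _; rewrite size_polyN geq_max !ud.
  apply: (@card_le_roots _ _ _ (fun c : 'I_n => cc c) _ pp0); first by move=> c c' _ _ /cci/val_inj.
  by move=> c; rewrite inE => /andP[].
have cT : (n * n * n <= #|T| + n * (d + d).+1 * n)%N.
  have -> : #|T| = (#|[set p | good p]| * n)%N.
    by rewrite -[X in (_ * X)%N]card_ord -cardsT -cardsX; apply: eq_card => x; rewrite !inE andbT.
  rewrite -mulnDl leq_mul2r; apply/orP; right.
  have <- : #|{: 'I_n * 'I_n}| = (n * n)%N by rewrite card_prod card_ord.
  rewrite -(cardsC [set p | good p]) leq_add2l.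
  rewrite (_ : ~: _ = [set p : 'I_n * 'I_n | J.[a p.1, b p.2] == 0]); last by apply/setP=> p; rewrite !inE negbK.
  rewrite (card_setX_sum (fun k l : 'I_n => J.[a k, b l] == 0)) -[X in (_ <= X * _)%N]card_ord -sum_nat_const.
  apply: leq_sum => k _; have Jk := e1P _ (e1a k (ltn_ord k)).
  apply: (@leq_trans (size J.[(a k)%:P])); last first.
    by apply: leq_trans (max_size_evalC _ _) _; case/andP: Jd.
  apply: ltnW; apply: (@card_le_roots _ _ _ (fun l : 'I_n => b l) _ Jk); first by move=> l l' _ _ /(b_inj bi)/val_inj.
  by move=> l; rewrite inE.
have FB := fibre_bound degK; have n0 : (0 < n)%N by rewrite muln_gt0 t0.
have tot : (n * n * n <= N * N * (n * (C2 * (t * M + t * t))) + n * n * (s * s) * d + n * (d + d).+1 * n)%N.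
  apply: leq_trans cT _; rewrite leq_add2r; apply: leq_trans FB _.
  by apply: leq_add => //; rewrite leq_mul2l cI orbT.
have {}tot : (n * n <= N * N * (C2 * (t * M + t * t)) + n * (s * s) * d + (d + d).+1 * n)%N.
  rewrite -(leq_pmul2l n0).
  by apply: leq_trans (leq_trans _ tot) _; apply: eq_leq; ring.
have {}tot : (t * s * s <= N * N * (C2 * (M + t)) + s * (s * s) * d + (d + d).+1 * s)%N.
  rewrite -(leq_pmul2l t0).
  by apply: leq_trans (leq_trans _ tot) _; apply: eq_leq; rewrite /n; ring.
have E : (t * s * s = s * (s * s) * d + s ^ 3)%N by rewrite /t; ring.
have {}tot : (s ^ 3 <= N * N * (C2 * (M + t)) + (d + d).+1 * s)%N.
  by rewrite -(leq_add2l (s * (s * s) * d)%N) -E; apply: leq_trans tot _; apply: eq_leq; ring.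
apply: leq_trans tot _.
have -> : ((N * N * C2 * d.+1 + (d + d).+1) * (M + s) = N * N * (C2 * (M + t)) + (d + d).+1 * s + (N * N * C2 * d * M + (d + d).+1 * M))%N.
  by rewrite /t; ring.
by rewrite leq_addr.
Qed.
End Growth.

(** * Polynomial solutions of first order linear equations *)

Lemma deriv_lead (L : idomainType) (p : {poly L}) :
  (forall (c : L) k, c *+ k.+1 = 0 -> c = 0) -> (1 < size p)%N ->
  size p^`() = (size p).-1 /\ lead_coef p^`() = lead_coef p *+ (size p).-1.
Proof.
move=> char0 sp; have p0 : p != 0 by rewrite -size_poly_gt0 (leq_trans _ sp).
have [m Em] : exists m, size p = m.+2 by exists (size p).-2; lia.
have cm : p^`()`_m = lead_coef p *+ m.+1 by rewrite coef_deriv lead_coefE Em.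
have cm0 : p^`()`_m != 0.
  by rewrite cm; apply: contraNneq p0 => /char0/eqP; rewrite lead_coef_eq0.
have sd : size p^`() = m.+1.
  apply/eqP; rewrite eqn_leq -ltnS -Em lt_size_deriv //= ltnNge; apply/negP=> sm.
  by move: cm0; rewrite nth_default ?eqxx.
by rewrite sd Em /= lead_coefE sd.
Qed.

Section Eigen.
Variable R : numFieldType.
Implicit Types p q u v e h : {poly R}.

Lemma char0_num (c : R) k : c *+ k.+1 = 0 -> c = 0.
Proof. by move/eqP; rewrite mulrn_eq0 => /eqP. Qed.

Lemma deriv_lead_num p : (1 < size p)%N ->
  size p^`() = (size p).-1 /\ lead_coef p^`() = lead_coef p *+ (size p).-1.
Proof. exact: deriv_lead char0_num. Qed.

(** Leading coefficients in the equation force equal degrees. The combination [r] that cancels the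
    leading term of [p] solves the same equation, so it is zero or has the degree it has just
    lost. *)
Lemma wronskian p q : q != 0 -> p^`() * q = p * q^`() -> exists c : R, p = c *: q.
Proof.
move=> q0 W; pose r := p - (lead_coef p / lead_coef q) *: q.
have lq : lead_coef q != 0 by rewrite lead_coef_eq0.
have degs u : u != 0 -> u^`() * q = u * q^`() -> size u = size q.
  move=> u0 Wu.
  have [su|su] := leqP (size u) 1; have [sq|sq] := leqP (size q) 1.
  - by move: su sq u0 q0; rewrite -!size_poly_gt0; lia.
  - have [_ lq'] := deriv_lead_num sq.
    move: Wu; rewrite (size1_polyC su) derivC mul0r => /esym/eqP; rewrite mulf_eq0 polyC_eq0.
    have -> : (q^`() == 0) = false by rewrite -lead_coef_eq0 lq' mulrn_eq0 (negPf lq) orbF; case: (size q) sq => [|[|]].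
    by rewrite orbF => /eqP E; move: u0; rewrite (size1_polyC su) E polyC0 eqxx.
  - have [_ lu'] := deriv_lead_num su.
    move: Wu; rewrite (size1_polyC sq) derivC mulr0 => /eqP; rewrite mulf_eq0 polyC_eq0.
    have -> : (u^`() == 0) = false by rewrite -lead_coef_eq0 lu' mulrn_eq0 lead_coef_eq0 (negPf u0) orbF; case: (size u) su => [|[|]].
    by move=> /= /eqP E; move: q0; rewrite (size1_polyC sq) E polyC0 eqxx.
  - have [_ lu'] := deriv_lead_num su; have [_ lq'] := deriv_lead_num sq.
    have := congr1 (fun w : {poly R} => lead_coef w) Wu; rewrite !lead_coefM lu' lq' mulrnAl mulrnAr.
    have l0 : lead_coef u * lead_coef q != 0 by rewrite mulf_neq0 ?lead_coef_eq0.
    rewrite -mulr_natr -[RHS]mulr_natr => /(mulfI l0)/eqP; rewrite eqr_nat => /eqP.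
    by move: su sq; lia.
exists (lead_coef p / lead_coef q); apply/subr0_eq/eqP; rewrite -/r; apply/negPn/negP=> r0.
have p0 : p != 0.
  by apply: contraNneq r0 => p0; rewrite /r p0 lead_coef0 mul0r scale0r subrr.
have Wr : r^`() * q = r * q^`() by rewrite /r derivB derivZ !mulrBl W -!scalerAl [q^`() * q]mulrC.
have spq := degs p p0 W; have srq := degs r r0 Wr.
have : r`_(size q).-1 = 0.
  by rewrite /r coefB coefZ -{1}spq -!lead_coefE divfK ?subrr.
by rewrite -srq -lead_coefE => /eqP; rewrite lead_coef_eq0 (negPf r0).
Qed.

(** Eigenvectors of the derivation (a / b) d/dt; eigenvalues add under multiplication. *)
Definition eig (a b : {poly R}) (lam : R) e : Prop := a * e^`() = lam *: (b * e).

Variables a b : {poly R}.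
Hypotheses (a0 : a != 0) (b0 : b != 0).

Lemma eig_unique lam u v : v != 0 -> eig a b lam u -> eig a b lam v -> exists c : R, u = c *: v.
Proof.
move=> v0 eu ev; apply: wronskian v0 _; apply: (mulfI a0).
by rewrite mulrA eu mulrCA ev -!mul_polyC; ring.
Qed.

Lemma eig_exp lam u n : eig a b lam u -> eig a b (lam *+ n) (u ^+ n).
Proof.
rewrite /eig => eu; elim: n => [|n IH]; first by rewrite expr0 -polyC1 derivC mulr0 mulr0n scale0r.
rewrite exprS derivM mulrDr mulrA eu mulrCA IH -!mul_polyC mulrS polyCD; ring.
Qed.

(** [e ^+ g] and [h ^+ (g * u + r)] have the same eigenvalue, so they are proportional and [h ^+ u]
    divides [e]; the quotient keeps the remaining eigenvalue. *)
Lemma eig_split lam h e (g r u : nat) : h != 0 -> e != 0 -> (0 < g)%N ->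
  eig a b (lam *+ g) h -> eig a b (lam *+ (g * u + r)) e ->
  exists e', [/\ e' != 0, eig a b (lam *+ r) e' & e = e' * h ^+ u].
Proof.
move=> h0 e0 g0 eh ee.
have E1 := eig_exp g ee; have E2 := eig_exp (g * u + r) eh.
rewrite -!mulrnA [(g * (g * u + r))%N]mulnC in E1 E2.
have hN : h ^+ (g * u + r) != 0 by rewrite expf_neq0.
have [c Ec] := eig_unique hN E1 E2.
have : h ^+ u %| e.
  rewrite -(@dvdp_pexp2r _ _ _ g) // Ec dvdpZr.
    by rewrite -exprM mulnC exprD dvdp_mulr.
  by apply: contraNneq (expf_neq0 g e0) => c0; rewrite Ec c0 scale0r.
case/dvdpP=> e' ee'; exists e'.
have e'0 : e' != 0 by apply: contraNneq e0 => E; rewrite ee' E mul0r.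
split=> //; have hu : h ^+ u != 0 by rewrite expf_neq0.
apply: (mulIf hu); move: ee; rewrite /eig {}ee' derivM.
have := eig_exp u eh; rewrite /eig -mulrnA => Eh.
rewrite mulrDr [a * (e' * _)]mulrCA Eh mulrnDr !scalerDl => H.
by apply: (addIr (e' * (lam *+ (g * u) *: (b * h ^+ u)))); rewrite -mulrA H -!mul_polyC; ring.
Qed.

Lemma eig0_const e : eig a b 0 e -> exists c : R, e = c%:P.
Proof.
rewrite /eig scale0r => /eqP; rewrite mulf_eq0 (negPf a0) => /eqP/deriv_eq0 E.
by exists e`_0.
Qed.

Lemma eig_degree lam e : size a = (size b).+1 -> e != 0 -> eig a b lam e ->
  lead_coef a *+ (size e).-1 = lam * lead_coef b.
Proof.
move=> sab e0 ee; have sb : (0 < size b)%N by rewrite size_poly_gt0.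
have lb : lead_coef b != 0 by rewrite lead_coef_eq0.
have le : lead_coef e != 0 by rewrite lead_coef_eq0.
have [se|se] := leqP (size e) 1.
  have -> : (size e).-1 = 0%N by lia.
  rewrite mulr0n; move: ee; rewrite /eig (size1_polyC se) derivC mulr0 => /esym/eqP.
  rewrite scaler_eq0 mulf_eq0 (negPf b0) /= => /orP[/eqP ->|]; first by rewrite mul0r.
  by rewrite polyC_eq0 => /eqP E; move: e0; rewrite (size1_polyC se) E polyC0 eqxx.
have [sd ld] := deriv_lead_num se.
have d0 : e^`() != 0 by rewrite -size_poly_gt0 sd; lia.
have lam0 : lam != 0.
  by apply/eqP=> l0; move/eqP: ee; rewrite l0 scale0r mulf_eq0 (negPf a0) (negPf d0).
have := congr1 (fun w : {poly R} => lead_coef w) ee; rewrite /= lead_coefM lead_coefZ lead_coefM ld => E.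
by apply: (mulIf le); rewrite -mulrA -E mulrnAl mulrnAr.
Qed.
End Eigen.

Lemma coefM_top (L : nzRingType) (p q : {poly L}) i j :
  (size p <= i.+1)%N -> (size q <= j.+1)%N -> (p * q)`_(i + j) = p`_i * q`_j.
Proof.
move=> sp sq; have li : (i < (i + j).+1)%N by lia.
rewrite coefM (bigD1 (Ordinal li)) //= big1 ?addr0 => [|k /negP nk]; first by rewrite addKn.
have : (k != i :> nat) by apply/negP=> /eqP E; case: nk; apply/eqP/val_inj.
rewrite neq_ltn => /orP[lk|lk].
  by rewrite [q`__]nth_default ?mulr0 //; apply: leq_trans sq _; lia.
by rewrite [p`__]nth_default ?mul0r //; apply: leq_trans sp _.
Qed.

Section Kernel.
Variable R : numFieldType.
Implicit Types f : {poly {poly R}}.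
Implicit Types a b h k : {poly R}.

Definition in_kernel a1 a2 b1 b2 f : Prop :=
  map_poly polyC a1 * b2%:P * dX f = map_poly polyC a2 * b1%:P * dY f.

Lemma size_Xpart a : size (map_poly (polyC : R -> {poly R}) a) = size a.
Proof. exact: size_map_polyC. Qed.

Lemma lead_coef_Xpart a : lead_coef (map_poly (polyC : R -> {poly R}) a) = (lead_coef a)%:P.
Proof. by rewrite lead_coefE size_Xpart coef_map. Qed.

Lemma dX_eq0 f : dX f = 0 -> f = (f`_0)%:P.
Proof.
move=> d0; apply/polyP=> -[|i]; rewrite coefC //=.
by apply: (@char0_mulrn R _ i); have := congr1 (fun q : {poly {poly R}} => q`_i) d0; rewrite /dX coef_deriv coef0.
Qed.

Lemma dX_lead f : dX f != 0 -> [/\ (1 < size f)%N, size (dX f) = (size f).-1 &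
  lead_coef (dX f) = lead_coef f *+ (size f).-1].
Proof.
move=> d0; have sf : (1 < size f)%N.
  by rewrite ltnNge; apply: contraNN d0 => /size1_polyC ->; rewrite dXC.
by have [? ?] := deriv_lead (@char0_mulrn R) sf.
Qed.

Lemma size_XYpart a b : (size (map_poly polyC a * b%:P)%R <= size a)%N.
Proof. by rewrite mulrC mul_polyC -(size_Xpart a) size_scale_leq. Qed.

Lemma size_dY f : (size (dY f) <= size f)%N.
Proof. exact: size_poly. Qed.

(** Compare the top coefficients in the first variable. If [a1] has larger degree than [a2], the two
    sides balance only for a difference of one, and the leading coefficient is an eigenvector.
    Otherwise nothing matches the derivative of the leading coefficient, which is therefore a
    constant, and [b1] divides [b2]. *)
Lemma kernel_lead a1 a2 b1 b2 f : a1 != 0 -> a2 != 0 -> b1 != 0 -> b2 != 0 ->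
  in_kernel a1 a2 b1 b2 f -> dX f != 0 ->
  size a1 = (size a2).+1 /\
    eig b1 b2 ((lead_coef a1 / lead_coef a2) *+ (size f).-1) (lead_coef f) \/
  b1 %| b2.
Proof.
move=> a10 a20 b10 b20 K d0; have [sf sd ld] := dX_lead d0.
have [m Em] : exists m, size f = m.+2 by exists (size f).-2; lia.
rewrite Em /= in sd ld *.
have s1 : (0 < size a1)%N by rewrite size_poly_gt0.
have s2 : (0 < size a2)%N by rewrite size_poly_gt0.
have X10 : map_poly polyC a1 != 0 :> {poly {poly R}} by rewrite -size_poly_gt0 size_Xpart.
have Y20 : b2%:P != 0 :> {poly {poly R}} by rewrite polyC_eq0.
have sL : size (map_poly polyC a1 * b2%:P * dX f) = ((size a1).-1 + m.+1)%N.
  rewrite size_mul ?mulf_neq0 // sd size_mul // size_Xpart size_polyC b20; lia.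
have top : (map_poly polyC a2 * b1%:P * dY f)`_((size a2).-1 + m.+1) =
    (lead_coef a2)%:P * b1 * (lead_coef f)^`().
  rewrite coefM_top.
  - by rewrite coefMC coef_map /= coef_dY !lead_coefE Em.
  - by rewrite (leq_trans (size_XYpart _ _)) // prednK.
  - by apply: leq_trans (size_dY _) _; rewrite Em.
have lL : lead_coef (map_poly polyC a1 * b2%:P * dX f) =
    (lead_coef a1)%:P * b2 * (lead_coef f *+ m.+1).
  by rewrite !lead_coefM lead_coef_Xpart lead_coefC ld.
have la2 : lead_coef a2 != 0 by rewrite lead_coef_eq0.
have [s12|s12] := ltnP (size a2) (size a1); [left | right].
  have sR : (size (map_poly polyC a2 * b1%:P * dY f)%R <= (size a2).-1 + m.+2)%N.
    apply: leq_trans (size_polyMleq _ _) _; move: (size_dY f) (size_XYpart a2 b1); rewrite Em.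
    move: (size _) (size _) (size _) s2; lia.
  have s12' : size a1 = (size a2).+1 by move: sR; rewrite -K sL; lia.
  split=> //; rewrite /eig.
  have : (lead_coef a1)%:P * b2 * (lead_coef f *+ m.+1) = (lead_coef a2)%:P * b1 * (lead_coef f)^`().
    rewrite -lL -top -K lead_coefE sL; congr (_`__); lia.
  move=> E; apply: (@mulfI _ (lead_coef a2)%:P); first by rewrite polyC_eq0.
  rewrite mulrA -E -mul_polyC polyCMn.
  have -> : (lead_coef a1)%:P = (lead_coef a2)%:P * (lead_coef a1 / lead_coef a2)%:P :> {poly R}.
    by rewrite -polyCM mulrC divfK.
  by rewrite mulrnAl !mulrnAr !mulrA.
have c0 : (lead_coef f)^`() = 0.
  have : (map_poly polyC a1 * b2%:P * dX f)`_((size a2).-1 + m.+1) = 0.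
    by rewrite nth_default // sL leq_add2r; lia.
  rewrite K top => /eqP; rewrite mulf_eq0 mulf_eq0 polyC_eq0 (negPf la2) (negPf b10) /=.
  by move/eqP.
have lf : lead_coef f = ((lead_coef f)`_0)%:P := deriv_eq0 c0.
have lf0 : (lead_coef f)`_0 != 0.
  by rewrite -polyC_eq0 -lf lead_coef_eq0; apply: contraNneq d0 => ->; rewrite /dX deriv0.
have : b1 %| (lead_coef a1)%:P * b2 * (lead_coef f *+ m.+1).
  by rewrite -lL lead_coefE K [map_poly _ _ * _]mulrC -mulrA coefCM dvdp_mulr.
rewrite lf -polyCMn mulrC mul_polyC mul_polyC !dvdpZr ?mulrn_eq0 //.
by rewrite lead_coef_eq0.
Qed.

Lemma in_kernel_swap a1 a2 b1 b2 f :
  in_kernel a1 a2 b1 b2 f -> in_kernel b1 b2 a1 a2 (swapXY f).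
Proof.
move=> K; have := congr1 swapXY K; rewrite /in_kernel !rmorphM /= -dX_swap -dY_swap.
by rewrite !swapXY_map_polyC !swapXY_polyC => E; rewrite [map_poly _ b1 * _]mulrC -E [map_poly _ b2 * _]mulrC.
Qed.

Lemma kernel_dX0 a1 a2 b1 b2 f : a1 != 0 -> a2 != 0 -> b1 != 0 -> b2 != 0 ->
  in_kernel a1 a2 b1 b2 f -> (dX f == 0) = (dY f == 0).
Proof.
move=> a10 a20 b10 b20 K; have N a : a != 0 -> map_poly polyC a != 0 :> {poly {poly R}}.
  by rewrite -!size_poly_gt0 size_Xpart.
have := congr1 (fun q => q == 0) K; rewrite /= !mulf_eq0 !polyC_eq0.
by rewrite !(negPf (N _ _)) // (negPf b10) (negPf b20).
Qed.

Lemma kernel_const a1 a2 b1 b2 f : a1 != 0 -> a2 != 0 -> b1 != 0 -> b2 != 0 ->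
  in_kernel a1 a2 b1 b2 f -> dX f = 0 -> exists c : R, f = c%:P%:P.
Proof.
move=> a10 a20 b10 b20 K d0.
have := kernel_dX0 a10 a20 b10 b20 K; rewrite d0 eqxx => /esym/eqP dy0.
have Ef := dX_eq0 d0; rewrite Ef dYC in dy0.
by exists (f`_0)`_0; rewrite {1}Ef -deriv_eq0 //; apply/eqP; rewrite -(polyC_eq0 (f`_0)^`()) dy0.
Qed.

End Kernel.

Section KernelForms.
Variable R : realType.
Implicit Types f F : {poly {poly R}}.
Implicit Types a b h k p : {poly R}.

Lemma primitive p : exists q : {poly R}, q^`() = p.
Proof.
exists (\poly_(i < (size p).+1) (p`_i.-1 / i%:R)); apply/polyP=> i.
rewrite coef_deriv coef_poly ltnS; case: ltnP => sp; last by rewrite mul0rn nth_default.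
by rewrite /= -[LHS]mulr_natr divfK // pnatr_eq0.
Qed.

Lemma comp_poly_inj0 k p : k^`() != 0 -> p \Po k = 0 -> p = 0.
Proof.
move=> k0 /eqP; rewrite comp_poly_eq0 //; first by move/eqP.
by rewrite ltnNge; apply: contraNN k0 => /size1_polyC ->; rewrite derivC.
Qed.

(** Descending induction on [i]: the equation in degree deg a + i expresses the derivative of the
    [i]-th coefficient through higher ones, as [b] times a polynomial in [k]; since [b] is the
    derivative of [k], this integrates to a polynomial in [k]. *)
Lemma kernel_coef a b k f i : k^`() = b -> a != 0 ->
  b%:P * dX f = map_poly polyC a * dY f -> exists G : {poly R}, f`_i = G \Po k.
Proof.
move=> kb a0 K.
have [n] := ubnP (size f - i)%N; elim: n i => // n IH i lin.
have [fi|fi] := leqP (size f) i; first by exists 0; rewrite nth_default // comp_poly0.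
have IH' j : (i < j)%N -> exists G : {poly R}, f`_j = G \Po k by move=> ij; apply: IH; lia.
pose P (u : {poly R}) := exists Q : {poly R}, u = (Q \Po k) * b.
have P0 : P 0 by exists 0; rewrite comp_poly0 mul0r.
have PD u v : P u -> P v -> P (u + v).
  by move=> [Q ->] [Q' ->]; exists (Q + Q'); rewrite comp_polyD mulrDl.
have PZ c u : P u -> P (c *: u) by move=> [Q ->]; exists (c *: Q); rewrite comp_polyZ scalerAl.
have PA j : (i < j)%N -> P (f`_j)^`().
  by move=> /IH'[G ->]; exists G^`(); rewrite deriv_comp kb.
have sa : (0 < size a)%N by rewrite size_poly_gt0.
have la : lead_coef a != 0 by rewrite lead_coef_eq0.
have := congr1 (fun u : {poly {poly R}} => u`_((size a).-1 + i)) K.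
have lA : ((size a).-1 < ((size a).-1 + i).+1)%N by lia.
rewrite /= coefCM coefM (bigD1 (Ordinal lA)) //= addKn coef_map /= -lead_coefE coef_dY mul_polyC.
rewrite /dX coef_deriv; set S := \sum_(_ < _ | _) _ => E.
have PS : P S.
  apply: (big_ind P P0 PD) => j /negP nj; rewrite coef_map /= coef_dY mul_polyC.
  have : (j != (size a).-1 :> nat) by apply/negP=> /eqP Ej; case: nj; apply/eqP/val_inj.
  rewrite neq_ltn => /orP[lj|lj]; first by apply/PZ/PA; rewrite -addnBAC ?(ltnW lj) // -{1}[i]add0n ltn_add2r subn_gt0.
  by exists 0; rewrite [a`_j]nth_default ?scale0r ?comp_poly0 ?mul0r //; apply: leq_trans (leqSpred _) lj.
have : P ((f`_i)^`()).
  have -> : (f`_i)^`() = (lead_coef a)^-1 *: (b * (f`_((size a).-1 + i).+1 *+ ((size a).-1 + i).+1) - S).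
    by rewrite E addrK scalerA mulVf // scale1r.
  have [|G ->] := IH' ((size a).-1 + i).+1; first lia.
  apply/PZ/PD; last by rewrite -scaleN1r; apply/PZ.
  by exists (G *+ ((size a).-1 + i).+1); rewrite mulrC -(rmorphMn (comp_poly k)).
move=> [Q EQ]; have [q dq] := primitive Q.
have : (f`_i - (q \Po k))^`() = 0 by rewrite derivB deriv_comp kb dq EQ subrr.
move/deriv_eq0=> Ec; exists (q + ((f`_i - (q \Po k))`_0)%:P).
by rewrite comp_polyD comp_polyC -Ec addrC subrK.
Qed.

(** By [kernel_coef], f(x, y) = F(x, k(y)), and the equation becomes F_x = h' F_t. So [F] is
    constant along the curves t = c - h(x) and is determined by its values at x = 0. *)
Lemma kernel_additive h k f : h^`() != 0 -> k^`() != 0 ->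
  (k^`())%:P * dX f = map_poly polyC h^`() * dY f ->
  exists g : {poly R}, forall x y, f.[x, y] = g.[h.[x] + k.[y]].
Proof.
move=> h0 k0 K; have [G EG] := boolp.choice (fun i => kernel_coef i erefl h0 K).
pose F : {poly {poly R}} := \poly_(i < size f) G i.
have fF : f = map_poly (comp_poly k) F.
  apply/polyP=> i; rewrite coef_map coef_poly /=; case: ltnP => // fi.
  by rewrite nth_default // comp_poly0.
have dXf : dX f = map_poly (comp_poly k) (dX F) by rewrite fF /dX deriv_map.
have dYf : dY f = map_poly (comp_poly k) (dY F) * (k^`())%:P.
  by apply/polyP=> i; rewrite coef_dY fF coefMC [in LHS]coef_map [in RHS]coef_map /= deriv_comp coef_dY.
have Xh : map_poly polyC h^`() = map_poly (comp_poly k) (map_poly polyC h^`()).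
  by apply/polyP=> i; rewrite !coef_map /= comp_polyC.
have FK : dX F - map_poly polyC h^`() * dY F = 0.
  have k0' : (k^`())%:P != 0 :> {poly {poly R}} by rewrite polyC_eq0.
  have : (k^`())%:P * map_poly (comp_poly k) (dX F - map_poly polyC h^`() * dY F) = 0.
    by rewrite rmorphB rmorphM /= -Xh mulrBr -dXf K dYf; ring.
  move/eqP; rewrite mulf_eq0 (negPf k0') /= => /eqP E.
  apply/polyP=> i; rewrite coef0; apply: (comp_poly_inj0 k0).
  by have := congr1 (fun u : {poly {poly R}} => u`_i) E; rewrite coef_map coef0.
have const c : exists z, forall s, F.[s, c - h.[s]] = z.
  pose w := comp2 'X (c%:P - h) F.
  have /deriv_eq0 Ew : w^`() = 0.
    rewrite /w deriv_comp2 derivX derivB derivC sub0r mulr1 mulrN.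
    have -> : comp2 'X (c%:P - h) (dX F) = comp2 'X (c%:P - h) (map_poly polyC h^`() * dY F).
      by rewrite -(subrK (map_poly polyC h^`() * dY F) (dX F)) FK add0r.
    rewrite rmorphM /=.
    have -> : comp2 'X (c%:P - h) (map_poly polyC h^`()) = h^`().
      by apply: poly_fun_eq => x; rewrite horner_comp2 hornerX hornerXpart.
    by rewrite mulrC subrr.
  exists w`_0 => s; have <- : w.[s] = F.[s, c - h.[s]].
    by rewrite horner_comp2 hornerX hornerD hornerN hornerC.
  by rewrite {1}Ew hornerC.
exists (F.[0] \Po ('X - h.[0]%:P)) => x y.
have [z Ez] := const (h.[x] + k.[y]).
have -> : f.[x, y] = F.[x, k.[y]].
  have -> : f.[x%:P] = F.[x%:P] \Po k by rewrite -horner_map /= comp_polyC fF.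
  by rewrite horner_comp.
have := Ez x; rewrite [h.[x] + _]addrC addrK => ->.
by rewrite horner_comp hornerXsubC -(Ez 0) polyC0 [k.[y] + _]addrC.
Qed.

End KernelForms.

Lemma nat_prod_eq (p q l m : nat) :
  (q * p = l * m -> p <= l -> q <= m -> 0 < l -> 0 < m -> q = m)%N.
Proof. nia. Qed.

Section KernelMultiplicative.
Variable R : realType.
Implicit Types f F : {poly {poly R}}.
Variables a1 a2 b1 b2 : {poly R}.
Hypotheses (a10 : a1 != 0) (a20 : a2 != 0) (b10 : b1 != 0) (b20 : b2 != 0).
Hypotheses (sa : size a1 = (size a2).+1) (sb : size b1 = (size b2).+1).

Let rho := lead_coef a1 / lead_coef a2.

Lemma in_kernelC c : in_kernel a1 a2 b1 b2 c%:P%:P.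
Proof. by rewrite /in_kernel dXC dYC derivC !mulr0. Qed.

Lemma in_kernelB f F : in_kernel a1 a2 b1 b2 f -> in_kernel a1 a2 b1 b2 F ->
  in_kernel a1 a2 b1 b2 (f - F).
Proof. by rewrite /in_kernel dXB dYB !mulrBr => -> ->. Qed.

Lemma in_kernelM f F : in_kernel a1 a2 b1 b2 f -> in_kernel a1 a2 b1 b2 F ->
  in_kernel a1 a2 b1 b2 (f * F).
Proof.
rewrite /in_kernel dXM dYM !mulrDr [_ * (f * dX F)]mulrCA [_ * (f * dY F)]mulrCA => Kf ->.
by rewrite !mulrA Kf.
Qed.

Lemma in_kernelX f u : in_kernel a1 a2 b1 b2 f -> in_kernel a1 a2 b1 b2 (f ^+ u).
Proof.
move=> Kf; elim: u => [|u IH]; first by rewrite expr0 -!polyC1; apply: in_kernelC.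
by rewrite exprS; apply: in_kernelM.
Qed.

Lemma ndvd_size (a b : {poly R}) : b != 0 -> size a = (size b).+1 -> ~ a %| b.
Proof. by move=> b0 sab /(dvdp_leq b0); rewrite sab ltnn. Qed.

(** The leading coefficients in both variables are eigenvectors, and [eig_degree] ties their degrees
    dq, dp to the eigenvalues. This gives dq dp = deg_x f deg_y f; as dq <= deg_x f and dp <= deg_y
    f, both are equalities, and the two eigenvalues coincide. *)
Lemma kernel_leads f : in_kernel a1 a2 b1 b2 f -> dX f != 0 ->
  [/\ (1 < size f)%N, eig b1 b2 (rho *+ (size f).-1) (lead_coef f) &
    exists q : {poly R}, q != 0 /\ eig a1 a2 (rho *+ (size f).-1) q].
Proof.
move=> K dx0; have [sf _ _] := dX_lead dx0.
have [[_ ep]|/(ndvd_size b20 sb)//] := kernel_lead a10 a20 b10 b20 K dx0.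
split=> //; have dy0 : dX (swapXY f) != 0.
  by rewrite dX_swap swapXY_eq0 -(kernel_dX0 a10 a20 b10 b20 K).
have K' := in_kernel_swap K; have [sf' _ _] := dX_lead dy0.
have [[_ eq]|/(ndvd_size a20 sa)//] := kernel_lead b10 b20 a10 a20 K' dy0.
have p0 : lead_coef f != 0 by rewrite lead_coef_eq0; apply: contraNneq dx0 => ->; rewrite /dX deriv0.
have q0 : lead_coef (swapXY f) != 0.
  by rewrite lead_coef_eq0; apply: contraNneq dy0 => ->; rewrite /dX deriv0.
exists (lead_coef (swapXY f)); split=> //.
have sp : (size (lead_coef f) <= size (swapXY f))%N by rewrite -sizeYE max_size_coefXY.
have sq : (size (lead_coef (swapXY f)) <= size f)%N.
  by rewrite -{2}(swapXYK f) -sizeYE max_size_coefXY.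
have := eig_degree b10 b20 sb p0 ep; have := eig_degree a10 a20 sa q0 eq.
have la1 : lead_coef a1 != 0 by rewrite lead_coef_eq0.
have la2 : lead_coef a2 != 0 by rewrite lead_coef_eq0.
have lb1 : lead_coef b1 != 0 by rewrite lead_coef_eq0.
have lb2 : lead_coef b2 != 0 by rewrite lead_coef_eq0.
set dq := (size (lead_coef (swapXY f))).-1; set dp := (size (lead_coef f)).-1.
set sg := lead_coef b1 / lead_coef b2 in eq *.
rewrite -/rho => Eq Ep.
have Eq' : rho * dq%:R = sg * (size (swapXY f)).-1%:R.
  by apply: (mulIf la2); rewrite [_ * dq%:R]mulr_natr mulrnAl divfK // Eq mulr_natr.
have Ep' : sg * dp%:R = rho * (size f).-1%:R.
  by apply: (mulIf lb2); rewrite [_ * dp%:R]mulr_natr mulrnAl divfK // Ep mulr_natr.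
have rho0 : rho != 0 by rewrite mulf_neq0 // invr_eq0.
have sg0 : sg != 0 by rewrite mulf_neq0 // invr_eq0.
have E : (dq * dp = (size (swapXY f)).-1 * (size f).-1)%N.
  apply/eqP; rewrite -(eqr_nat R) !natrM; apply/eqP.
  apply: (mulfI (mulf_neq0 rho0 sg0)).
  have -> : rho * sg * (dq%:R * dp%:R) = (rho * dq%:R) * (sg * dp%:R) by ring.
  by rewrite Eq' Ep'; ring.
have Edq : dq = (size f).-1.
  have P i j : (i <= j -> i.-1 <= j.-1)%N by move=> ij; rewrite -!subn1 leq_sub2r.
  have Q i : (1 < i -> 0 < i.-1)%N by case: i => [|[]].
  exact: nat_prod_eq E (P _ _ sp) (P _ _ sq) (Q _ sf') (Q _ sf).
by rewrite /eig -mulr_natr -Edq Eq' mulr_natr.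
Qed.

(** Let [g] be the least positive exponent for which both variables have eigenvectors [h], [k] with
    eigenvalue [rho *+ g]. By [eig_split], a remainder of the degree of a solution modulo [g] would
    be a smaller exponent, so the leading coefficient is a multiple of a power of [k]. Subtracting a
    multiple of a power of h(x) k(y) lowers the degree. *)
Lemma kernel_multiplicative : exists (h k : {poly R}) (lam : R),
  [/\ h != 0, k != 0, eig b1 b2 lam k &
    forall f, in_kernel a1 a2 b1 b2 f -> exists g : {poly R}, forall x y, f.[x, y] = g.[h.[x] * k.[y]]].
Proof.
pose S j := `[< (0 < j)%N /\ (exists h k : {poly R}, [/\ h != 0, k != 0,
   eig a1 a2 (rho *+ j) h & eig b1 b2 (rho *+ j) k]) >].
have inS f : in_kernel a1 a2 b1 b2 f -> dX f != 0 -> S (size f).-1.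
  move=> K d0; have [sf ep [q [q0 eq]]] := kernel_leads K d0.
  apply/asboolP; split; first by case: (size f) sf => [|[]].
  exists q, (lead_coef f); split=> //.
  by rewrite lead_coef_eq0; apply: contraNneq d0 => ->; rewrite /dX deriv0.
have [exS|nS] := pselect (exists j, S j); last first.
  (* Without such an exponent all solutions are constants. *)
  exists 1, 1, 0; split; rewrite ?oner_neq0 //; first by rewrite /eig scale0r -polyC1 derivC mulr0.
  move=> f K; have d0 : dX f = 0.
    by apply/eqP/negPn/negP=> d0; apply: nS; exists (size f).-1; apply: inS.
  by have [c ->] := kernel_const a10 a20 b10 b20 K d0; exists c%:P => x y; rewrite !hornerC.
have [g Sg ming] := ex_minnP exS.
move/asboolP: (Sg) => [g0 [h [k [h0 k0 eh ek]]]].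
exists h, k, (rho *+ g); split=> // f; have [n] := ubnP (size f).
have la1 : lead_coef a1 != 0 by rewrite lead_coef_eq0.
have la2 : lead_coef a2 != 0 by rewrite lead_coef_eq0.
have sh : (size h).-1 = g.
  have := eig_degree a10 a20 sa h0 eh; rewrite mulrnAl /rho divfK // -[LHS]mulr_natr -[RHS]mulr_natr.
  by move/(mulfI la1)/eqP; rewrite eqr_nat => /eqP.
elim: n f => // n IH f sfn K.
have [d0|d0] := eqVneq (dX f) 0.
  by have [c ->] := kernel_const a10 a20 b10 b20 K d0; exists c%:P => x y; rewrite !hornerC.
have [sf ep [q [q0 eq]]] := kernel_leads K d0.
have lf0 : lead_coef f != 0.
  by rewrite lead_coef_eq0; apply: contraNneq d0 => ->; rewrite /dX deriv0.
pose m := (size f).-1; rewrite -/m in ep eq.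
have Em := divn_eq m g; rewrite mulnC in Em.
rewrite Em in ep eq.
have [e [e0 ee Ee]] := eig_split b10 k0 lf0 g0 ek ep.
have [e' [e'0 ee' _]] := eig_split a10 h0 q0 g0 eh eq.
have r0 : (m %% g = 0)%N.
  apply/eqP/negPn/negP; rewrite -lt0n => r0.
  have /ming : S (m %% g)%N by apply/asboolP; split=> //; exists e', e.
  by rewrite leqNgt ltn_mod g0.
rewrite r0 mulr0n in ee.
have [c Ec] := eig0_const b10 ee.
pose u := (m %/ g)%N; rewrite -/u in Ee.
pose w : {poly {poly R}} := map_poly polyC h * k%:P.
pose c' := c / lead_coef h ^+ u.
have Kw : in_kernel a1 a2 b1 b2 w.
  rewrite /in_kernel /w dXM dYM dX_Xpart dY_Xpart dXC dYC mulr0 addr0 mul0r add0r.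
  have -> : map_poly polyC a1 * b2%:P * (map_poly polyC h^`() * k%:P) =
    map_poly polyC (a1 * h^`()) * (b2 * k)%:P :> {poly {poly R}} by rewrite rmorphM polyCM /=; ring.
  have -> : map_poly polyC a2 * b1%:P * (map_poly polyC h * (k^`())%:P) =
    map_poly polyC (a2 * h) * (b1 * k^`())%:P :> {poly {poly R}} by rewrite rmorphM polyCM /=; ring.
  rewrite eh ek -!mul_polyC !polyCM !rmorphM /= map_polyC /=; ring.
pose f' := f - c'%:P%:P * w ^+ u.
have Kf' : in_kernel a1 a2 b1 b2 f'.
  by apply: in_kernelB K _; apply: in_kernelM (in_kernelC _) (in_kernelX u Kw).
have lh : lead_coef h ^+ u != 0 by rewrite expf_neq0 // lead_coef_eq0.
have mu : m = (g * u)%N by rewrite Em r0 addn0.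
have shu : size (h ^+ u) = m.+1.
  by rewrite -[LHS]prednK ?size_poly_gt0 ?expf_neq0 // size_exp sh mu.
have wu j : (w ^+ u)`_j = ((h ^+ u)`_j)%:P * k ^+ u.
  by rewrite exprMn_comm; [rewrite -rmorphXn -rmorphXn coefMC coef_map | exact: mulrC].
have sf' : (size f' < n)%N.
  suff: (size f' <= m)%N by rewrite /m; case: (size f) sf sfn => // s _; rewrite ltnS => sn le; apply: leq_ltn_trans le sn.
  apply/leq_sizeP => j; rewrite leq_eqVlt /f' coefB coefCM wu => /orP[/eqP <-|mj].
    have -> : (h ^+ u)`_m = lead_coef h ^+ u by rewrite -lead_coef_exp lead_coefE shu.
    have -> : f`_m = lead_coef f by [].
    rewrite Ee Ec mulrA -polyCM /c' divfK //.
    by rewrite subrr.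
  rewrite [f`_j]nth_default; last by move: mj; rewrite /m; case: (size f).
  by rewrite [(h ^+ u)`_j]nth_default ?shu // mul0r mulr0 subrr.
have [g' Eg'] := IH f' sf' Kf'.
exists (g' + c' *: 'X^u) => x y.
have Ew : w.[x, y] = h.[x] * k.[y] by rewrite /w 2!hornerM hornerXpart hornerC.
have -> : f = f' + c'%:P%:P * w ^+ u by rewrite subrK.
clearbody f' w.
by rewrite 3!hornerD Eg' hornerZ hornerXn 2!hornerM 2!hornerC 2!horner_exp Ew.
Qed.
End KernelMultiplicative.

Section SpecialForms.
Variable R : realType.
Implicit Types f F : {poly {poly R}}.
Implicit Types a b h k p q : {poly R}.

Lemma dvdp_neq0 a b : b != 0 -> a %| b -> exists2 c, c != 0 & b = c * a.
Proof. by move=> b0 /dvdpP[c E]; exists c => //; apply: contraNneq b0 => c0; rewrite E c0 mul0r. Qed.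

Lemma primitive_neq0 p : p != 0 -> exists2 q, q^`() = p & q^`() != 0.
Proof. by move=> p0; have [q Eq] := primitive p; exists q; rewrite ?Eq. Qed.

Lemma in_kernel_cancel a1 b1 a b f : a1 != 0 -> b1 != 0 ->
  in_kernel a1 (a * a1) b1 (b * b1) f -> b%:P * dX f = map_poly polyC a * dY f.
Proof.
move=> a10 b10; rewrite /in_kernel !rmorphM /= => K.
have X0 : map_poly polyC a1 != 0 :> {poly {poly R}} by rewrite -size_poly_gt0 size_Xpart size_poly_gt0.
apply: (mulfI (mulf_neq0 X0 (_ : b1%:P != 0))); first by rewrite polyC_eq0.
transitivity (map_poly polyC a1 * (b%:P * b1%:P) * dX f); first by ring.
by rewrite K; ring.
Qed.

(** One pair [h], [k] serves all solutions; this lets the coefficients of a polynomial in three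
    variables be treated together. *)
Lemma kernel_forms a1 a2 b1 b2 : a1 != 0 -> a2 != 0 -> b1 != 0 -> b2 != 0 ->
  exists h k,
    (forall f, in_kernel a1 a2 b1 b2 f ->
       exists g : {poly R}, forall x y, f.[x, y] = g.[h.[x] + k.[y]]) \/
    (forall f, in_kernel a1 a2 b1 b2 f ->
       exists g : {poly R}, forall x y, f.[x, y] = g.[h.[x] * k.[y]]).
Proof.
move=> a10 a20 b10 b20.
have [[f0 [K0 d0]]|nf] := pselect (exists f, in_kernel a1 a2 b1 b2 f /\ dX f != 0); last first.
  exists 0, 0; left=> f K; have [|c ->] := kernel_const a10 a20 b10 b20 K.
    by apply/eqP/negPn/negP=> d0; apply: nf; exists f.
  by exists c%:P => x y; rewrite !hornerC.
have dy0 : dX (swapXY f0) != 0.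
  by rewrite dX_swap swapXY_eq0 -(kernel_dX0 a10 a20 b10 b20 K0).
case: (kernel_lead a10 a20 b10 b20 K0 d0) => [[sa _]|db];
  case: (kernel_lead b10 b20 a10 a20 (in_kernel_swap K0) dy0) => [[sb _]|da].
- have [h [k [lam [_ _ _ H]]]] := kernel_multiplicative a10 a20 b10 b20 sa sb.
  by exists h, k; right.
- by case: (ndvd_size a20 sa).
- by case: (ndvd_size b20 sb).
have [a an0 Ea] := dvdp_neq0 a20 da; have [b bn0 Eb] := dvdp_neq0 b20 db.
have [h Eh h0] := primitive_neq0 an0; have [k Ek k0] := primitive_neq0 bn0.
exists h, k; left=> f K; apply: (kernel_additive h0 k0); rewrite Eh Ek.
by apply: (in_kernel_cancel a10 b10); rewrite -Ea -Eb.
Qed.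

(** The additive case with the second variable already straightened: for [b1 = b2 = 1] degrees rule
    out the multiplicative alternative. *)
Lemma translation_form a1 a2 F : a1 != 0 -> a2 != 0 ->
  map_poly polyC a1 * dX F = map_poly polyC a2 * dY F ->
  exists l g : {poly R}, forall z t, F.[z, t] = g.[l.[z] + t].
Proof.
move=> a10 a20 E; have K : in_kernel a1 a2 1 1 F by rewrite /in_kernel !polyC1 !mulr1.
have one0 : (1 : {poly R}) != 0 := oner_neq0 _.
have [d0|d0] := eqVneq (dX F) 0.
  have [c ->] := kernel_const a10 a20 one0 one0 K d0.
  by exists 0, c%:P => z t; rewrite !hornerC.
have dy0 : dX (swapXY F) != 0.
  by rewrite dX_swap swapXY_eq0 -(kernel_dX0 a10 a20 one0 one0 K).
case: (kernel_lead one0 one0 a10 a20 (in_kernel_swap K) dy0) => [[]|da].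
  by rewrite size_poly1.
have [a an0 Ea] := dvdp_neq0 a20 da; have [l El l0] := primitive_neq0 an0.
have X0 : ('X : {poly R})^`() != 0 by rewrite derivX.
have [|g Eg] := kernel_additive (f := F) l0 X0; last by exists l, g => z t; rewrite Eg hornerX.
by rewrite derivX El; apply: (in_kernel_cancel a10 one0); rewrite -Ea mulr1.
Qed.

(** For the Euler derivation each nonzero coefficient forces its exponent to equal [lam]. *)
Lemma eigX lam k : k != 0 -> eig 'X 1 lam k -> exists (c : R) j, k = c *: 'X^j.
Proof.
move=> k0 E; have co i : k`_i *+ i = lam * k`_i.
  have := congr1 (fun p : {poly R} => p`_i) E; rewrite mul1r coefXM coefZ coef_deriv => <-.
  by case: i.
pose j := (size k).-1; exists (lead_coef k), j; apply/polyP=> i.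
rewrite coefZ coefXn; have [->|ij] := eqVneq i j; first by rewrite mulr1.
rewrite mulr0; apply/eqP/negPn/negP=> ki.
have lk : k`_j != 0 by rewrite -lead_coefE lead_coef_eq0.
have := co j; rewrite -mulr_natl => /(mulIf lk) Ej; have := co i; rewrite -mulr_natl => /(mulIf ki).
by rewrite -Ej => /eqP; rewrite eqr_nat (negPf ij).
Qed.

Lemma dilation_form a1 a2 F : a1 != 0 -> a2 != 0 ->
  map_poly polyC a1 * dX F = map_poly polyC a2 * 'X%:P * dY F ->
  exists (l g : {poly R}) j, forall z t, F.[z, t] = g.[l.[z] * t ^+ j].
Proof.
move=> a10 a20 E; have K : in_kernel a1 a2 'X 1 F by rewrite /in_kernel polyC1 mulr1.
have one0 : (1 : {poly R}) != 0 := oner_neq0 _.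
have X0 : ('X : {poly R}) != 0 by rewrite polyX_eq0.
have [d0|d0] := eqVneq (dX F) 0.
  have [c ->] := kernel_const a10 a20 X0 one0 K d0.
  by exists 0, c%:P, 0%N => z t; rewrite !hornerC.
case: (kernel_lead a10 a20 X0 one0 K d0) => [[sa _]|]; last first.
  by move=> /(dvdp_leq one0); rewrite size_polyX size_poly1.
have sX : size ('X : {poly R}) = (size (1 : {poly R})).+1 by rewrite size_polyX size_poly1.
have [h [k [lam [_ k0 ek /(_ _ K)[g Eg]]]]] := kernel_multiplicative a10 a20 X0 one0 sa sX.
have [c [j Ek]] := eigX k0 ek; exists (c *: h), g, j => z t.
by rewrite Eg Ek !hornerZ hornerXn; congr (g.[_]); ring.
Qed.

Lemma deriv_colE f x : (f.[x%:P])^`() = (dY f).[x%:P].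
Proof. by apply: poly_fun_eq => y; rewrite deriv_col. Qed.

Lemma deriv_rowE f y : ((swapXY f).[y%:P])^`() = (swapXY (dX f)).[y%:P].
Proof. by apply: poly_fun_eq => x; rewrite deriv_slice horner2_swapXY. Qed.

Lemma wronskian_cross p q : p^`() * q = p * q^`() ->
  forall x y, p.[x] * q.[y] = p.[y] * q.[x].
Proof.
move=> W x y; have [->|q0] := eqVneq q 0; first by rewrite !hornerC !mulr0.
by have [c ->] := wronskian q0 W; rewrite !hornerZ; ring.
Qed.

(** The Jacobian of f_xy / (f_x f_y) with [f] is the mixed second derivative of log(f_x / f_y). Its
    vanishing, integrated twice by [wronskian_cross], splits f_x / f_y into a factor in x and a
    factor in y, which is the equation of [kernel_forms]. *)
Lemma bivariate_special f : ~~ nonspecial f -> dX f != 0 -> dY f != 0 ->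
  exists g h k, (forall x y, f.[x, y] = g.[h.[x] + k.[y]]) \/
                (forall x y, f.[x, y] = g.[h.[x] * k.[y]]).
Proof.
rewrite negbK /nonspecial => /eqP; set u := dX f; set v := dY f; set n := dX v => E u0 v0.
have vx : dX v = n by []; have uy : dY u = n by rewrite /u -dXY_comm.
(* [N / (u * v)] is the x-derivative of log(u / v); [NW] says that it does not depend on y. *)
pose N := dX u * v - u * n.
have NW : dY N * (u * v) = N * dY (u * v).
  move: E; rewrite /jac /N dXM dYM dYB !dYM vx uy -/u -/v -dXY_comm uy => E.
  apply/eqP; rewrite -subr_eq0; apply/eqP.
  transitivity (u * v * (dX n * v - dY n * u) - n * ((dX u * v + u * n) * v - (n * v + u * dY v) * u)); first by ring.
  by rewrite E subrr.
have [x0 [y0 uv0]] := nonroot2 (mulf_neq0 u0 v0).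
have cross x y : N.[x, y] * (u * v).[x, y0] = N.[x, y0] * (u * v).[x, y].
  by apply: wronskian_cross; rewrite !deriv_colE -!hornerM NW.
have Nv x y : N.[x, y] = (dX u).[x, y] * v.[x, y] - u.[x, y] * n.[x, y].
  by rewrite /N !hornerD !hornerN !hornerM.
have mv x y : (u * v).[x, y] = u.[x, y] * v.[x, y] by rewrite !hornerM.
have cross2 x y : u.[x, y] * v.[x, y0] * (v.[x0, y] * u.[x0, y0]) =
    u.[x0, y] * v.[x0, y0] * (v.[x, y] * u.[x, y0]).
  have := @wronskian_cross ((swapXY u).[y%:P] * (swapXY v).[y0%:P])
    ((swapXY v).[y%:P] * (swapXY u).[y0%:P]).
  rewrite !derivM !deriv_rowE => /(_ _ x x0); rewrite !hornerM !horner2_swapXY; apply.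
  apply: poly_fun_eq => s; rewrite !(hornerM, hornerD) !horner2_swapXY vx.
  have := cross s y; rewrite !mv !Nv => C.
  apply/eqP; rewrite -subr_eq0; apply/eqP.
  transitivity (((dX u).[s, y] * v.[s, y] - u.[s, y] * n.[s, y]) * (u.[s, y0] * v.[s, y0]) -
    ((dX u).[s, y0] * v.[s, y0] - u.[s, y0] * n.[s, y0]) * (u.[s, y] * v.[s, y])); first by ring.
  by rewrite C subrr.
pose a1 := (swapXY v).[y0%:P]; pose a2 := (swapXY u).[y0%:P].
pose b1 := v.[x0, y0] *: u.[x0%:P]; pose b2 := u.[x0, y0] *: v.[x0%:P].
move: uv0; rewrite mv mulf_eq0 negb_or => /andP[u00 v00].
have nz (p : {poly R}) t : p.[t] != 0 -> p != 0 by apply: contraNneq => ->; rewrite hornerC.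
have a10 : a1 != 0 by apply: (nz _ x0); rewrite horner2_swapXY.
have a20 : a2 != 0 by apply: (nz _ x0); rewrite horner2_swapXY.
have b10 : b1 != 0 by apply: (nz _ y0); rewrite hornerZ mulf_neq0.
have b20 : b2 != 0 by apply: (nz _ y0); rewrite hornerZ mulf_neq0.
have K : in_kernel a1 a2 b1 b2 f.
  apply: poly2_fun_eq => x y; rewrite /in_kernel !hornerM !hornerXpart !hornerYpart !hornerZ.
  rewrite !horner2_swapXY -/u -/v; have := cross2 x y => C.
  transitivity (u.[x, y] * v.[x, y0] * (v.[x0, y] * u.[x0, y0])); first by ring.
  by rewrite C; ring.
have [h [k [H|H]]] := kernel_forms a10 a20 b10 b20; have [g Eg] := H f K.
  by exists g, h, k; left.
by exists g, h, k; right.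
Qed.
End SpecialForms.

(** * The trivariate equations *)

Section Trivariate.
Variable R : realType.
Implicit Types f F : {poly {poly R}}.
Implicit Types a b h k p q : {poly R}.
Implicit Types T U : {poly {poly {poly R}}}.

Definition eval2 (x y : R) : {poly {poly R}} -> R := horner_eval y \o horner_eval x%:P.

Definition zslice T (c : R) : {poly {poly R}} := T.[c%:P%:P].
Definition zcol T (x y : R) : {poly R} := map_poly (eval2 x y) T.

Lemma eval2E x y f : eval2 x y f = f.[x, y]. Proof. by []. Qed.

Lemma horner_zcol T x y c : (zcol T x y).[c] = (zslice T c).[x, y].
Proof.
have -> : c = eval2 x y c%:P%:P by rewrite eval2E !hornerC.
by rewrite /zcol horner_map /= eval2E !hornerC.
Qed.

Lemma poly3_fun0 T : (forall x y z, (zslice T z).[x, y] = 0) -> T = 0.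
Proof.
move=> T0; apply/polyP=> i; rewrite coef0; apply: poly2_fun0 => x y.
have : zcol T x y = 0 by apply: poly_fun0 => z; rewrite horner_zcol.
by move/(congr1 (fun p : {poly R} => p`_i)); rewrite coef_map coef0.
Qed.

Lemma nonroot3 T : T != 0 -> exists x y z, (zslice T z).[x, y] != 0.
Proof.
move=> T0; have [//|nE] := pselect (exists x y z, (zslice T z).[x, y] != 0).
move/eqP: T0 => []; apply: poly3_fun0 => x y z; apply/eqP/negPn/negP=> H.
by apply: nE; exists x, y, z.
Qed.

Lemma zslice_map (D : {poly {poly R}} -> {poly {poly R}}) T c : D 0 = 0 ->
  (forall f F, D (f + F) = D f + D F) -> (forall f (t : R), D (f * t%:P%:P) = D f * t%:P%:P) ->
  zslice (map_poly D T) c = D (zslice T c).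
Proof.
move=> D0 DD DC; rewrite /zslice (horner_coef_wide _ (size_poly _ _)) horner_coef (big_morph D DD D0).
by apply: eq_bigr => i _; rewrite coef_map_id0 // -!rmorphXn /= DC.
Qed.

Lemma zslice_dX T c : zslice (map_poly (@dX R) T) c = dX (zslice T c).
Proof.
apply: zslice_map => [|f F|f t]; rewrite ?dXD // ?dXM ?dXC ?mulr0 ?addr0 //.
Qed.

Lemma zslice_dY T c : zslice (map_poly (@dY R) T) c = dY (zslice T c).
Proof.
apply: zslice_map => [|f F|f t]; rewrite ?dYD // ?dYM ?dYC ?derivC ?polyC0 ?mulr0 ?addr0 //.
Qed.

Lemma zcol_deriv T x y c : (zcol T x y)^`().[c] = (zslice T^`() c).[x, y].
Proof. by rewrite /zcol deriv_map horner_zcol. Qed.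

Lemma zsliceM T U c : zslice (T * U) c = zslice T c * zslice U c.
Proof. exact: hornerM. Qed.

(* The three families of slices of one function of three variables, in cyclic order. *)
Variables (T : {poly {poly {poly R}}}) (Fx Fy : R -> {poly {poly R}}).
Let Fz := zslice T.
Hypothesis Fxz : forall x y z, (Fx x).[y, z] = (Fz z).[x, y].
Hypothesis Fyz : forall x y z, (Fy y).[z, x] = (Fz z).[x, y].
Let D1 x y z := (dX (Fz z)).[x, y].
Let D2 x y z := (dY (Fz z)).[x, y].
Let D3 x y z := (zslice T^`() z).[x, y].

Let D1y x y z : (dY (Fy y)).[z, x] = D1 x y z.
Proof.
rewrite /D1 -deriv_col -deriv_slice; congr (_^`().[_]); apply: poly_fun_eq => s.
by rewrite horner2_swapXY Fyz.
Qed.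

Let D2x x y z : (dX (Fx x)).[y, z] = D2 x y z.
Proof.
rewrite /D2 -deriv_col -deriv_slice; congr (_^`().[_]); apply: poly_fun_eq => s.
by rewrite horner2_swapXY Fxz.
Qed.

Let D3x x y z : (dY (Fx x)).[y, z] = D3 x y z.
Proof.
rewrite /D3 -zcol_deriv -deriv_col; congr (_^`().[_]); apply: poly_fun_eq => s.
by rewrite horner_zcol Fxz.
Qed.

Let D3y x y z : (dX (Fy y)).[z, x] = D3 x y z.
Proof.
rewrite /D3 -zcol_deriv -deriv_slice; congr (_^`().[_]); apply: poly_fun_eq => s.
by rewrite horner2_swapXY horner_zcol Fyz.
Qed.

Hypothesis Jz : forall c c', jac (Fz c) (Fz c') = 0.
Hypothesis Jx : forall c c', jac (Fx c) (Fx c') = 0.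
Hypothesis Jy : forall c c', jac (Fy c) (Fy c') = 0.

Let jac_cross F F' x y : jac F F' = 0 -> (dX F).[x, y] * (dY F').[x, y] = (dY F).[x, y] * (dX F').[x, y].
Proof.
move=> J; apply/eqP; rewrite -subr_eq0 -!hornerM -hornerN -hornerD -hornerN -hornerD.
by rewrite [X in X.[x%:P]](_ : _ = jac F F') ?J ?horner0.
Qed.

Hypothesis D10 : exists x y z, D1 x y z != 0.
Hypothesis D20 : exists x y z, D2 x y z != 0.
Hypothesis D30 : exists x y z, D3 x y z != 0.

Lemma base_point : exists x y z, [/\ D1 x y z != 0, D2 x y z != 0 & D3 x y z != 0].
Proof.
have nz U : (exists x y z, (zslice U z).[x, y] != 0) -> U != 0.
  by move=> [x [y [z H]]]; apply: contraNneq H => ->; rewrite /zslice !horner0.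
have T1 : map_poly (@dX R) T != 0.
  by apply: nz; have [x [y [z H]]] := D10; exists x, y, z; rewrite zslice_dX.
have T2 : map_poly (@dY R) T != 0.
  by apply: nz; have [x [y [z H]]] := D20; exists x, y, z; rewrite zslice_dY.
have [x [y [z]]] := nonroot3 (mulf_neq0 (mulf_neq0 T1 T2) (nz _ D30)).
rewrite !zsliceM zslice_dX zslice_dY !hornerM !mulf_eq0 !negb_or => /andP[/andP[? ?] ?].
by exists x, y, z.
Qed.

Let crossz x y z z' : D1 x y z * D2 x y z' = D2 x y z * D1 x y z'.
Proof. exact: jac_cross. Qed.
Let crossx x x' y z : D2 x y z * D3 x' y z = D3 x y z * D2 x' y z.
Proof. by rewrite -!D2x -!D3x jac_cross. Qed.
Let crossy x y y' z : D3 x y z * D1 x y' z = D1 x y z * D3 x y' z.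
Proof. by rewrite -!D1y -!D3y jac_cross. Qed.

(** D1 / D2 is independent of z, D2 / D3 of x, and D3 / D1 of y. So D1 / D2 at (x, y, z) is D1 / D3
    at (x, y0, z0) times D3 / D2 at (x0, y, z0). These factors do not involve z, and the equation
    passes to each coefficient of [T]. *)
Lemma slices_in_kernel x0 y0 z0 : D2 x0 y0 z0 != 0 -> D3 x0 y0 z0 != 0 -> forall i,
  in_kernel (dX (Fy y0)).[z0%:P] (dY (Fy y0)).[z0%:P]
    (swapXY (dY (Fx x0))).[z0%:P] (dY (Fz z0)).[x0%:P] T`_i.
Proof.
move=> d2 d3 i; set a1 := (dX (Fy y0)).[z0%:P]; set a2 := (dY (Fy y0)).[z0%:P].
set b1 := (swapXY (dY (Fx x0))).[z0%:P]; set b2 := (dY (Fz z0)).[x0%:P].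
have a1E x : a1.[x] = D3 x y0 z0 by rewrite /a1 D3y.
have a2E x : a2.[x] = D1 x y0 z0 by rewrite /a2 D1y.
have b1E y : b1.[y] = D3 x0 y z0 by rewrite /b1 horner2_swapXY D3x.
have b2E y : b2.[y] = D2 x0 y z0 by [].
pose U := (map_poly polyC a1 * b2%:P)%:P * map_poly (@dX R) T -
  (map_poly polyC a2 * b1%:P)%:P * map_poly (@dY R) T.
have U0 : U = 0.
  apply: poly3_fun0 => x y z.
  (* Multiplication by this nonzero polynomial replaces the divisions by D2 and D3. *)
  pose W := dY (Fz z0) * zslice T^`() z0.
  have W0 : W != 0.
    apply: contraTneq isT => W0; have := congr1 (fun f => f.[x0, y0]) W0.
    by rewrite !hornerM !horner0 => /eqP; rewrite mulf_eq0 (negPf d2) (negPf d3).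
  have : zslice U z * W = 0.
    apply: poly2_fun_eq => {x y} x y; rewrite !horner0 2!hornerM.
    have -> : (zslice U z).[x, y] = a1.[x] * b2.[y] * D1 x y z - a2.[x] * b1.[y] * D2 x y z.
      rewrite /U /zslice hornerD hornerN 2!hornerM 2!(hornerC (_ * _)) -!/(zslice _ _) zslice_dX zslice_dY.
      by rewrite 2!hornerD 2!hornerN 8!hornerM !hornerXpart !hornerYpart.
    have -> : W.[x, y] = D2 x y z0 * D3 x y z0 by rewrite 2!hornerM.
    rewrite a1E a2E b1E b2E.
    transitivity (D3 x y0 z0 * D2 x0 y z0 * (D1 x y z * D2 x y z0) * D3 x y z0 -
      D1 x y0 z0 * D3 x0 y z0 * D2 x y z * (D2 x y z0 * D3 x y z0)); first by ring.
    rewrite crossz; transitivity ((D3 x y0 z0 * D1 x y z0) * D2 x y z * (D2 x0 y z0 * D3 x y z0) -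
      D1 x y0 z0 * D3 x0 y z0 * D2 x y z * (D2 x y z0 * D3 x y z0)); first by ring.
    by rewrite crossy crossx; ring.
  by move/eqP; rewrite mulf_eq0 (negPf W0) orbF => /eqP ->; rewrite !horner0.
have := congr1 (fun V : {poly {poly {poly R}}} => V`_i) U0.
rewrite /U coefB !coefCM coef0 => /eqP; rewrite subr_eq0 => /eqP.
by rewrite !coef_map_id0 ?/dX ?/dY ?deriv0 ?map_poly0.
Qed.

Lemma factor_slices (t : R -> R -> R) : (forall i, exists g : {poly R}, forall x y, (T`_i).[x, y] = g.[t x y]) ->
  exists F : {poly {poly R}}, forall x y, zcol T x y = (swapXY F).[(t x y)%:P].
Proof.
move=> /choice[G EG]; exists (\poly_(i < size T) G i) => x y; apply/polyP=> i.
rewrite horner_swapXY !coef_map /= coef_poly /eval2 /= /horner_eval EG; case: ltnP => // Ti.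
by rewrite horner0 -EG nth_default // !horner0.
Qed.

(** All coefficients in z share [h] and [k], so f = F(z, t) with t = h(x) + k(y) or t = h(x) k(y).
    The independence of D2 / D3 from x then becomes an equation between F_z and F_t, solved by
    [translation_form] or [dilation_form]. *)
Lemma trivariate_special : exists g h k l : {poly R},
  (forall x y z, (Fz z).[x, y] = g.[h.[x] + k.[y] + l.[z]]) \/
  (forall x y z, (Fz z).[x, y] = g.[h.[x] * k.[y] * l.[z]]).
Proof.
have [x0 [y0 [z0 [d1 d2 d3]]]] := base_point.
have K := slices_in_kernel d2 d3.
set a1 := (dX (Fy y0)).[z0%:P] in K; set a2 := (dY (Fy y0)).[z0%:P] in K.
set b1 := (swapXY (dY (Fx x0))).[z0%:P] in K; set b2 := (dY (Fz z0)).[x0%:P] in K.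
have nz (p : {poly R}) s : p.[s] != 0 -> p != 0 by apply: contraNneq => ->; rewrite hornerC.
have a10 : a1 != 0 by apply: (nz _ x0); rewrite /a1 D3y.
have a20 : a2 != 0 by apply: (nz _ x0); rewrite /a2 D1y.
have b10 : b1 != 0 by apply: (nz _ y0); rewrite /b1 horner2_swapXY D3x.
have b20 : b2 != 0 by apply: (nz _ y0); rewrite /b2.
pose A1 := (dX (Fx x0)).[y0%:P]; pose A2 := (zcol T x0 y0)^`().
have A1E z : A1.[z] = D2 x0 y0 z by rewrite /A1 D2x.
have A2E z : A2.[z] = D3 x0 y0 z by rewrite /A2 zcol_deriv.
have A10 : A1 != 0 by apply: (nz _ z0); rewrite A1E.
have A20 : A2 != 0 by apply: (nz _ z0); rewrite A2E.
have [h [k [H|H]]] := kernel_forms a10 a20 b10 b20.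
  have [|F EF] := @factor_slices (fun x y => h.[x] + k.[y]); first by move=> i; apply: H.
  have f3 x y z : (Fz z).[x, y] = F.[z, h.[x] + k.[y]] by rewrite -horner_zcol EF horner2_swapXY.
  have E1 x y z : D1 x y z = (dY F).[z, h.[x] + k.[y]] * h^`().[x].
    rewrite /D1 -[LHS]deriv_slice.
    have -> : (swapXY (Fz z)).[y%:P] = F.[z%:P] \Po (h + k.[y]%:P).
      by apply: poly_fun_eq => s; rewrite horner2_swapXY f3 horner_comp hornerD hornerC.
    by rewrite deriv_comp hornerM horner_comp derivD derivC addr0 hornerD hornerC deriv_col.
  have E2 x y z : D2 x y z = (dY F).[z, h.[x] + k.[y]] * k^`().[y].
    rewrite /D2 -[LHS]deriv_col.
    have -> : (Fz z).[x%:P] = F.[z%:P] \Po (h.[x]%:P + k).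
      by apply: poly_fun_eq => s; rewrite f3 horner_comp hornerD hornerC.
    by rewrite deriv_comp hornerM horner_comp derivD derivC add0r hornerD hornerC deriv_col.
  have E3 x y z : D3 x y z = (dX F).[z, h.[x] + k.[y]].
    by rewrite /D3 -zcol_deriv EF deriv_slice.
  have kd : k^`().[y0] != 0 by apply: contraNneq d2 => E; rewrite E2 E mulr0.
  have hd : h^`() != 0 by apply: contraNneq d1 => E; rewrite E1 E horner0 mulr0.
  have [|| l [g Eg]] := @translation_form R A1 (k^`().[y0] *: A2) F A10; first by rewrite scaler_eq0 negb_or kd A20.
    apply/subr0_eq/poly2_fun0 => z t; set V := (_ - _).
    suff -> : V.[z%:P] = 0 by rewrite horner0.
    (* The equation is known for t = h(x) + k(y0) only; as [h] is not constant, this suffices for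
       polynomials in t. *)
    apply: (@comp_poly_inj0 _ (h + k.[y0]%:P)); first by rewrite derivD derivC addr0.
    apply: poly_fun0 => x; rewrite horner_comp.
    have -> : (h + k.[y0]%:P).[x] = h.[x] + k.[y0] by rewrite hornerD hornerC.
    rewrite /V hornerD hornerN hornerD hornerN.
    rewrite 4!hornerM !hornerXpart hornerZ A1E A2E -E3 crossx E2; ring.
  exists g, h, k, l; left=> x y z; rewrite f3 Eg; congr (g.[_]); ring.
have [|F EF] := @factor_slices (fun x y => h.[x] * k.[y]); first by move=> i; apply: H.
have f3 x y z : (Fz z).[x, y] = F.[z, h.[x] * k.[y]] by rewrite -horner_zcol EF horner2_swapXY.
have E1 x y z : D1 x y z = (dY F).[z, h.[x] * k.[y]] * (k.[y] * h^`().[x]).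
  rewrite /D1 -[LHS]deriv_slice.
  have -> : (swapXY (Fz z)).[y%:P] = F.[z%:P] \Po (k.[y] *: h).
    by apply: poly_fun_eq => s; rewrite horner2_swapXY f3 horner_comp hornerZ mulrC.
  by rewrite deriv_comp hornerM horner_comp derivZ !hornerZ deriv_col [k.[y] * h.[x]]mulrC.
have E2 x y z : D2 x y z = (dY F).[z, h.[x] * k.[y]] * (h.[x] * k^`().[y]).
  rewrite /D2 -[LHS]deriv_col.
  have -> : (Fz z).[x%:P] = F.[z%:P] \Po (h.[x] *: k).
    by apply: poly_fun_eq => s; rewrite f3 horner_comp hornerZ.
  by rewrite deriv_comp hornerM horner_comp derivZ !hornerZ deriv_col.
have E3 x y z : D3 x y z = (dX F).[z, h.[x] * k.[y]].
  by rewrite /D3 -zcol_deriv EF deriv_slice.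
have kd : k^`().[y0] != 0 by apply: contraNneq d2 => E; rewrite E2 E !mulr0.
have k0 : k.[y0] != 0 by apply: contraNneq d1 => E; rewrite E1 E mul0r mulr0.
have hd : h^`() != 0 by apply: contraNneq d1 => E; rewrite E1 E horner0 !mulr0.
(* Here D2 = F_t h k', and the factor [k.[y0]] completes h(x) to t, which produces the Euler term t
   F_t. *)
have [||| l [g [j Eg]]] := @dilation_form R (k.[y0] *: A1) (k^`().[y0] *: A2) F.
- by rewrite scaler_eq0 negb_or k0.
- by rewrite scaler_eq0 negb_or kd.
- apply/subr0_eq/poly2_fun0 => z t; set V := (_ - _).
  suff -> : V.[z%:P] = 0 by rewrite horner0.
  apply: (@comp_poly_inj0 _ (k.[y0] *: h)); first by rewrite derivZ scaler_eq0 negb_or k0.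
  apply: poly_fun0 => x; rewrite horner_comp.
  have -> : (k.[y0] *: h).[x] = h.[x] * k.[y0] by rewrite hornerZ mulrC.
  rewrite /V hornerD hornerN hornerD hornerN.
  rewrite 6!hornerM !hornerXpart hornerYpart hornerX !hornerZ A1E A2E -E3.
  by rewrite -[k.[y0] * _ * _]mulrA crossx E2; ring.
exists g, (h ^+ j), (k ^+ j), l; right=> x y z; rewrite f3 Eg !horner_exp; congr (g.[_]).
by rewrite exprMn mulrC.
Qed.

End Trivariate.

(** * From square grids to arbitrary finite sets *)

Section Growth.
Variable R : realType.

Lemma block_size (L n : nat) : (0 < L)%N -> exists s, (L * (s * s) <= n < L * (s.+1 * s.+1))%N.
Proof.
move=> L0; elim: n => [|n [s /andP[sn ns]]]; first by exists 0%N; rewrite !muln0 !muln1.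
have [lt|ge] := ltnP n.+1 (L * (s.+1 * s.+1))%N; first by exists s; rewrite leqW.
exists s.+1; rewrite ge /=; apply: leq_ltn_trans ns _; nia.
Qed.

Lemma powR_square (x : R) : 0 <= x -> exp.powR (x ^+ 2) (3%:R / 2%:R) = x ^+ 3.
Proof.
move=> x0; rewrite -exp.powR_mulrn // -exp.powRrM -(exp.powR_mulrn 3) //.
by congr (exp.powR _ _); rewrite mulrC divfK // pnatr_eq0.
Qed.

(** Either [s <= 2 * C], and [s ^ 3] is at most a constant while [M] is positive, or [C * s] is at
    most half of [s ^ 3]. *)
Lemma cubic_absorb (C M s : nat) : (0 < s -> 0 < M -> s ^ 3 <= C * (M + s) ->
  s ^ 3 <= (2 * C + 8 * C ^ 3 + 1) * M)%N.
Proof.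
move=> s0 M0 H; have [sC|Cs] := leqP s (2 * C)%N.
  have : (s ^ 3 <= (2 * C) ^ 3)%N by rewrite leq_exp2r.
  by rewrite expnMn -[(2 ^ 3)%N]/8%N; move: (C ^ 3)%N (s ^ 3)%N => c3 s3; nia.
have : (2 * (C * s) <= s ^ 3)%N by rewrite !expnS expn0 muln1; nia.
by move: (C ^ 3)%N (s ^ 3)%N H => c3 s3; nia.
Qed.

(** [K] elements are reserved for roots to be avoided. With [L = q + K] and L s^2 <= n < L (s +
    1)^2, a positive [s] leaves room for the grid and the reserve, and n^(3/2) <= (L (s + 1))^3 <= 8
    L^3 s^3; for [s = 0] the positivity of [M] suffices. *)
Lemma cubic_growth (C K q : nat) : (0 < q)%N -> exists c : R, 0 < c /\ forall n M : nat,
  ((0 < n)%N -> (0 < M)%N) ->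
  (forall s, (0 < s)%N -> (q * (s * s) + K <= n)%N -> (s ^ 3 <= C * (M + s))%N) ->
  c * exp.powR n%:R (3%:R / 2%:R) <= M%:R.
Proof.
move=> q0; pose L := (q + K)%N; pose D := (8 * L ^ 3 * (2 * C + 8 * C ^ 3 + 1))%N.
have L0 : (0 < L)%N by rewrite /L; lia.
have D0 : (0 < D)%N by rewrite /D muln_gt0 addn1 andbT muln_gt0 /= expn_gt0 L0.
exists (D%:R)^-1; split=> [|n M Mn H]; first by rewrite invr_gt0 ltr0n.
have [n0|n0] := posnP n.
  by rewrite n0 exp.powR0 ?mulr0 ?ler0n // mulf_neq0 ?invr_eq0 ?pnatr_eq0.
have M0 := Mn n0; have [s /andP[sn ns]] := block_size n L0.
have : ((L * s.+1) ^ 3 <= D * M)%N.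
  have -> : (D * M = L ^ 3 * (8 * ((2 * C + 8 * C ^ 3 + 1) * M)))%N.
    by rewrite /D; move: (L ^ 3)%N (2 * C + 8 * C ^ 3 + 1)%N => l3 x; ring.
  rewrite expnMn leq_mul2l; apply/orP; right.
  have [->|s0] := posnP s; first by rewrite exp1n; nia.
  have /H : (q * (s * s) + K <= n)%N by apply: leq_trans sn; rewrite /L mulnDl leq_add2l leq_pmulr // muln_gt0 s0.
  move/(_ s0) => Hs; have le8 : (s.+1 ^ 3 <= 8 * s ^ 3)%N.
    by rewrite -[8%N]/(2 ^ 3)%N -expnMn leq_exp2r // mul2n -addnn; lia.
  apply: leq_trans le8 _; rewrite leq_mul2l /=; exact: cubic_absorb.
move=> big; rewrite -ler_pdivlMl ?invr_gt0 ?ltr0n // invrK -natrM.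
apply: le_trans (_ : (L * s.+1)%:R ^+ 3 <= _); last by rewrite -natrX ler_nat.
rewrite -powR_square ?ler0n //; apply: exp.ge0_ler_powR; rewrite ?nnegrE ?ler0n ?exprn_ge0 //.
  by rewrite divr_ge0 ?ler0n.
rewrite -natrX ler_nat; apply: leq_trans (ltnW ns) _; rewrite expnMn expnS expn1 -mulnA; nia.
Qed.

(** The grid lemmas want sequences that increase on all of [nat], so the sorted list of elements
    that are not roots of [e] is continued past position [N.-1] in steps of 1. *)
Lemma increasing_sequence (A : {fset R}) (e : {poly R}) (K N : nat) : e != 0 -> (size e <= K)%N ->
  (0 < N)%N -> (N + K <= #|` A|)%N ->
  exists a : nat -> R, (forall i, a i < a i.+1) /\
    forall k, (k < N)%N -> a k \in A /\ e.[a k] != 0.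
Proof.
move=> e0 eK N0 NK; pose s := sort <=%R [seq x <- enum_fset A | ~~ root e x].
have us : uniq s by rewrite sort_uniq filter_uniq // fset_uniq.
have sN : (N <= size s)%N.
  rewrite size_sort size_filter; have := count_predC (root e) (enum_fset A).
  rewrite -/(#|` A|); have : (count (root e) (enum_fset A) <= K)%N.
    rewrite -size_filter; case: (posnP (size [seq x <- enum_fset A | root e x])) => [->//|ne].
    apply: leq_trans (ltnW _) eK; apply: (max_poly_roots e0); first exact: filter_all.
    by rewrite filter_uniq // fset_uniq.
  rewrite -[size (enum_fset A)]/(#|` A|); move: (count _ _) (count _ _) NK => c1 c2; lia.
have ss : sorted <%R s by rewrite lt_sorted_uniq_le us sort_sorted //; exact: le_total.
pose a k := s`_(minn k N.-1) + (k - N.-1)%:R.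
exists a; split=> [i|k kN].
  rewrite /a; have [iN|Ni] := ltnP i N.-1.
    have -> : (i - N.-1 = 0)%N by lia.
    have -> : (i.+1 - N.-1 = 0)%N by lia.
    rewrite (minn_idPl iN) !addr0.
    have iN' : (i.+1 < N)%N by lia.
    apply: (sorted_ltn_nth lt_trans 0 ss); rewrite ?inE ?leqnn //; last exact: leq_trans iN' sN.
    exact: leq_trans (ltnW iN') sN.
  by rewrite (minn_idPr (leqW Ni)) ltrD2l ltr_nat; lia.
have kN' : (k <= N.-1)%N by lia.
have ks : (k < size s)%N by apply: leq_trans sN.
have -> : a k = s`_k by rewrite /a (minn_idPl kN') (eqP (_ : k - N.-1 == 0)%N) ?subn_eq0 // addr0.
by have := mem_nth 0 ks; rewrite mem_sort mem_filter => /andP[].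
Qed.

Lemma fset_enumeration (D : {fset R}) : exists val : 'I_#|` D| -> R,
  injective val /\ forall y, y \in D -> exists v, y = val v.
Proof.
exists (fun v => (enum_fset D)`_v); split=> [u v /eqP|y yD].
  by rewrite nth_uniq ?fset_uniq // => /eqP/val_inj.
have lt : (index y (enum_fset D) < #|` D|)%N by rewrite index_mem.
by exists (Ordinal lt); rewrite nth_index.
Qed.

Lemma increasing_inj (a : nat -> R) : (forall i, a i < a i.+1) -> injective a.
Proof.
move=> ai i j E; apply/eqP/negPn/negP; rewrite neq_ltn => /orP[] lt.
  by have := homo_ltn lt_trans ai lt; rewrite E ltxx.
by have := homo_ltn lt_trans ai lt; rewrite E ltxx.
Qed.

Definition grid_image (phi : R -> R -> R -> R) (A B C : {fset R}) : {fset R} :=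
  [fset phi p.1.1 p.1.2 p.2 | p in ((A `*` B) `*` C)%fset]%fset.

Lemma in_grid_image phi (A B C : {fset R}) a b c : a \in A -> b \in B -> c \in C ->
  phi a b c \in grid_image phi A B C.
Proof. by move=> aA bB cC; apply/imfsetP; exists (a, b, c); rewrite //= !inE /= aA bB. Qed.

Definition expanding (c : R) (phi : R -> R -> R -> R) : Prop := forall (n : nat) (A B C : {fset R}),
  #|` A| = n -> #|` B| = n -> #|` C| = n ->
  c * exp.powR n%:R (3%:R / 2%:R) <= #|` grid_image phi A B C|%:R.

Lemma grid_image_gt0 phi (A B C : {fset R}) n : #|` A| = n -> #|` B| = n -> #|` C| = n ->
  (0 < n)%N -> (0 < #|` grid_image phi A B C|)%N.
Proof.
move=> An Bn Cn n0; have ne (D : {fset R}) : #|` D| = n -> exists x, x \in D.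
  by move=> Dn; apply/fset0Pn; rewrite -cardfs_gt0 Dn.
have [[a aA] [b bB] [c cC]] := And3 (ne A An) (ne B Bn) (ne C Cn).
by rewrite cardfs_gt0; apply/fset0Pn; exists (phi a b c); apply: in_grid_image.
Qed.

Lemma expanding3 (d : nat) : exists c : R, 0 < c /\ forall T : {poly {poly {poly R}}},
  (forall z, bideg_le d (zslice T z)) -> (forall x y, size (zcol T x y) <= d.+1)%N ->
  (exists z z', jac (zslice T z) (zslice T z') != 0) ->
  expanding c (fun x y z => (zslice T z).[x, y]).
Proof.
have [C [K H]] := trivariate_growth R d.
have [c [c0 Hc]] := @cubic_growth C K d.+1 isT.
exists c; split=> // T Td Ts [z [z' J]] n A B E An Bn En.
have [e [e0 eK He]] := H (zslice T) (zcol T) z z' Td Ts (horner_zcol T) J.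
apply: Hc => [|s s0 sn]; first exact: grid_image_gt0 En.
rewrite mulnA in sn; have N0 : (0 < d.+1 * s * s)%N by rewrite !muln_gt0 s0.
have seq (D : {fset R}) : #|` D| = n -> _ := fun Dn =>
  @increasing_sequence D e K _ e0 eK N0 (eq_ind_r (fun m => (_ <= m)%N) sn Dn).
have [a [ai aA]] := seq A An; have [b [bi bB]] := seq B Bn; have [cc [ci cE]] := seq E En.
have [val [vinj vals]] := fset_enumeration (grid_image (fun x y z => (zslice T z).[x, y]) A B E).
apply: (He a b cc s _ val s0 ai bi (increasing_inj ci)) => // [k /aA[]//|k l i /aA[ak _] /bB[bl _] /cE[ci' _]].
by apply: vals; apply: (in_grid_image (fun x y z => (zslice T z).[x, y])).
Qed.

Lemma expanding2 (d : nat) : exists c : R, 0 < c /\ forall g : {poly {poly R}},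
  bideg_le d g -> nonspecial g -> expanding c (fun x y _ => g.[x, y]).
Proof.
have [C [K H]] := bivariate_growth R d.
have [c [c0 Hc]] := @cubic_growth C K 1 isT.
exists c; split=> // g gd gs n A B E An Bn En.
have [e1 [e2 [e10 e20 e1K e2K He]]] := H g gd gs.
apply: Hc => [|s s0 sn]; first exact: grid_image_gt0 En.
rewrite mul1n in sn; have N0 : (0 < s * s)%N by rewrite muln_gt0 s0.
have [|a [ai aA]] := @increasing_sequence A e1 K (s * s) e10 e1K N0; first by rewrite An.
have [|b [bi bB]] := @increasing_sequence B e2 K (s * s) e20 e2K N0; first by rewrite Bn.
have [z zE] : exists z, z \in E.
  apply/fset0Pn; rewrite -cardfs_gt0 En; apply: leq_trans N0 _; apply: leq_trans sn; exact: leq_addr.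
have [val [vinj vals]] := fset_enumeration (grid_image (fun x y _ => g.[x, y]) A B E).
apply: (He a b s _ val s0 ai bi) => // [k /aA[]//|l /bB[]//|k l /aA[ak _] /bB[bl _]].
by apply: vals; apply: (in_grid_image (fun x y _ => g.[x, y]) ak bl zE).
Qed.

End Growth.

(** * Multivariate polynomials *)

Section Tower.
Variable R : realType.
Implicit Types f : {mpoly R[3]}.
Notation P3 := {poly {poly {poly R}}}.
Implicit Types t : 'I_3 -> P3.

(** Iterated univariate polynomials give access to slices and derivatives. Three cyclic choices of
    [t] put each of the variables outermost in turn. *)
Definition tower t f : P3 := \sum_(m <- msupp f) (f@_m)%:P%:P%:P * \prod_i t i ^+ m i.

Lemma rmorph_tower (S : comNzRingType) (phi : {rmorphism P3 -> S}) t f :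
  phi (tower t f) = \sum_(m <- msupp f) phi (f@_m)%:P%:P%:P * \prod_i phi (t i) ^+ m i.
Proof.
rewrite rmorph_sum; apply: eq_bigr => m _; rewrite rmorphM rmorph_prod; congr (_ * _).
by apply: eq_bigr => i _; rewrite rmorphXn.
Qed.

Lemma horner_tower t f x y z : (zslice (tower t f) z).[x, y] = f.@[fun i => (zslice (t i) z).[x, y]].
Proof.
etransitivity; first exact: (rmorph_tower (eval2 x y \o horner_eval z%:P%:P) t f).
rewrite mevalE; apply: eq_bigr => m _; congr (_ * _).
by rewrite /= /horner_eval !hornerC.
Qed.

Lemma mdeg_le f m : m \in msupp f -> (m ord0 + m (lift ord0 ord0) + m ord_max <= total_degree f)%N.
Proof.
move/msize_mdeg_lt; rewrite mdegE !big_ord_recl big_ord0 addn0 /total_degree.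
have -> : lift ord0 (lift ord0 ord0) = ord_max :> 'I_3 by apply: val_inj.
case: (msize f) => // s; rewrite ltnS addnA; exact.
Qed.

Lemma bideg_tower t f z : (forall i, bideg_le 1 (zslice (t i) z)) ->
  bideg_le (total_degree f) (zslice (tower t f) z).
Proof.
move=> H; have -> := (rmorph_tower (horner_eval z%:P%:P) t f : zslice _ _ = _).
rewrite big_seq_cond; apply: bideg_le_sum => m; rewrite andbT => /mdeg_le le.
apply: bideg_leW le _; rewrite !big_ord_recl big_ord0 mulr1.
have -> : lift ord0 (lift ord0 ord0) = ord_max :> 'I_3 by apply: val_inj.
rewrite -[X in bideg_le X]add0n; apply: bideg_leM; first by rewrite /= /horner_eval hornerC; apply: bideg_leCC.
rewrite -addnA; apply: bideg_leM; first by rewrite -[X in bideg_le X]mul1n; apply: bideg_leX (H _).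
by apply: bideg_leM; rewrite -[X in bideg_le X]mul1n; apply: bideg_leX (H _).
Qed.

Lemma size_mulS (p q : {poly R}) a b : (size p <= a.+1)%N -> (size q <= b.+1)%N -> (size (p * q)%R <= (a + b).+1)%N.
Proof. by move=> pa qb; apply: leq_trans (size_polyMleq _ _) _; lia. Qed.

Lemma size_expS (p : {poly R}) a : (size p <= 2)%N -> (size (p ^+ a)%R <= a.+1)%N.
Proof.
move=> p2; elim: a => [|a IH]; first by rewrite expr0 size_poly1.
by rewrite exprS; apply: (@size_mulS _ _ 1 a).
Qed.

Lemma zcol_tower t f x y : (forall i, size (zcol (t i) x y) <= 2)%N ->
  (size (zcol (tower t f) x y) <= (total_degree f).+1)%N.
Proof.
move=> H; have -> := (rmorph_tower (map_poly (eval2 x y)) t f : zcol _ _ _ = _).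
rewrite big_seq_cond; apply: (big_ind (fun p : {poly R} => size p <= (total_degree f).+1)%N).
- by rewrite size_poly0.
- by move=> p q ps qs; apply: leq_trans (size_polyD _ _) _; rewrite geq_max ps.
move=> m; rewrite andbT => /mdeg_le le.
apply: (@leq_trans (0 + (m ord0 + (m (lift ord0 ord0) + m ord_max))).+1); last by rewrite add0n addnA ltnS.
rewrite !big_ord_recl big_ord0 mulr1.
have -> : lift ord0 (lift ord0 ord0) = ord_max :> 'I_3 by apply: val_inj.
apply: size_mulS; first by rewrite /= map_polyC size_polyC leq_b1.
by apply: size_mulS; [|apply: size_mulS]; apply: size_expS; apply: H.
Qed.

Definition varX : P3 := 'X%:P.
Definition varY : P3 := 'X%:P%:P.
Definition varZ : P3 := 'X.

Lemma zslice_vars z x y : [/\ (zslice varX z).[x, y] = x, (zslice varY z).[x, y] = y & (zslice varZ z).[x, y] = z].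
Proof. by rewrite /zslice /varX /varY /varZ !hornerC !hornerX !hornerC. Qed.

Lemma vars_le T : T \in [:: varX; varY; varZ] ->
  (forall z, bideg_le 1 (zslice T z)) /\ (forall x y, size (zcol T x y) <= 2)%N.
Proof.
rewrite !inE => /or3P[]/eqP->; split=> [z|x y]; rewrite /zslice /zcol /varX /varY /varZ.
- by rewrite hornerC bideg_le_X.
- by rewrite map_polyC size_polyC (leq_trans (leq_b1 _)).
- by rewrite hornerC bideg_le_Y.
- by rewrite map_polyC size_polyC (leq_trans (leq_b1 _)).
- by rewrite hornerX bideg_leCC.
- by rewrite map_polyX size_polyX.
Qed.

Definition towerZ := tower (tnth [tuple varX; varY; varZ]).
Definition towerX := tower (tnth [tuple varZ; varX; varY]).
Definition towerY := tower (tnth [tuple varY; varZ; varX]).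

Lemma meval_ext f (u v : 'I_3 -> R) : u =1 v -> f.@[u] = f.@[v].
Proof. by move=> uv; rewrite !mevalE; apply: eq_bigr => m _; congr (_ * _); apply: eq_bigr => i _; rewrite uv. Qed.

Lemma horner_towerZ f x y z : (zslice (towerZ f) z).[x, y] = eval3 f x y z.
Proof.
rewrite horner_tower; have [ex ey ez] := zslice_vars z x y.
by apply: meval_ext => -[[|[|[|]]]] // i; rewrite !(tnth_nth 0).
Qed.
Lemma horner_towerX f x y z : (zslice (towerX f) x).[y, z] = eval3 f x y z.
Proof.
rewrite horner_tower; have [ex ey ez] := zslice_vars x y z.
by apply: meval_ext => -[[|[|[|]]]] // i; rewrite !(tnth_nth 0).
Qed.
Lemma horner_towerY f x y z : (zslice (towerY f) y).[z, x] = eval3 f x y z.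
Proof.
rewrite horner_tower; have [ex ey ez] := zslice_vars y z x.
by apply: meval_ext => -[[|[|[|]]]] // i; rewrite !(tnth_nth 0).
Qed.

Lemma tower_perm_le (t : 3.-tuple P3) f : {subset t <= [:: varX; varY; varZ]} ->
  (forall z, bideg_le (total_degree f) (zslice (tower (tnth t) f) z)) /\
  (forall x y, size (zcol (tower (tnth t) f) x y) <= (total_degree f).+1)%N.
Proof.
move=> tv; have H i := vars_le (tv _ (mem_tnth i t)).
by split=> [z|x y]; [apply: bideg_tower | apply: zcol_tower] => i; have [] := H i.
Qed.

Lemma towerZ_le f : (forall z, bideg_le (total_degree f) (zslice (towerZ f) z)) /\
  (forall x y, size (zcol (towerZ f) x y) <= (total_degree f).+1)%N.
Proof. by apply: tower_perm_le => p; rewrite !inE. Qed.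
Lemma towerX_le f : (forall z, bideg_le (total_degree f) (zslice (towerX f) z)) /\
  (forall x y, size (zcol (towerX f) x y) <= (total_degree f).+1)%N.
Proof. by apply: tower_perm_le => p; rewrite !inE => /or3P[]->; rewrite ?orbT. Qed.
Lemma towerY_le f : (forall z, bideg_le (total_degree f) (zslice (towerY f) z)) /\
  (forall x y, size (zcol (towerY f) x y) <= (total_degree f).+1)%N.
Proof. by apply: tower_perm_le => p; rewrite !inE => /or3P[]->; rewrite ?orbT. Qed.

(* Substituting back the variables shows that [towerZ] is injective. *)
Lemma towerZ_inj f : towerZ f = 0 -> f = 0.
Proof.
move=> T0; pose v1 := horner_alg (Yvar R).
pose v2 := horner_eval (Xvar R) \o map_poly v1.
pose v3 := horner_eval (Zvar R) \o map_poly v2.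
have E1 (p : {poly R}) : v2 p%:P = v1 p by rewrite /v2 /= /horner_eval map_polyC hornerC.
have E2 g : v3 g%:P = v2 g by rewrite /v3 /= /horner_eval map_polyC hornerC.
have EC c : v3 c%:P%:P%:P = c%:MP.
  by rewrite E2 E1 /v1 horner_algC -mul_mpolyC mulr1.
rewrite [f]mpolyE -[RHS](rmorph0 v3) -T0; apply/esym.
etransitivity; first exact: (rmorph_tower v3).
apply: eq_bigr => m _; rewrite -mul_mpolyC mpolyXE_id; congr (_ * _); first exact: EC.
apply: eq_bigr => i _; congr (_ ^+ _).
case: i => -[|[|[|]]] // i; rewrite (tnth_nth 0); cbn [nth tval]; rewrite -?[LHS]/(v3 _) /varX /varY /varZ.
- rewrite E2 /v2 /= /horner_eval map_polyX hornerX; congr 'X_(_); apply: val_inj; by rewrite /= inordK.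
- rewrite E2 E1 /v1 horner_algX; congr 'X_(_); apply: val_inj; by rewrite /= inordK.
- rewrite /v3 /= /horner_eval map_polyX hornerX; congr 'X_(_); apply: val_inj; by rewrite /= inordK.
Qed.

Lemma eval3B f1 f2 x y z : eval3 (f1 - f2) x y z = eval3 f1 x y z - eval3 f2 x y z.
Proof. exact: mevalB. Qed.

Lemma mpoly_fun_eq f1 f2 : (forall x y z, eval3 f1 x y z = eval3 f2 x y z) -> f1 = f2.
Proof.
move=> E; apply/subr0_eq/towerZ_inj; apply: poly3_fun0 => x y z.
by rewrite horner_towerZ eval3B E subrr.
Qed.

Lemma eval3_compose (g : {poly R}) u x y z : eval3 (compose g u) x y z = g.[eval3 u x y z].
Proof.
rewrite /compose /eval3; elim/poly_ind: g => [|g c IH]; first by rewrite rmorph0 mevalC hornerC.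
rewrite rmorphD rmorphM /= horner_algX horner_algC mevalD mevalM IH hornerMXaddC; congr (_ + _).
by rewrite mevalZ meval1 mulr1.
Qed.

Lemma eval3_vars x y z : [/\ eval3 (Xvar R) x y z = x, eval3 (Yvar R) x y z = y & eval3 (Zvar R) x y z = z].
Proof. by split; rewrite /eval3 mevalXU (tnth_nth 0) /= inordK. Qed.

Definition fun_form (phi : R -> R -> R -> R) : Prop := exists g h k l : {poly R},
  (forall x y z, phi x y z = g.[h.[x] + k.[y] + l.[z]]) \/
  (forall x y z, phi x y z = g.[h.[x] * k.[y] * l.[z]]).

Lemma fun_form_mpoly f : fun_form (eval3 f) -> additive_form f \/ multiplicative_form f.
Proof.
move=> [g [h [k [l [E|E]]]]]; [left|right]; exists g, h, k, l; apply: mpoly_fun_eq => x y z;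
  have [ex ey ez] := eval3_vars x y z.
  by rewrite E eval3_compose /eval3 !mevalD -!/(eval3 _ _ _ _) !eval3_compose ex ey ez.
by rewrite E eval3_compose /eval3 !mevalM -!/(eval3 _ _ _ _) !eval3_compose ex ey ez.
Qed.

Lemma expanding_perm (c : R) (phi psi : R -> R -> R -> R) :
  [\/ forall x y z, psi x y z = phi x y z, forall x y z, psi y z x = phi x y z |
      forall x y z, psi z x y = phi x y z] -> expanding c psi -> expanding c phi.
Proof.
move=> E H n A B C An Bn Cn.
case: E => E; [have := H n A B C An Bn Cn | have := H n B C A Bn Cn An | have := H n C A B Cn An Bn];
  move/le_trans; apply; rewrite ler_nat; apply: fsubset_leq_card; apply/fsubsetP => v /imfsetP[[[p q] r]];
  rewrite /= !inE /= => /andP[/andP[pA qB] rC] ->; rewrite E; exact: in_grid_image.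
Qed.

Lemma expanding_le (c c' : R) phi : c' <= c -> expanding c phi -> expanding c' phi.
Proof.
move=> cc H n A B C An Bn Cn; apply: le_trans (H n A B C An Bn Cn).
by apply: ler_wpM2r => //; apply: exp.powR_ge0.
Qed.

Lemma bivariate_form (g : {poly {poly R}}) : ~~ nonspecial g ->
  exists p h k : {poly R}, (forall x y, g.[x, y] = p.[h.[x] + k.[y]]) \/
                           (forall x y, g.[x, y] = p.[h.[x] * k.[y]]).
Proof.
move=> gs; have [d0|dx] := eqVneq (dX g) 0.
  by exists g`_0, 0, 'X; left=> x y; rewrite {1}(dX_eq0 d0) !hornerC hornerX add0r.
have [d0|dy] := eqVneq (dY g) 0; last exact: bivariate_special.
have E : swapXY g = ((swapXY g)`_0)%:P by apply: dX_eq0; rewrite dX_swap d0 rmorph0.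
by exists (swapXY g)`_0, 'X, 0; left=> x y; rewrite -horner2_swapXY {1}E !hornerC hornerX addr0.
Qed.

End Tower.

Theorem corollary1p2 (R : realType) :
  exists c : nat -> R,
    (forall d : nat, 0 < c d) /\
    forall (f : {mpoly R[3]}) (n : nat) (A B C : {fset R}),
      #|` A| = n -> #|` B| = n -> #|` C| = n ->
      c (total_degree f) * exp.powR n%:R (3%:R / 2%:R)
        <= (#|` image3 f A B C|)%:R
      \/ (additive_form f \/ multiplicative_form f).
Proof.
have [c2 H2] := choice (@expanding2 R); have [c3 H3] := choice (@expanding3 R).
(* The minimum serves the bivariate and the trivariate bound at once. *)
exists (fun d => Num.min (c2 d) (c3 d)); split=> [d|f].
  by rewrite lt_min; have [-> _] := H2 d; have [-> _] := H3 d.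
set d := total_degree f; set c := Num.min _ _.
suff [H|H] : expanding c (eval3 f) \/ fun_form (eval3 f).
- by move=> n A B C An Bn Cn; left; apply: H.
- by move=> n A B C _ _ _; right; apply: fun_form_mpoly.
have [_ {}H2] := H2 d; have [_ {}H3] := H3 d.
have E2 g psi : bideg_le d g -> nonspecial g -> (forall x y z, psi x y z = g.[x, y]) -> expanding c psi.
  move=> gd gs E; apply: (expanding_le (_ : c <= c2 d)); first by rewrite ge_min lexx.
  by apply: expanding_perm (H2 g gd gs); apply: Or31 => x y z; rewrite E.
have [[Zd Zs] [Xd Xs] [Yd Ys]] := And3 (towerZ_le f) (towerX_le f) (towerY_le f).
have Ez := horner_towerZ f; have Ex := horner_towerX f; have Ey := horner_towerY f.
have E3 T phi : (forall z, bideg_le d (zslice T z)) -> (forall x y, size (zcol T x y) <= d.+1)%N ->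
    ~ (forall z z', jac (zslice T z) (zslice T z') = 0) ->
    [\/ forall x y z, (zslice T z).[x, y] = phi x y z, forall x y z, (zslice T x).[y, z] = phi x y z |
      forall x y z, (zslice T y).[z, x] = phi x y z] -> expanding c phi.
  move=> Td Ts J E; apply: (expanding_le (_ : c <= c3 d)); first by rewrite ge_min lexx orbT.
  have {}J : exists z z', jac (zslice T z) (zslice T z') != 0.
    apply: contrapT => nE; apply: J => z z'; apply/eqP/negPn/negP=> J0.
    by apply: nE; exists z, z'.
  apply: expanding_perm (H3 T Td Ts J); case: E => E; [apply: Or31|apply: Or32|apply: Or33] => x y z; exact: E.
(* A nonzero Jacobian in one of the three cyclic families of slices gives growth; what passes the
   three tests has vanishing Jacobians throughout. *)
have [Jz|/(E3 _ (eval3 f) Zd Zs)] := pselect (forall z z', jac (zslice (towerZ f) z) (zslice (towerZ f) z') = 0);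
  last by move=> H; left; apply: H; apply: Or31.
have [Jx|/(E3 _ (eval3 f) Xd Xs)] := pselect (forall z z', jac (zslice (towerX f) z) (zslice (towerX f) z') = 0);
  last by move=> H; left; apply: H; apply: Or32.
have [Jy|/(E3 _ (eval3 f) Yd Ys)] := pselect (forall z z', jac (zslice (towerY f) z) (zslice (towerY f) z') = 0);
  last by move=> H; left; apply: H; apply: Or33.
have const (p : {poly R}) : (forall s, p^`().[s] = 0) -> forall s, p.[s] = p.[0].
  by move=> p0 s; rewrite (deriv_eq0 (poly_fun0 p0)) !hornerC.
have none (D : R -> R -> R -> R) : ~ (exists x y z, D x y z != 0) -> forall x y z, D x y z = 0.
  by move=> nD x y z; apply/eqP/negPn/negP=> D0; apply: nD; exists x, y, z.
(* If a partial derivative vanishes identically, the bivariate dichotomy decides; the missing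
   variable enters the forms through the constant 0 in a sum or 1 in a product. *)
have [D1|/(none (fun _ _ _ => _))D1] := pselect (exists x y z, (dX (zslice (towerZ f) z)).[x, y] != 0); last first.
  have E x y z : (zslice (towerX f) 0).[y, z] = eval3 f x y z.
    rewrite Ex -(Ez 0) -(Ez x) -[LHS]horner2_swapXY -[RHS]horner2_swapXY; apply/esym/const => s.
    by rewrite deriv_slice; apply: D1.
  have [gs|/bivariate_form[p [h [k [G|G]]]]] := boolP (nonspecial (zslice (towerX f) 0)).
  - left; apply: expanding_perm (E2 _ (fun y z _ => (zslice (towerX f) 0).[y, z]) (Xd 0) gs (fun _ _ _ => erefl)).
    by apply: Or32 => x y z; apply: E.
  - by right; exists p, 0, h, k; left=> x y z; rewrite -E G hornerC add0r.
  - by right; exists p, 1, h, k; right=> x y z; rewrite -E G hornerC mul1r.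
have [D2|/(none (fun _ _ _ => _))D2] := pselect (exists x y z, (dY (zslice (towerZ f) z)).[x, y] != 0); last first.
  have E x y z : (zslice (towerY f) 0).[z, x] = eval3 f x y z.
    by rewrite Ey -(Ez x 0) -(Ez x y); apply/esym/const => s; rewrite deriv_col; apply: D2.
  have [gs|/bivariate_form[p [h [k [G|G]]]]] := boolP (nonspecial (zslice (towerY f) 0)).
  - left; apply: expanding_perm (E2 _ (fun z x _ => (zslice (towerY f) 0).[z, x]) (Yd 0) gs (fun _ _ _ => erefl)).
    by apply: Or33 => x y z; apply: E.
  - by right; exists p, k, 0, h; left=> x y z; rewrite -E G hornerC addr0 addrC.
  - by right; exists p, k, 1, h; right=> x y z; rewrite -E G hornerC mulr1 mulrC.
have [D3|/(none (fun _ _ _ => _))D3] := pselect (exists x y z, (zslice (towerZ f)^`() z).[x, y] != 0); last first.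
  have E x y z : (zslice (towerZ f) 0).[x, y] = eval3 f x y z.
    by rewrite -(Ez x y z) -[LHS]horner_zcol -[RHS]horner_zcol; apply/esym/const => s; rewrite zcol_deriv; apply: D3.
  have [gs|/bivariate_form[p [h [k [G|G]]]]] := boolP (nonspecial (zslice (towerZ f) 0)).
  - left; apply: expanding_perm (E2 _ (fun x y _ => (zslice (towerZ f) 0).[x, y]) (Zd 0) gs (fun _ _ _ => erefl)).
    by apply: Or31 => x y z; apply: E.
  - by right; exists p, h, k, 0; left=> x y z; rewrite -E G hornerC addr0.
  - by right; exists p, h, k, 1; right=> x y z; rewrite -E G hornerC mulr1.
right; have [||g [h [k [l [G|G]]]]] := @trivariate_special R (towerZ f) (zslice (towerX f)) (zslice (towerY f)) _ _ Jz Jx Jy D1 D2 D3.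
- by move=> x y z; rewrite Ex Ez.
- by move=> x y z; rewrite Ey Ez.
- by exists g, h, k, l; left=> x y z; rewrite -Ez G.
- by exists g, h, k, l; right=> x y z; rewrite -Ez G.
Qed.
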